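(* Let $\boldsymbol{\sigma} = (\sigma_n)_{n\in\mathbb{N}}$ be a primitive and algebraically irreducible sequence of unimodular substitutions over $\mathcal{A}=\{1,2\}$. Assume that there is $C > 0$ such that for each $\ell \in \mathbb{N}$, there is $n \ge 1$ with $(\sigma_{n},\ldots,\sigma_{n+\ell-1}) = (\sigma_{0},\ldots,\sigma_{\ell-1})$ and the language $\mathcal{L}_{\boldsymbol{\sigma}}^{(n+\ell)}$ is $C$-balanced. Then the $S$-adic shift $(X_{\boldsymbol{\sigma}},\Sigma,\mu)$, where $\Sigma$ stands for the shift and $\mu$ is the (unique) shift-invariant probability measure on $X_{\boldsymbol{\sigma}}$, is measurably conjugate to a rotation on the circle $\mathbb{S}^1$; in particular, it has pure discrete spectrum.
   Context: Let $\mathcal{A}=\{1,2\}$ and let $\mathcal{A}^*$ be the free monoid of finite words over $\mathcal{A}$ (with concatenation). A substitution over $\mathcal{A}$ is an endomorphism of the monoid $\mathcal{A}^*$ sending non-empty words to non-empty words. For $w\in\mathcal{A}^*$, $|w|_i$ is the number of occurrences of the letter $i$ in $w$. The incidence matrix of $\sigma$ is $M_\sigma = (|\sigma(j)|_i)_{i,j\in\mathcal{A}} \in \mathbb{N}^{2\times 2}$; $\sigma$ is unimodular if $|\det M_\sigma|=1$. Here $\mathbb{N}=\{0,1,2,\dots\}$. For a sequence of substitutions $\boldsymbol{\sigma} = (\sigma_n)_{n\in\mathbb{N}}$, put $M_n = M_{\sigma_n}$, $\sigma_{[k,\ell)} = \sigma_k \sigma_{k+1}\cdots\sigma_{\ell-1}$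 (composition) and $M_{[k,\ell)} = M_k M_{k+1}\cdots M_{\ell-1}$ for $0\le k\le \ell$. The sequence $\boldsymbol{\sigma}$ is primitive if for each $k\in\mathbb{N}$, $M_{[k,\ell)}$ is a positive matrix (all entries $>0$) for some $\ell>k$. It is algebraically irreducible if for each $k\in\mathbb{N}$ the characteristic polynomial of $M_{[k,\ell)}$ is irreducible (over $\mathbb{Q}$) for all sufficiently large $\ell$. The language of level $m\in\mathbb{N}$ is $\mathcal{L}_{\boldsymbol{\sigma}}^{(m)} = \{w\in\mathcal{A}^* : w \text{ is a factor (contiguous subword) of } \sigma_{[m,n)}(i) \text{ for some } i\in\mathcal{A},\ n\in\mathbb{N}\}$ (with $n \ge m$). A language $\mathcal{L}\subseteq\mathcal{A}^*$ is $C$-balanced if for all $u,v\in\mathcal{L}$ of the same length and all $j\in\mathcal{A}$ one has $-C\le |u|_j-|v|_j\le C$. The shift $\Sigma$ maps $(\omega_n)_{n\in\mathbb{N}}$ to $(\omega_{n+1})_{n\in\mathbb{N}}$. The $S$-adic shift of $\boldsymbol{\sigma}$ is $(X_{\boldsymbol{\sigma}},\Sigma)$, where $X_{\boldsymbol{\sigma}}\subseteq\mathcal{A}^{\mathbb{N}}$ is the set of (one-sided) infinite words all of whose finite factors belong to $\mathcal{L}_{\boldsymbol{\sigma}}^{(0)}$, with the product topology of the discrete topology. Under the hypotheses of the statement it is known that $(X_{\boldsymbol{\sigma}},\Sigma)$ is minimal and uniquely ergodic, i.e. there is exactly one shift-invariant Borel probability measure on $X_{\boldsymbol{\sigma}}$.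 A measurable eigenfunction of $(X,\Sigma,\mu)$ with eigenvalue $\alpha\in\mathbb{R}$ is $f\in L^2(X,\mu)$ with $f(\Sigma^n\omega)=e^{2\pi i\alpha n}f(\omega)$ for all $n \in \mathbb{N}$ and $\omega \in X$ (as usual for $L^2$ functions, up to null sets). The system has pure discrete spectrum if $L^2(X,\mu)$ is spanned (in the closed linear sense) by its measurable eigenfunctions. The circle $\mathbb{S}^1\cong\mathbb{R}/\mathbb{Z}$ carries its normalized Haar (Lebesgue) measure. *)

(* Defs.v *)
From HB Require Import structures.
From mathcomp Require Import all_boot all_order all_algebra.
From mathcomp Require Import complex.
From mathcomp Require Import all_classical all_reals all_analysis.

Set Implicit Arguments.
Unset Strict Implicit.
Unset Printing Implicit Defensive.

Import Order.TTheory GRing.Theory Num.Theory.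
Import numFieldNormedType.Exports.

Local Open Scope classical_set_scope.
Local Open Scope ring_scope.

(* The alphabet {1, 2} is 'I_2 (letters 0 and 1), and the free monoid over it
   is seq 'I_2 under concatenation. *)
Notation letter := 'I_2.
HB.instance Definition _ (n : nat) := isPointed.Build 'I_n.+1 ord0.
Definition word := seq letter.

Definition is_substitution (s : word -> word) : Prop :=
  [/\ s [::] = [::],
      forall u v, s (u ++ v) = s u ++ s v &
      forall u, u != [::] -> s u != [::]].

Definition incidence (s : word -> word) : 'M[int]_2 :=
  \matrix_(i, j) (count_mem i (s [:: j]))%:Z.

Definition unimodular (s : word -> word) : Prop := `|\det (incidence s)| = 1.

Section SequencesOfSubstitutions.
Variable sigma : nat -> word -> word.

(* sigma_k \o (sigma_(k+1) \o ... \o sigma_(l-1)); the identity if l <= k. *)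
Definition subst_prod (k l : nat) : word -> word :=
  \big[(fun f g : word -> word => f \o g)/id]_(k <= n < l) sigma n.

Definition incidence_prod (k l : nat) : 'M[int]_2 :=
  \prod_(k <= n < l) incidence (sigma n).

Definition primitive : Prop :=
  forall k, exists2 l, (k < l)%N & forall i j, 0 < incidence_prod k l i j.

Definition algebraically_irreducible : Prop :=
  forall k, exists l0, forall l, (k <= l)%N -> (l0 <= l)%N ->
    irreducible_poly
      (map_poly (intr : int -> rat) (char_poly (incidence_prod k l))).

Definition language (m : nat) : set word :=
  [set w | exists (i : letter) (n : nat),
     (m <= n)%N /\ infix w (subst_prod m n [:: i])].

End SequencesOfSubstitutions.

Definition balanced (R : realType) (C : R) (L : set word) : Prop :=
  forall u v, L u -> L v -> size u = size v -> forall j : letter,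
    - C <= (count_mem j u)%:R - (count_mem j v)%:R <= C.

Definition infinite_word :=
  g_sigma_algebraType
    (@open (prod_topology (fun _ : nat => discrete_topology letter))).

Definition wshift (w : infinite_word) : infinite_word := fun n => w n.+1.

Definition sadic_shift (sigma : nat -> word -> word) : set infinite_word :=
  [set w | forall a n : nat, language sigma 0 (mkseq (fun i => w (a + i)%N) n)].

(* A Borel probability measure on the subshift X is represented by its
   extension to all infinite words, i.e. by one giving full mass to X (which is
   closed, hence Borel). *)
Definition shift_invariant_on (R : realType) (X : set infinite_word)
    (mu : probability infinite_word R) : Prop :=
  mu X = 1%E /\
  forall A : set infinite_word, measurable A -> mu (wshift @^-1` A) = mu A.

(* Isomorphism modulo null sets: a bimeasurable, measure-preserving, equivariant
   bijection phi between forward-invariant sets X1 and X2 of full measure, with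
   inverse psi. *)
Definition measurably_conjugate (R : realType) (d1 d2 : measure_display)
    (T1 : measurableType d1) (T2 : measurableType d2)
    (mu1 : {measure set T1 -> \bar R}) (f1 : T1 -> T1)
    (mu2 : {measure set T2 -> \bar R}) (f2 : T2 -> T2) : Prop :=
  exists (X1 : set T1) (X2 : set T2) (phi : T1 -> T2) (psi : T2 -> T1),
    [/\ [/\ measurable X1, mu1 (~` X1) = 0%E & f1 @` X1 `<=` X1],
        [/\ measurable X2, mu2 (~` X2) = 0%E & f2 @` X2 `<=` X2],
        [/\ phi @` X1 `<=` X2, psi @` X2 `<=` X1,
            {in X1, cancel phi psi} & {in X2, cancel psi phi}],
        measurable_fun X1 phi /\ measurable_fun X2 psi &
        (forall B, measurable B -> mu1 (X1 `&` phi @^-1` B) = mu2 (X2 `&` B)) /\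
        {in X1, forall x, phi (f1 x) = f2 (phi x)}].

(* The circle R/Z is represented by its fundamental domain [0, 1[ in R: its Haar
   measure is the restriction of the Lebesgue measure, and the rotation by alpha
   is addition of alpha modulo 1. *)
Definition circle_measure (R : realType) :
    {measure set (measurableTypeR R) -> \bar R} :=
  mrestr (@lebesgue_measure R) (measurable_itv `[0 : R, 1[).

Definition rotation (R : realType) (alpha : R)
    (x : measurableTypeR R) : measurableTypeR R :=
  x + alpha - (Num.floor (x + alpha))%:~R.

Section Spectrum.
Context (R : realType) (d : measure_display) (T : measurableType d).
Variables (mu : {measure set T -> \bar R}) (f : T -> T).
Local Notation Re := complex.Re.
Local Notation Im := complex.Im.

Definition square_integrable (g : T -> R[i]) : Prop :=
  [/\ measurable_fun setT (fun x => Re (g x)),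
      measurable_fun setT (fun x => Im (g x)) &
      (\int[mu]_x ((Re (g x) ^+ 2 + Im (g x) ^+ 2)%:E) < +oo)%E].

Definition expi (t : R) : R[i] := (cos t +i* sin t)%C.

Definition eigenfunction (alpha : R) (g : T -> R[i]) : Prop :=
  square_integrable g /\
  {ae mu, forall x, forall n : nat,
     g (iter n f x) = expi (2 * pi * alpha * n%:R) * g x}.

(* Finite linear combinations of eigenfunctions are dense in L^2. *)
Definition pure_discrete_spectrum : Prop :=
  forall g, square_integrable g -> forall eps : R, 0 < eps ->
  exists (N : nat) (c : 'I_N -> R[i]) (h : 'I_N -> T -> R[i]),
    (forall k, exists alpha, eigenfunction alpha (h k)) /\
    (\int[mu]_x
       ((Re (g x - \sum_(k < N) c k * h k x) ^+ 2 +
         Im (g x - \sum_(k < N) c k * h k x) ^+ 2)%:E) < eps%:E)%E.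

End Spectrum.

(* Main.v *)
Require Import Defs.
From HB Require Import structures.
From mathcomp Require Import all_boot all_order all_algebra.
From mathcomp Require Import complex.
From mathcomp Require Import all_classical all_reals all_analysis.
From mathcomp Require Import measurable_realfun.
From mathcomp Require Import zify ring lra.

Set Implicit Arguments.
Unset Strict Implicit.
Unset Printing Implicit Defensive.

Import Order.TTheory GRing.Theory Num.Theory.
Import numFieldNormedType.Exports.

Local Open Scope classical_set_scope.
Local Open Scope ring_scope.

(* The hypotheses yield a frequency [f] of the letter 0, irrational by primitivity
   and unimodularity, and infinitely many balanced levels; balance bounds the
   deviations [|w_0 ... w_(n-1)|_0 - n f] over the shift [X]. Let [h w] be the
   upper limit of the deviations of [w] in [X]. Then [h (wshift w) = h w - [w_0 = 0] + f]
   on [X], so the fractional part [phi] of [h] is a factor map onto the rotation by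
   [f], and it maps the invariant measure to the Lebesgue measure.

   To see that [phi] is injective almost everywhere, read words as lattice paths.
   Two paths that stay close to the line of frequency [f] cross, hence at a high
   level they pass through common vertices with bounded gaps. By the strong
   coincidence of the two letters and the recurrence of the initial block of
   substitutions, each such vertex leads to a common edge of a lower level. By
   iterating this at lower and lower levels, the proportion of distinct edges is
   contracted to 0. So if [h w - h w'] is close to an integer, then [w] and [w']
   agree on a long initial segment up to a small proportion of letters. By
   invariance of the measure, the letter [w_0] is then approximated by Borel
   functions of [phi w], and therefore equal to one almost everywhere.

   The functions [exp (2 pi i k phi)] are eigenfunctions. Their combinations
   approximate indicators of arcs in the variable [phi], hence of all Borel sets,
   and thus all of L^2. *)

(** A common vertex is not enough: the two paths may leave it along different letters, and only a
    coincidence some levels further down yields a common edge. For the proportion of distinct edges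
    to tend to 0, each round of the contraction must gain the same factor. All constants behind this
    factor are therefore read off from one initial block of substitutions, and recurrence copies
    this block to arbitrarily high levels; the additive errors of a round are absorbed by choosing
    the copy high enough.

    Unimodularity makes the two steps of each level a basis of the lattice and forces their
    transversal parts to be small once they are long. Hence a vector close to the line is either
    short, or a nonnegative combination of both steps.

    An upper limit, unlike a supremum over all prefixes, is not affected by deleting a first letter,
    so [h] satisfies an exact relation along the shift. Closeness modulo integers suffices because
    translating a path by [(k, -k)] preserves the number of letters read and changes the transversal
    position by [k]. *)

Notation vec := (int * int)%type.
Local Notation La := (@ord0 1).
Local Notation Lb := (@ord_max 1).

(** * Words, lattice paths and substitutions *)

Lemma vec_eq (u v : vec) : u.1 = v.1 -> u.2 = v.2 -> u = v.
Proof. by case: u v => ? ? [? ?] /= -> ->. Qed.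

Lemma letterP (i : letter) : i = La \/ i = Lb.
Proof.
by case: i => [[|[|//]] h]; [left | right]; apply/val_inj.
Qed.

(* Abelianization: a word is read as the lattice path through the points
   [ab p], for [p] running over its prefixes. *)
Definition ab (w : word) : vec := ((count_mem La w)%:Z, (count_mem Lb w)%:Z).

Lemma ab_cat u v : ab (u ++ v) = ab u + ab v.
Proof. by apply: vec_eq; rewrite /= count_cat PoszD. Qed.

Lemma ab_cons i w : ab (i :: w) = ab [:: i] + ab w.
Proof. by rewrite -cat1s ab_cat. Qed.

Lemma ab_ge0 w : 0 <= (ab w).1 /\ 0 <= (ab w).2.
Proof. by []. Qed.

Lemma size_ab w : (size w)%:Z = (ab w).1 + (ab w).2.
Proof.
elim: w => [//|i w IH]; rewrite ab_cons /= in IH *.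
case: (letterP i) => -> /=; lia.
Qed.

Arguments ab : simpl never.

(* The action of the incidence matrix of [s] on [vec]. *)
Definition lmap (s : word -> word) (v : vec) : vec :=
  ((ab (s [:: La])).1 * v.1 + (ab (s [:: Lb])).1 * v.2,
   (ab (s [:: La])).2 * v.1 + (ab (s [:: Lb])).2 * v.2).

Lemma lmapD s u v : lmap s (u + v) = lmap s u + lmap s v.
Proof. by apply: vec_eq => /=; ring. Qed.

Lemma lmapN s v : lmap s (- v) = - lmap s v.
Proof. by apply: vec_eq => /=; ring. Qed.

Lemma lmapB s u v : lmap s (u - v) = lmap s u - lmap s v.
Proof. by rewrite lmapD lmapN. Qed.

Lemma cat_prefix_drop (u x v y : word) : u ++ x = v ++ y -> (size u <= size v)%N ->
  v = u ++ drop (size u) v.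
Proof.
move=> h hs; rewrite -{1}(cat_take_drop (size u) v); congr (_ ++ _).
by have := congr1 (take (size u)) h; rewrite take_size_cat // takel_cat.
Qed.

Section Substitution.
Variable s : word -> word.
Hypothesis hs : is_substitution s.

Lemma subst_nil : s [::] = [::]. Proof. by case: hs. Qed.

Lemma subst_cat u v : s (u ++ v) = s u ++ s v. Proof. by case: hs. Qed.

Lemma subst_cons i w : s (i :: w) = s [:: i] ++ s w.
Proof. by rewrite -cat1s subst_cat. Qed.

Lemma subst_size_gt0 i : (0 < size (s [:: i]))%N.
Proof. by rewrite lt0n size_eq0; case: hs => _ _; apply. Qed.

Lemma leq_size_subst w : (size w <= size (s w))%N.
Proof.
elim: w => [|i w IH] //; rewrite subst_cons size_cat /=.
by have := subst_size_gt0 i; lia.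
Qed.

Lemma ab_subst w : ab (s w) = lmap s (ab w).
Proof.
elim: w => [|i w IH].
  by rewrite subst_nil; apply: vec_eq; rewrite /lmap /ab /= ?mulr0 ?addr0.
rewrite subst_cons ab_cat ab_cons lmapD -IH; congr (_ + _).
by case: (letterP i) => ->; apply: vec_eq; rewrite /lmap /ab /=; ring.
Qed.

Lemma prefix_subst_letter (w u : word) : prefix w (s u) ->
  exists (v x : word) j, [/\ prefix v u, w = s v ++ x & prefix x (s [:: j])].
Proof.
elim: u w => [|i u IH] w.
  rewrite subst_nil => /prefixP[x]; case: w => // _.
  by exists [::], [::], La; rewrite subst_nil !prefix0s.
rewrite subst_cons; case: (leqP (size (s [:: i])) (size w)) => hw.
  move=> /prefixP[x hx].
  have hw' := cat_prefix_drop hx hw.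
  have /IH[v [y [j [hv hy hs']]]] : prefix (drop (size (s [:: i])) w) (s u).
    apply/prefixP; exists x; move: hx; rewrite {1}hw' -catA.
    by move/eqP; rewrite eqseq_cat // => /andP[_ /eqP].
  exists (i :: v), y, j; rewrite prefix_cons eqxx hv; split => //.
  by rewrite subst_cons -catA -hy.
move=> /prefixP[x hx]; exists [::], w, i; rewrite subst_nil !prefix0s; split => //.
apply/prefixP; exists (drop (size w) (s [:: i])).
exact: cat_prefix_drop (esym hx) (ltnW hw).
Qed.

Lemma prefix_subst (M : nat) (w u : word) :
  (forall i, (size (s [:: i]) <= M)%N) -> prefix w (s u) ->
  exists v x : word, [/\ prefix v u, w = s v ++ x & (size x <= M)%N].
Proof.
move=> hM /prefix_subst_letter[v [x [j [hv hw hx]]]]; exists v, x; split => //.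
exact: leq_trans (size_prefix hx) (hM j).
Qed.

Lemma infix_subst (M : nat) (w u : word) :
  (forall i, (size (s [:: i]) <= M)%N) -> infix w (s u) ->
  exists x v y : word, [/\ infix v u, w = x ++ s v ++ y, (size x <= M)%N &
                    (size y <= M)%N].
Proof.
move=> hM; elim: u => [|i u IH].
  rewrite subst_nil infixs0 => /eqP ->.
  by exists [::], [::], [::]; rewrite subst_nil.
rewrite subst_cons => /infixP[p [q hpq]].
case: (leqP (size (s [:: i])) (size p)) => hp.
  have /IH[x [v [y [hv -> hx hy]]]] : infix w (s u).
    apply/infixP; exists (drop (size (s [:: i])) p), q.
    have := congr1 (drop (size (s [:: i]))) hpq.
    rewrite (@drop_size_cat _ _ (s [:: i])) // drop_cat; case: ltnP => // h.
    have -> : size (s [:: i]) = size p by lia.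
    by rewrite subnn drop0 drop_size.
  exists x, v, y; split => //.
  exact: infix_trans hv (infix_cons _ _).
(* If [w] ends within the image of [i], the desubstituted word [v] is empty. *)
case: (leqP (size p + size w) (size (s [:: i]))) => hw.
  exists w, [::], [::]; rewrite subst_nil !cats0 infix0s; split => //.
  by apply: (leq_trans _ (hM i)); lia.
pose k := (size (s [:: i]) - size p)%N.
have hpre : prefix (drop k w) (s u).
  apply/prefixP; exists q.
  have := congr1 (drop (size (s [:: i]))) hpq.
  rewrite (@drop_size_cat _ _ (s [:: i])) // drop_cat ltnNge (ltnW hp) /= drop_cat -/k.
  by have -> : (k < size w)%N by rewrite /k; lia.
have [v [y [hv hy hs']]] := prefix_subst hM hpre.
exists (take k w), v, y; split => //.
- exact: prefix_infix_trans hv (infix_cons _ _).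
- by rewrite -hy cat_take_drop.
- by rewrite size_take; apply: (leq_trans _ (hM i)); rewrite /k; case: ifP; lia.
Qed.

End Substitution.

Lemma is_substitution_comp s t :
  is_substitution s -> is_substitution t -> is_substitution (s \o t).
Proof.
move=> [s0 sc sn] [t0 tc tn]; split => /=; first by rewrite t0.
  by move=> u v; rewrite tc sc.
by move=> u /tn /sn.
Qed.

Lemma lmap_comp s t : is_substitution s -> lmap (s \o t) =1 lmap s \o lmap t.
Proof.
move=> hs v; rewrite /= {1}/lmap !(ab_subst hs) /lmap.
by apply: vec_eq => /=; ring.
Qed.

Definition det2 (s : word -> word) : int :=
  (ab (s [:: La])).1 * (ab (s [:: Lb])).2 -
  (ab (s [:: Lb])).1 * (ab (s [:: La])).2.

Lemma det2_comp s t : is_substitution s -> det2 (s \o t) = det2 s * det2 t.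
Proof.
move=> hs; rewrite /det2 /comp !(ab_subst hs) /lmap.
case: (ab (s _)) (ab (s _)) (ab (t _)) (ab (t _)) => [a b] [c d] [x y] [z w] /=.
by ring.
Qed.

Lemma unimodular_det2 s : unimodular s -> `|det2 s| = 1.
Proof.
rewrite /unimodular (expand_det_row _ ord0) !big_ord_recl big_ord0 addr0.
have e1 : lift ord0 (ord0 : 'I_1) = Lb by apply/val_inj.
have e2 : lift Lb (ord0 : 'I_1) = La by apply/val_inj.
rewrite /cofactor !det_mx11 !mxE /= !e1 e2 expr0 expr1 mul1r mulN1r mulrN.
by [].
Qed.

Section Products.
Variable sigma : nat -> word -> word.
Hypothesis sigma_subst : forall n, is_substitution (sigma n).

Lemma subst_prod_geq k n : (n <= k)%N -> subst_prod sigma k n = id.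
Proof. by move=> h; rewrite /subst_prod big_geq. Qed.

Lemma subst_prod_ltn k n : (k < n)%N ->
  subst_prod sigma k n = sigma k \o subst_prod sigma k.+1 n.
Proof. by move=> h; rewrite /subst_prod big_ltn. Qed.

Lemma subst_prod_ind (P : nat -> (word -> word) -> Prop) n :
  (forall k, (n <= k)%N -> P k id) ->
  (forall k f, (k < n)%N -> P k.+1 f -> P k (sigma k \o f)) ->
  forall k, P k (subst_prod sigma k n).
Proof.
move=> h0 hS k; have [m] := ubnP (n - k)%N; elim: m k => // m IH k hm.
have [h|h] := leqP n k; first by rewrite subst_prod_geq //; apply: h0.
by rewrite subst_prod_ltn //; apply: hS => //; apply: IH; lia.
Qed.

Lemma is_substitution_prod k n : is_substitution (subst_prod sigma k n).
Proof.
apply: (subst_prod_ind (P := fun _ f => is_substitution f)) => // j f _ hf.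
exact: is_substitution_comp.
Qed.

Lemma subst_prod_comp k m n : (k <= m)%N -> (m <= n)%N ->
  subst_prod sigma k n = subst_prod sigma k m \o subst_prod sigma m n.
Proof.
move=> hkm hmn; have [d] := ubnP (m - k)%N; elim: d k hkm => // d IH k hkm hd.
have [h|h] := leqP m k; first by rewrite (subst_prod_geq h); congr subst_prod; lia.
rewrite (subst_prod_ltn h) subst_prod_ltn; last by lia.
by rewrite (IH k.+1) //; lia.
Qed.

Lemma subst_prod_compE k m n w : (k <= m)%N -> (m <= n)%N ->
  subst_prod sigma k n w = subst_prod sigma k m (subst_prod sigma m n w).
Proof. by move=> h1 h2; rewrite (subst_prod_comp h1 h2). Qed.

Lemma eq_subst_prod (tau : nat -> word -> word) k l p :
  (forall i, (i < p)%N -> sigma (k + i)%N = tau (l + i)%N) ->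
  subst_prod sigma k (k + p) = subst_prod tau l (l + p).
Proof.
elim: p k l => [|p IH] k l h; first by rewrite !addn0 /subst_prod !big_geq.
have hk : (k < k + p.+1)%N by rewrite -addn1; lia.
have hl : (l < l + p.+1)%N by rewrite -addn1; lia.
rewrite /subst_prod (big_ltn hk) (big_ltn hl).
have := h 0%N isT; rewrite !addn0 => ->; congr (_ \o _).
have := IH k.+1 l.+1; rewrite /subst_prod !addSnnS; apply=> i hi.
by rewrite !addSnnS h.
Qed.

Lemma det2_prod k n : (forall m, unimodular (sigma m)) ->
  `|det2 (subst_prod sigma k n)| = 1.
Proof.
move=> hu; apply: (subst_prod_ind (P := fun _ f => `|det2 f| = 1)) => // j f _ hf.
by rewrite det2_comp // normrM hf mulr1 unimodular_det2.
Qed.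

Lemma incidence_ab s i j :
  incidence s i j = if i == La then (ab (s [:: j])).1 else (ab (s [:: j])).2.
Proof. by rewrite mxE; case: (letterP i) => ->. Qed.

Lemma incidence_comp s t :
  is_substitution s -> incidence (s \o t) = incidence s *m incidence t.
Proof.
move=> hs; apply/matrixP => i j; rewrite [RHS]mxE !big_ord_recl big_ord0 addr0.
rewrite !incidence_ab /comp (ab_subst hs) /lmap.
have -> : lift ord0 (ord0 : 'I_1) = Lb by apply/val_inj.
by case: (letterP i) => -> /=; rewrite mulrC [X in _ + X]mulrC.
Qed.

Lemma incidence_id : incidence id = 1%:M.
Proof.
apply/matrixP => i j; rewrite !mxE /=.
by case: (letterP i) => ->; case: (letterP j) => ->.
Qed.

Lemma incidence_prodE k n :
  incidence_prod sigma k n = incidence (subst_prod sigma k n).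
Proof.
have [d] := ubnP (n - k)%N; elim: d k => // d IH k hd.
have [h|h] := leqP n k.
  by rewrite /incidence_prod big_geq // subst_prod_geq // incidence_id.
rewrite /incidence_prod big_ltn // subst_prod_ltn // incidence_comp //.
by rewrite -[in RHS]IH //; lia.
Qed.

Lemma primitive_ab : primitive sigma ->
  forall k, exists2 l, (k < l)%N &
    forall j, 0 < (ab (subst_prod sigma k l [:: j])).1 /\
              0 < (ab (subst_prod sigma k l [:: j])).2.
Proof.
move=> hp k; have [l hl h] := hp k; exists l => // j.
move: (h La j) (h Lb j); rewrite incidence_prodE !incidence_ab.
by have -> : (Lb == La) = false by [].
Qed.

Lemma language_infix m u w : language sigma m w -> infix u w -> language sigma m u.
Proof.
by move=> [i [n [h hw]]] hu; exists i, n; split => //; apply: infix_trans hu hw.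
Qed.

Lemma language_prod m n i : (m <= n)%N -> language sigma m (subst_prod sigma m n [:: i]).
Proof. by move=> h; exists i, n; split => //; apply: infix_refl. Qed.

End Products.

(** * Deviations from the letter frequency *)

Section Frequency.
Context (R : realType).

(* The coordinate of [v] transversal to the line on which the first letter has
   frequency [f]. *)
Definition tr (f : R) (v : vec) : R := v.1%:~R - f * (v.1 + v.2)%:~R.

Lemma trD f u v : tr f (u + v) = tr f u + tr f v.
Proof. by rewrite /tr /= !intrD; ring. Qed.

Lemma trN f v : tr f (- v) = - tr f v.
Proof. by rewrite /tr /= !intrD !intrN; ring. Qed.

Lemma trB f u v : tr f (u - v) = tr f u - tr f v.
Proof. by rewrite trD trN. Qed.

Lemma tr0 f : tr f 0 = 0.
Proof. by rewrite /tr /= mulr0 subr0. Qed.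

Lemma tr_lmap f s v :
  tr f (lmap s v) = tr f (ab (s [:: La])) * v.1%:~R + tr f (ab (s [:: Lb])) * v.2%:~R.
Proof.
rewrite /tr /lmap; case: (ab _) (ab _) v => [a b] [c d] [x y] /=.
by rewrite !(intrD, intrM); ring.
Qed.

Variable sigma : nat -> word -> word.
Hypothesis sigma_subst : forall n, is_substitution (sigma n).
Hypothesis sigma_unimodular : forall n, unimodular (sigma n).
Hypothesis sigma_primitive : primitive sigma.

Local Notation S := (subst_prod sigma).
Local Notation subst_prodP := (is_substitution_prod sigma_subst).

(** All levels share one lattice: a word of level [n] is drawn as the path of its image at level
    0. *)
Definition pos n w : vec := ab (subst_prod sigma 0 n w).
Definition len n i : nat := size (subst_prod sigma 0 n [:: i]).

Local Notation A := pos.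

Lemma pos_nil n : A n [::] = 0.
Proof. by rewrite /A (subst_nil (subst_prodP 0 n)). Qed.

Lemma pos_cat n u v : A n (u ++ v) = A n u + A n v.
Proof. by rewrite /A (subst_cat (subst_prodP 0 n)) ab_cat. Qed.

Lemma pos_cons n i w : A n (i :: w) = A n [:: i] + A n w.
Proof. by rewrite -cat1s pos_cat. Qed.

Lemma pos_lmap n w : A n w = lmap (S 0 n) (ab w).
Proof. by rewrite /A (ab_subst (subst_prodP 0 n)). Qed.

Lemma pos_comp n m w : (n <= m)%N -> A m w = A n (S n m w).
Proof. by move=> h; rewrite /A (@subst_prod_compE sigma 0 n m). Qed.

Lemma len_ab n i : (len n i)%:Z = (A n [:: i]).1 + (A n [:: i]).2.
Proof. exact: size_ab. Qed.

Lemma len_gt0 n i : (0 < len n i)%N.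
Proof. exact: (subst_size_gt0 (subst_prodP 0 n)). Qed.

Lemma size_cons n i w : size (S 0 n (i :: w)) = (len n i + size (S 0 n w))%N.
Proof.
by rewrite (subst_cons (subst_prodP 0 n)) size_cat.
Qed.

Lemma pos_ge0 n w : 0 <= (A n w).1 /\ 0 <= (A n w).2.
Proof. exact: ab_ge0. Qed.

Lemma tr_pos_len f n i : tr f (A n [:: i]) = (A n [:: i]).1%:~R - f * (len n i)%:R.
Proof. by rewrite /tr -len_ab. Qed.

(* The intervals spanned by the frequencies of the first letter in the two words
   [S 0 n [:: i]] are nested. *)
Lemma exists_frequency : exists f : R, forall n,
  tr f (A n [:: La]) * tr f (A n [:: Lb]) <= 0.
Proof.
pose sl n i : R := (A n [:: i]).1%:~R / (len n i)%:R.
have lenR n i : 0 < (len n i)%:R :> R by rewrite ltr0n len_gt0.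
have slE n i : (A n [:: i]).1%:~R = sl n i * (len n i)%:R.
  by rewrite /sl divfK // gt_eqF.
pose lo n := Num.min (sl n La) (sl n Lb).
pose hi n := Num.max (sl n La) (sl n Lb).
have hlo n i : lo n <= sl n i.
  by rewrite /lo; case: (letterP i) => ->; rewrite ge_min lexx ?orbT.
have hhi n i : sl n i <= hi n.
  by rewrite /hi; case: (letterP i) => ->; rewrite le_max lexx ?orbT.
(* The slope over an image is a weighted mean of the slopes over the images of single letters. *)
have key n w : lo n * (size (S 0 n w))%:R <= (A n w).1%:~R <= hi n * (size (S 0 n w))%:R.
  elim: w => [|i w /andP[IH1 IH2]].
    rewrite pos_nil (subst_nil (subst_prodP 0 n)).
    by rewrite !mulr0 lexx.
  rewrite pos_cons size_cons natrD !mulrDr intrD slE !lerD //.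
    by rewrite ler_wpM2r ?hhi // ltW.
  by rewrite ler_wpM2r ?hlo // ltW.
have mono n m i : (n <= m)%N -> lo n <= sl m i <= hi n.
  move=> h; have := key n (S n m [:: i]).
  rewrite -(@pos_comp n m) // -(@subst_prod_compE sigma 0 n m) // slE.
  by rewrite -/(len m i) !ler_pM2r.
have lohi n m : lo n <= hi m.
  have /andP[h1 _] := mono n (maxn n m) La (leq_maxl _ _).
  by have /andP[_ h2] := mono m (maxn n m) La (leq_maxr _ _); apply: le_trans h2.
have hsup : has_sup (range lo).
  by split; [exists (lo 0%N); exists 0%N | exists (hi 0%N) => _ [n _ <-]].
exists (sup (range lo)) => n.
have h1 : lo n <= sup (range lo) by apply: sup_upper_bound => //; exists n.
have h2 : sup (range lo) <= hi n.
  by apply: ge_sup => [|_ [m _ <-]] //; exists (lo 0%N), 0%N.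
(* Both deviations are positive multiples of a slope minus the supremum, and the supremum lies
   between the two slopes. *)
rewrite !tr_pos_len !slE -!mulrBl mulrACA pmulr_lle0; last exact: mulr_gt0.
move: h1 h2; rewrite /lo /hi; set x := sup _; case: (lerP (sl n La) (sl n Lb)) => h h1 h2.
  by apply: mulr_le0_ge0; rewrite ?subr_le0 ?subr_ge0.
by apply: mulr_ge0_le0; rewrite ?subr_le0 ?subr_ge0.
Qed.

Variable f : R.
Hypothesis f_freq : forall n, tr f (A n [:: La]) * tr f (A n [:: Lb]) <= 0.

Local Notation T := (tr f).
Local Notation d n i := (T (A n [:: i])).

Lemma freq01 : 0 <= f <= 1.
Proof.
have := f_freq 0; rewrite /tr /pos /ab subst_prod_geq //= => h.
by rewrite !(mulr0, mulr1, sub0r, add0r, addr0) in h; apply/andP; split; nra.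
Qed.

(** Passing from letter counts to deviation and length is a column operation, which leaves the
    determinant unchanged up to sign. *)
Lemma det_dev n : `|d n La * (len n Lb)%:R - d n Lb * (len n La)%:R| = 1.
Proof.
have := det2_prod sigma_subst 0 n sigma_unimodular; rewrite /det2 -/(A n _) -/(A n _).
have := len_ab n La; have := len_ab n Lb; rewrite /tr.
case: (A n _) (A n _) => [a b] [c e] /= h1 h2 h.
have hn (k : nat) : k%:R = (k%:Z)%:~R :> R by [].
rewrite !hn !h1 !h2 -[RHS]/(1%:~R) -h intr_norm; congr `|_|.
by rewrite !(intrD, intrN, intrM); ring.
Qed.

Lemma pos_step n l j : (n <= l)%N -> T (A l [:: j]) =
  d n La * (ab (S n l [:: j])).1%:~R + d n Lb * (ab (S n l [:: j])).2%:~R.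
Proof. by move=> h; rewrite (@pos_comp n l) // pos_lmap tr_lmap. Qed.

(** If one deviation vanished, then at a level reached by a positive matrix both deviations would be
    positive multiples of the other one. Their product could be nonpositive only if that one
    vanished too, against [det_dev]. *)
Lemma dev_opp n : d n La * d n Lb < 0.
Proof.
rewrite lt_neqAle f_freq andbT mulf_eq0; apply/negP => h0.
have [l hl hp] := primitive_ab sigma_subst sigma_primitive n.
have hl' := ltnW hl.
have := f_freq l; rewrite !(pos_step _ hl').
have hR (x : int) : 0 < x -> 0 < x%:~R :> R by rewrite ltr0z.
have [/hR + /hR] := hp La; have [/hR + /hR] := hp Lb.
have := det_dev n; move: h0.
move: (d n La) (d n Lb) => x y.
move: (len _ _) (len _ _) => ? ?.
move: (_%:~R) (_%:~R) (_%:~R) (_%:~R) => p q r s /orP[]/eqP-> + hp' hq hr hs hle.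
  have -> : y = 0; last by rewrite !mul0r subrr normr0 => /eqP; rewrite eq_sym oner_eq0.
  apply/eqP; rewrite -sqrf_eq0 eq_le sqr_ge0 andbT.
  by rewrite -(pmulr_lle0 _ (mulr_gt0 hq hs)); nra.
have -> : x = 0; last by rewrite !mul0r subrr normr0 => /eqP; rewrite eq_sym oner_eq0.
apply/eqP; rewrite -sqrf_eq0 eq_le sqr_ge0 andbT.
by rewrite -(pmulr_lle0 _ (mulr_gt0 hp' hr)); nra.
Qed.

Lemma norm_dev_gt0 n i : 0 < `|d n i|.
Proof.
rewrite normr_gt0; have := dev_opp n; case: (letterP i) => ->.
  by apply: contraTneq => ->; rewrite mul0r ltxx.
by apply: contraTneq => ->; rewrite mulr0 ltxx.
Qed.

(** The two deviations have opposite signs, so nothing cancels. *)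
Lemma norm_dev_opp n (x y : R) : (0 <= x * y) ->
  `|d n La * x - d n Lb * y| = `|d n La| * `|x| + `|d n Lb| * `|y|.
Proof.
move=> hxy; rewrite -!normrM; have h := dev_opp n.
have : (d n La * x) * - (d n Lb * y) >= 0.
  by rewrite mulrN mulrACA oppr_ge0 mulr_le0_ge0 // ltW.
move: (d n La * x) (d n Lb * y) => u v huv; rewrite -[`|v|]normrN.
have [hu|hu] := lerP 0 u.
  have [->|hu0] := eqVneq u 0; first by rewrite !normr0 !add0r.
  have hv : 0 <= - v by rewrite -(pmulr_rge0 _ (x := u)) // lt_neqAle eq_sym hu0.
  by rewrite (ger0_norm hu) (ger0_norm hv) ger0_norm // addr_ge0.
have hv : - v <= 0 by rewrite -(nmulr_rge0 _ hu).
have huv' : u - v <= 0 by lra.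
by rewrite (ler0_norm huv') (ltr0_norm hu) (ler0_norm hv); lra.
Qed.

(** This is why deviations tend to 0 when lengths grow. *)
Lemma norm_dev_len n : `|d n La| * (len n Lb)%:R + `|d n Lb| * (len n La)%:R = 1.
Proof.
have h := @norm_dev_opp n (len n Lb)%:R (len n La)%:R (mulr_ge0 (ler0n _ _) (ler0n _ _)).
by rewrite !normr_nat in h; rewrite -h det_dev.
Qed.

Definition spread n : R := `|d n La| + `|d n Lb|.

Lemma spread_gt0 n : 0 < spread n.
Proof. by rewrite addr_gt0 ?norm_dev_gt0. Qed.

Lemma le_norm_tr_lmap n (v : vec) (c : R) :
  `|v.1%:~R| <= c -> `|v.2%:~R| <= c -> `|T (lmap (S 0 n) v)| <= spread n * c.
Proof.
move=> h1 h2; rewrite tr_lmap /spread [leRHS]mulrDl; apply: le_trans (ler_normD _ _) _.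
by rewrite !normrM lerD // ler_wpM2l.
Qed.

Lemma le_norm_tr_pos n w : `|T (A n w)| <= spread n * (size w)%:R.
Proof.
have hh (x : int) : 0 <= x -> x <= (size w)%:Z -> `|x%:~R| <= (size w)%:R :> R.
  by move=> h0 h; rewrite ger0_norm ?ler0z // -[leRHS]/((size w)%:Z%:~R) ler_int.
have [h1 h2] := ab_ge0 w; have h := size_ab w.
by rewrite pos_lmap; apply: le_norm_tr_lmap; apply: hh => //; lia.
Qed.

(** Across a positive matrix every image contains both letters, so the smallest length strictly
    increases. *)
Lemma len_unbounded (K : nat) :
  exists n0, forall n, (n0 <= n)%N -> forall i, (K <= len n i)%N.
Proof.
have mono n m i : (n <= m)%N -> (minn (len n La) (len n Lb) <= len m i)%N.
  move=> h; have -> : len m i = size (S 0 n (S n m [:: i])).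
    by rewrite /len (@subst_prod_compE sigma 0 n m).
  have := subst_size_gt0 (subst_prodP n m) i.
  case: (S n m [:: i]) => // j w _; rewrite size_cons.
  by case: (letterP j) => ->; lia.
elim: K => [|K [n0 IH]]; first by exists 0%N.
have [l hl hp] := primitive_ab sigma_subst sigma_primitive n0.
exists l => n hn i; apply: leq_trans (mono l n i hn); rewrite leq_min.
suff h j : (K < len l j)%N by rewrite !h.
have -> : (len l j = len n0 La * count_mem La (S n0 l [:: j]) +
           len n0 Lb * count_mem Lb (S n0 l [:: j]))%N.
  apply/eqP; rewrite -eqz_nat PoszD !PoszM !len_ab; apply/eqP.
  rewrite (@pos_comp n0 l) 1?ltnW // pos_lmap /lmap /pos /ab /=; ring.
have [] := hp j; rewrite /ab /= !ltz_nat => h1 h2.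
have := len_gt0 n0 Lb; have := IH n0 (leqnn _) La; nia.
Qed.

Lemma spread_lim (eps : R) : 0 < eps ->
  exists n0, forall n, (n0 <= n)%N -> spread n < eps.
Proof.
move=> he; have [n0 h0] := len_unbounded (Num.truncn (eps^-1 * 2)).+1.
exists n0 => n /h0 hn.
have hlen i : eps^-1 * 2 < (len n i)%:R.
  apply: lt_le_trans (truncnS_gt _) _.
  by rewrite ler_nat.
have h2 : 0 < eps^-1 by rewrite invr_gt0.
have hh (x : R) i : 0 <= x -> x * (len n i)%:R <= 1 -> x < eps / 2 \/ x = 0.
  move=> hx h; have [->|x0] := eqVneq x 0; [by right|left].
  have {}hx : 0 < x by rewrite lt_neqAle eq_sym x0.
  rewrite ltNge; apply/negP => hle.
  have : 1 < x * (len n i)%:R.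
    apply: le_lt_trans (_ : x * (eps^-1 * 2) < _); last by rewrite ltr_pM2l.
    have e1 : eps / 2 * (eps^-1 * 2) = 1 by field; lra.
    rewrite -[leLHS]e1.
    by rewrite ler_pM2r // mulr_gt0.
  by rewrite ltNge h.
have := norm_dev_len n; rewrite /spread.
set a := `|d n La|; set b := `|d n Lb| => hab.
have ha : 0 <= a := normr_ge0 _.
have hb : 0 <= b := normr_ge0 _.
have hLa : 0 <= b * (len n La)%:R by rewrite mulr_ge0.
have hLb : 0 <= a * (len n Lb)%:R by rewrite mulr_ge0.
have h1 : a * (len n Lb)%:R <= 1 by lra.
have h3 : b * (len n La)%:R <= 1 by lra.
by have [|->] := hh a Lb ha h1; have [|->] := hh b La hb h3; lra.
Qed.

Lemma leq_size_subst_mul s (M : nat) w : is_substitution s ->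
  (forall i, (size (s [:: i]) <= M)%N) -> (size (s w) <= M * size w)%N.
Proof.
move=> hs hM; elim: w => [|i w IH]; first by rewrite (subst_nil hs).
rewrite (subst_cons hs) size_cat /= mulnS.
exact: leq_add (hM i) IH.
Qed.

Definition maxlen n := maxn (len n La) (len n Lb).

Lemma leq_maxlen n i : (len n i <= maxlen n)%N.
Proof. by rewrite /maxlen; case: (letterP i) => ->; rewrite leq_max leqnn ?orbT. Qed.

Lemma size_prod_unbounded n (K : nat) :
  exists n0, forall m, (n0 <= m)%N -> (n <= m)%N /\
    forall i, (K <= size (S n m [:: i]))%N.
Proof.
have [n0 h] := len_unbounded (maxlen n * K).
exists (maxn n0 n) => m; rewrite geq_max => /andP[h1 h2]; split => // i.
rewrite -(@leq_pmul2l (maxlen n)); last exact: leq_trans (len_gt0 n La) (leq_maxlen _ _).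
apply: leq_trans (h m h1 i) _; rewrite /len (@subst_prod_compE sigma 0 n m) //.
apply: leq_size_subst_mul; first exact: is_substitution_prod.
exact: leq_maxlen.
Qed.

Lemma balanced_ge0 C m : balanced C (language sigma m) -> 0 <= C :> R.
Proof.
move=> /(_ (S m m [:: La]) (S m m [:: La]) (language_prod _ _ (leqnn _))
  (language_prod _ _ (leqnn _)) erefl La).
by rewrite subrr => /andP[].
Qed.

(* If some word of length [k] deviated by more than the bound, all words of
   length [k] would deviate by a fixed amount in the same direction, and these
   deviations would add up along [S n m [:: i]]. *)
Lemma balanced_dev C n w : balanced C (language sigma n) ->
  language sigma n w -> `|T (A n w)| <= C * spread n.
Proof.
move=> hC hw; have C0 := balanced_ge0 hC.
suff key (e : R) : `|e| = 1 -> e * T (A n w) <= C * spread n.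
  rewrite ler_norml -lerNl; apply/andP; split.
    by rewrite -mulN1r key // normrN1.
  by rewrite -[leLHS]mul1r key // normr1.
move=> he; rewrite leNgt; apply/negP => hgt.
set k := size w; pose eta := e * T (A n w) - C * spread n.
have eta0 : 0 < eta by rewrite subr_gt0.
have k0 : (0 < k)%N.
  rewrite lt0n size_eq0; apply/negP => /eqP w0; move: hgt.
  by rewrite w0 pos_nil tr0 mulr0 ltNge mulr_ge0 // ltW // spread_gt0.
have hv v : language sigma n v -> size v = k -> eta <= e * T (A n v).
  move=> hlv hs; rewrite /eta lerBlDr -lerBlDl -mulrBr -trB !pos_lmap -lmapB.
  apply: le_trans (ler_norm _) _; rewrite normrM he mul1r mulrC.
  have hb j := hC w v hw hlv (esym hs) j.
  by apply: le_norm_tr_lmap => /=; rewrite ler_norml rmorphB; apply: hb.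
clearbody eta.
have hq q U : size U = (q * k)%N -> language sigma n U -> q%:R * eta <= e * T (A n U).
  elim: q U => [|q IH] U.
    by move=> /size0nil -> _; rewrite pos_nil tr0 mulr0 mul0r.
  move=> hU hl; rewrite -(cat_take_drop k U) pos_cat trD mulrDr -addn1 natrD.
  rewrite mulrDl mul1r addrC lerD //.
    apply: hv; first exact: language_infix hl (infix_take _ _).
    by rewrite size_takel // hU mulSn leq_addr.
  apply: IH; first by rewrite size_drop hU mulSn addKn.
  exact: language_infix hl (infix_drop _ _).
(* [Q] blocks gain more than 1, which bounds the deviation of all of [U], plus the possible loss in
   the incomplete last block. *)
pose Q := (Num.truncn ((1 + spread n * k%:R) / eta)).+1.
have [n0 h0] := size_prod_unbounded n (Q * k).
have [n1 h1] := spread_lim ltr01.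
pose m := maxn n0 n1.
have [hnm hsz] := h0 m (leq_maxl _ _).
have hm1 := h1 m (leq_maxr _ _).
set U := S n m [:: La]; have hU : language sigma n U by exact: language_prod.
pose q := (size U %/ k)%N.
have hqQ : (Q <= q)%N by rewrite leq_divRL //; apply: hsz.
have hUE : U = take (q * k) U ++ drop (q * k) U by rewrite cat_take_drop.
have hup : e * T (A n U) <= 1.
  apply: le_trans (ler_norm _) _; rewrite normrM he mul1r /U -pos_comp //.
  by apply: ltW; apply: le_lt_trans hm1; rewrite /spread lerDl.
have hlow1 : q%:R * eta <= e * T (A n (take (q * k) U)).
  apply: hq; last exact: language_infix hU (infix_take _ _).
  by rewrite size_takel // leq_trunc_div.
have hlow2 : - (spread n * k%:R) <= e * T (A n (drop (q * k) U)).
  rewrite lerNl -mulNr; apply: le_trans (ler_norm _) _.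
  rewrite normrM normrN he mul1r; apply: le_trans (le_norm_tr_pos _ _) _.
  rewrite ler_wpM2l ?ler_nat ?(ltW (spread_gt0 _)) // size_drop.
  by rewrite {1}(divn_eq (size U) k) addKn ltnW // ltn_mod.
move: hup; rewrite hUE pos_cat trD mulrDr => hup.
have : (1 + spread n * k%:R) / eta < Q%:R by exact: truncnS_gt.
rewrite ltr_pdivrMr // => hQ.
have : Q%:R * eta <= q%:R * eta by rewrite ler_pM2r // ler_nat.
by move=> hQq; lra.
Qed.

Lemma lmap_surj n (v : vec) : exists y, v = lmap (S 0 n) y.
Proof.
have := det2_prod sigma_subst 0 n sigma_unimodular.
rewrite /det2 /lmap; case: (ab _) (ab _) v => [a b] [c e] [x y] /= hd.
(* [dd] is the determinant, 1 or -1 and thus its own inverse; the witness below is Cramer's rule. *)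
pose dd : int := c * b - a * e.
have hdd : dd * dd = 1.
  have : dd = 1 \/ dd = -1 by rewrite /dd; lia.
  by case=> ->.
exists (dd * (b * x - a * y), dd * (c * y - e * x)).
apply: vec_eq => /=.
  rewrite -[LHS]mul1r -{1}hdd /dd; ring.
rewrite -[LHS]mul1r -{1}hdd /dd; ring.
Qed.

Lemma norm_tr_lmap n (y : vec) : y.1 * y.2 <= 0 ->
  `|T (lmap (S 0 n) y)| = `|d n La| * `|y.1%:~R| + `|d n Lb| * `|y.2%:~R|.
Proof.
move=> hy; rewrite tr_lmap -[_ * y.2%:~R]opprK -mulrN norm_dev_opp ?normrN //.
by rewrite mulrN -intrM oppr_ge0 lerz0.
Qed.

Lemma height_lmap n (y : vec) : (lmap (S 0 n) y).1 + (lmap (S 0 n) y).2 =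
  (len n La)%:Z * y.1 + (len n Lb)%:Z * y.2.
Proof. by rewrite !len_ab /lmap /pos /=; ring. Qed.

(** A quantitative irrationality of [f]. At a level whose steps are longer than [2 * b], a nonzero
    vector of the box must have coordinates of strictly opposite signs in the basis of these steps,
    since otherwise it would be too long. Then the transversal parts add up to at least the spread
    of that level. *)
Lemma tr_lower (b : nat) : exists2 kap : R, 0 < kap &
  forall v : vec, v != 0 -> `|v.1| <= b%:Z -> `|v.2| <= b%:Z -> kap <= `|T v|.
Proof.
have [n0 h] := len_unbounded (b + b).+1; have {}h := h n0 (leqnn _).
exists (spread n0); first exact: spread_gt0.
move=> v v0 h1 h2; have [y hy] := lmap_surj n0 v.
have hh := height_lmap n0 y; rewrite -hy in hh.
have := h La; have := h Lb; move: hh; rewrite hy.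
have y0 : y != 0.
  by apply: contraNneq v0 => y0; rewrite hy y0 /lmap /= !mulr0.
have hy12 : (y.1 != 0) || (y.2 != 0).
  by move: y0; case: (y) => y1 y2; rewrite xpair_eqE negb_and.
move: (len n0 La) (len n0 Lb) => p q hpq hq hp.
have [hneg|hpos] := ltrP (y.1 * y.2) 0; last first.
  exfalso; rewrite -hy in hpq.
  have : `|v.1 + v.2| <= (b + b)%:Z by lia.
  rewrite hpq; case/orP: hy12 => hne; nia.
rewrite norm_tr_lmap ?(ltW hneg) //.
have h3 : y.1 != 0 by apply/eqP => e; rewrite e mul0r ltxx in hneg.
have h4 : y.2 != 0 by apply/eqP => e; rewrite e mulr0 ltxx in hneg.
have hz (z : int) : z != 0 -> 1 <= `|z%:~R| :> R.
  by move=> hz; rewrite -intr_norm -[1]/(1%:~R) ler_int; lia.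
by rewrite /spread lerD // ler_peMr // hz.
Qed.

(** If the coordinates of [v] in the basis of the two steps had opposite signs, their transversal
    parts would add up; both coordinates, and hence the length, would be bounded in terms of [B]. *)
Lemma cone_of_height n (B : R) : exists K : nat, forall v : vec, `|T v| <= B ->
  K%:Z <= v.1 + v.2 -> exists p, [/\ v = lmap (S 0 n) p, 0 <= p.1 & 0 <= p.2].
Proof.
have hd := norm_dev_gt0 n.
pose c := Num.min `|d n La| `|d n Lb|.
have c0 : 0 < c by rewrite /c lt_min !hd.
pose K0 := (Num.truncn (B / c)).+1.
exists (maxlen n * K0).+1 => v hB hK; have [y hy] := lmap_surj n v.
have hh := height_lmap n y; rewrite -hy in hh.
exists y; have hK' : B < K0%:R * c.
  by rewrite -ltr_pdivrMr // truncnS_gt.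
have := leq_maxlen n La; have := leq_maxlen n Lb.
have := len_gt0 n La; have := len_gt0 n Lb.
suff key (z : int) i : `|z%:~R| * `|d n i| <= `|T v| -> z < K0%:Z.
  move: (maxlen n) hK => M hK l1 l2 l3 l4; move: hh.
  move: (len n La) (len n Lb) l1 l2 l3 l4 => p q l1 l2 l3 l4 hh.
  have [hneg|hpos] := ltrP (y.1 * y.2) 0; last by split => //; nia.
  have := norm_tr_lmap n (ltW hneg); rewrite -hy => hT.
  have k1 : y.1 < K0%:Z.
    by apply: (key _ La); rewrite hT mulrC lerDl mulr_ge0.
  have k2 : y.2 < K0%:Z.
    by apply: (key _ Lb); rewrite hT mulrC lerDr mulr_ge0.
  exfalso; have [h|h] := ltrP y.1 0.
    have : p%:Z * y.1 <= 0 by nia.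
    have : q%:Z * y.2 <= M%:Z * K0%:Z by nia.
    by lia.
  have : q%:Z * y.2 <= 0 by nia.
  have : p%:Z * y.1 <= M%:Z * K0%:Z by nia.
  by lia.
move=> hz; have hc : c <= `|d n i|.
  by rewrite /c; case: (letterP i) => ->; rewrite ge_min lexx ?orbT.
rewrite -(ltr_int R) -(ltr_pM2r c0); apply: le_lt_trans hK'.
apply: le_trans hB; apply: le_trans hz.
apply: (@le_trans _ _ (`|z%:~R| * c)); first by rewrite ler_pM2r // ler_norm.
by rewrite ler_wpM2l.
Qed.

Lemma letter_in_prod n : exists2 l, (n < l)%N & forall m i j, (l <= m)%N ->
  infix [:: i] (S n m [:: j]).
Proof.
have [l hl hp] := primitive_ab sigma_subst sigma_primitive n.
exists l => // m i j hm; rewrite (@subst_prod_compE sigma n l m) // 1?ltnW //.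
have := subst_size_gt0 (subst_prodP l m) j.
case: (S l m [:: j]) => // x w _.
rewrite (subst_cons (subst_prodP n l)).
apply: infix_catr; rewrite infix1s -has_pred1 has_count.
have [h1 h2] := hp x.
by rewrite -ltz_nat; case: (letterP i) => ->.
Qed.

(** The word [w] may be known to occur only in an image of a level below [N]. Every letter of that
    level occurs in all images from far enough up, so [w] also occurs in an image that can be
    desubstituted to level [N]. *)
Lemma language_deep N w : language sigma 0 w ->
  exists x v y, [/\ language sigma N v, w = x ++ S 0 N v ++ y,
    (size x <= maxlen N)%N & (size y <= maxlen N)%N].
Proof.
move=> [i [n [_ hw]]]; have [l hl hi] := letter_in_prod n.
pose m := maxn l N; have hlm : (l <= m)%N by apply: leq_maxl.
have hw' : infix w (S 0 N (S N m [:: La])).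
  rewrite -(@subst_prod_compE sigma 0 N m) ?leq_maxr //.
  rewrite (@subst_prod_compE sigma 0 n m) //; last lia.
  apply: infix_trans hw _; have /infixP[p [q ->]] := hi m i La hlm.
  rewrite !(subst_cat (subst_prodP 0 n)).
  exact: infix_infix.
have [x [v [y [hv -> hx hy]]]] :=
  infix_subst (subst_prodP 0 N) (leq_maxlen N) hw'.
exists x, v, y; split => //.
by apply: language_infix hv; apply: language_prod; apply: leq_maxr.
Qed.

Lemma bounded_dev (C : R) N : balanced C (language sigma N) ->
  exists C0 : R, forall w, language sigma 0 w -> `|T (ab w)| <= C0.
Proof.
move=> hC; exists (spread 0 * (maxlen N)%:R + (C * spread N + spread 0 * (maxlen N)%:R)).
move=> w /(@language_deep N)[x [v [y [hv -> hx hy]]]].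
have hp u : (size u <= maxlen N)%N -> `|T (ab u)| <= spread 0 * (maxlen N)%:R.
  move=> hu; have := le_norm_tr_pos 0 u; rewrite {1}/pos subst_prod_geq // => h.
  by apply: le_trans h _; rewrite ler_wpM2l ?ler_nat // ltW // spread_gt0.
rewrite !ab_cat !trD; apply: le_trans (ler_normD _ _) _.
apply: lerD; first exact: hp.
apply: le_trans (ler_normD _ _) _; apply: lerD; last exact: hp.
exact: balanced_dev hC hv.
Qed.

(** * Edges of a given level and strong coincidence *)

(* At level [n], the edge [(X, i)] is the segment from [X] to
   [X + A n [:: i]]; substituting subdivides it into edges of lower level. *)
Definition edge := (vec * letter)%type.

Fixpoint edges n (X : vec) (w : word) : seq edge :=
  if w is i :: w' then (X, i) :: edges n (X + A n [:: i]) w' else [::].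

Lemma edges_cat n X u v : edges n X (u ++ v) = edges n X u ++ edges n (X + A n u) v.
Proof.
elim: u X => [|i u IH] X /=; first by rewrite pos_nil addr0.
by rewrite IH (pos_cons _ i u) addrA.
Qed.

Lemma size_edges n X w : size (edges n X w) = size w.
Proof. by elim: w X => //= i w IH X; rewrite IH. Qed.

Lemma mem_edgesP n X w (e : edge) : reflect
  (exists p q, w = p ++ e.2 :: q /\ e.1 = X + A n p) (e \in edges n X w).
Proof.
apply: (iffP idP).
  elim: w X => [//|i w IH] X /=; rewrite inE => /orP[/eqP->|].
    by exists [::], w; rewrite pos_nil addr0.
  move=> /IH[p [q [-> ->]]]; exists (i :: p), q; split => //.
  by rewrite (pos_cons _ i p) addrA.
move=> [p [q [-> h]]]; rewrite edges_cat mem_cat /= inE -h.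
by case: e {h} => ? ?; rewrite eqxx orbT.
Qed.

Lemma edges_shift n X V w : edges n (X + V) w = [seq (e.1 + V, e.2) | e <- edges n X w].
Proof. by elim: w X => [//|i w IH] X /=; rewrite -IH addrAC. Qed.

Lemma edges_sub n m X w : (n <= m)%N -> edges n X (S n m w) =
  flatten [seq edges n e.1 (S n m [:: e.2]) | e <- edges m X w].
Proof.
move=> h; elim: w X => [|i w IH] X /=.
  by rewrite (subst_nil (subst_prodP n m)).
rewrite (subst_cons (subst_prodP n m)) edges_cat IH.
by rewrite -pos_comp.
Qed.

Lemma mem_edges_sub n m X w (e : edge) : (n <= m)%N ->
  reflect (exists2 E, E \in edges m X w & e \in edges n E.1 (S n m [:: E.2]))
    (e \in edges n X (S n m w)).
Proof. by move=> h; rewrite edges_sub //; apply: flatten_mapP. Qed.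

Definition low n (e : edge) := edges 0 e.1 (S 0 n [:: e.2]).

Definition noncoincident n (e e' : edge) := ~~ has (mem (low n e')) (low n e).

Local Notation nc := noncoincident.

Definition shift (V : vec) (e : edge) : edge := (e.1 + V, e.2).

Lemma low_sub n m (E e : edge) : (n <= m)%N -> e \in edges n E.1 (S n m [:: E.2]) ->
  {subset low n e <= low m E}.
Proof.
move=> h he x hx; rewrite /low (@subst_prod_compE sigma 0 n m) //.
by apply/mem_edges_sub => //; exists e.
Qed.

Lemma noncoincident_sub n m (E E' e e' : edge) : (n <= m)%N ->
  e \in edges n E.1 (S n m [:: E.2]) -> e' \in edges n E'.1 (S n m [:: E'.2]) ->
  nc m E E' -> nc n e e'.
Proof.
move=> h he he'; apply: contra => /hasP[x h1 h2]; apply/hasP; exists x.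
  exact: low_sub he _ h1.
exact: low_sub he' _ h2.
Qed.

Lemma noncoincidentC n e e' : nc n e e' = nc n e' e.
Proof.
by congr (~~ _); apply/hasP/hasP => -[x h1 h2]; exists x.
Qed.

Lemma noncoincident_irr n e : nc n e e = false.
Proof.
apply/negbTE; rewrite negbK; apply/hasP.
have := subst_size_gt0 (subst_prodP 0 n) e.2.
rewrite /low; case: (S 0 n _) => // i w _.
by exists (e.1, i); rewrite /= inE eqxx.
Qed.

Lemma noncoincident_shift n V e e' : nc n (shift V e) (shift V e') = nc n e e'.
Proof.
have inj : injective (shift V).
  move=> [x i] [y j] h; have := congr1 snd h; have := congr1 fst h.
  by move=> /= /addIr -> ->.
congr (~~ _); rewrite /low !edges_shift has_map; apply: eq_has => x /=.
exact: (mem_map inj).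
Qed.

(* With these weights two lattice points at the same height differ by a multiple
   of [(4, -5)] and hence are transversally far apart. *)
Definition hgt (v : vec) : int := 5 * v.1 + 4 * v.2.

Lemma hgtD u v : hgt (u + v) = hgt u + hgt v.
Proof. by rewrite /hgt /=; ring. Qed.

Lemma hgtN v : hgt (- v) = - hgt v.
Proof. by rewrite /hgt /=; ring. Qed.

Lemma hgtB u v : hgt (u - v) = hgt u - hgt v.
Proof. by rewrite /hgt /=; ring. Qed.

Lemma hgt_eq (u v : vec) : hgt u = hgt v -> `|T u - T v| < 4 -> u = v.
Proof.
move=> h; rewrite -trB => hT; apply/eqP; rewrite -subr_eq0; apply/eqP.
have {h} h : hgt (u - v) = 0 by rewrite hgtB h subrr.
move: (u - v) h hT => [a b]; rewrite /hgt /tr /= => h hT.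
pose s : int := a + b; have hab : a + b = s by [].
have ha : a = - 4 * s by rewrite /s; lia.
suff s0 : s = 0 by apply: vec_eq; rewrite /= ?ha ?s0 //; move: s0; rewrite /s; lia.
move: hT; rewrite hab ha intrM.
have /andP[f0 _] := freq01.
have -> : (- 4)%:~R * s%:~R - f * s%:~R = - ((4 + f) * s%:~R) :> R by ring.
rewrite normrN normrM (ger0_norm (_ : 0 <= 4 + f)); last by lra.
apply: contraPeq => hs; apply/negP; rewrite -leNgt.
have : 1 <= `|s%:~R| :> R by rewrite -intr_norm -[1]/(1%:~R) ler_int; lia.
by nra.
Qed.

Definition edge_end n (e : edge) := e.1 + A n [:: e.2].

(** Half-open, so that exactly one edge of a path crosses each height in its range. *)
Definition crosses n (t : int) (e : edge) := hgt e.1 <= t < hgt (edge_end n e).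

Lemma hgt_pos_ge0 n w : 0 <= hgt (A n w).
Proof. by have [] := pos_ge0 n w; rewrite /hgt; lia. Qed.

Lemma hgt_pos_gt0 n i : 0 < hgt (A n [:: i]).
Proof.
have [] := pos_ge0 n [:: i]; have := len_ab n i; have := len_gt0 n i.
by rewrite /hgt; lia.
Qed.

Lemma hgt_edge_end n e : hgt e.1 < hgt (edge_end n e).
Proof. by rewrite hgtD ltrDl hgt_pos_gt0. Qed.

Lemma edge_end_shift n V e : edge_end n (shift V e) = edge_end n e + V.
Proof. by rewrite /edge_end /= addrAC. Qed.

Lemma crosses_shift n t V e : crosses n (t + hgt V) (shift V e) = crosses n t e.
Proof. by rewrite /crosses edge_end_shift !hgtD lerD2r ltrD2r. Qed.

Lemma crosses_ex n t X w : hgt X <= t < hgt (X + A n w) ->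
  exists2 e : edge, e \in edges n X w & crosses n t e.
Proof.
elim: w X => [|i w IH] X /=; first by rewrite pos_nil addr0; lia.
move=> /andP[h1 h2]; have [h|h] := ltrP t (hgt (X + A n [:: i])).
  by exists (X, i); rewrite ?inE ?eqxx // /crosses h1.
have [|e he hc] := IH (X + A n [:: i]); first by rewrite h -addrA -pos_cons.
by exists e => //; rewrite inE he orbT.
Qed.

Lemma edges_hgt n X w (e : edge) : e \in edges n X w ->
  hgt X <= hgt e.1 /\ hgt (edge_end n e) <= hgt (X + A n w).
Proof.
move=> /mem_edgesP[p [q [-> he]]]; rewrite /edge_end he pos_cat (pos_cons _ e.2 q).
have := hgt_pos_ge0 n p; have := hgt_pos_ge0 n q; rewrite !hgtD.
by lia.
Qed.

Lemma crosses_uniq n t X w (e e' : edge) : e \in edges n X w -> e' \in edges n X w ->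
  crosses n t e -> crosses n t e' -> e = e'.
Proof.
elim: w X => [//|i w IH] X /=; rewrite !inE.
move=> /orP[/eqP->|he] /orP[/eqP->|he'] //; last exact: IH he he'.
  have [+ _] := edges_hgt he'; rewrite /crosses /edge_end /=; lia.
have [+ _] := edges_hgt he; rewrite /crosses /edge_end /=; lia.
Qed.

(* Edges of level [n] that cross the height [t] within the strip of half-width
   [D] and have no edge of level 0 in common. *)
Definition config n D c t (s : seq edge) :=
  [/\ forall e : edge, e \in s -> crosses n t e,
      forall e : edge, e \in s -> `|T e.1 - c| <= D & pairwise (nc n) s].

Lemma config_uniq n D c t s : config n D c t s -> uniq s.
Proof.
case=> _ _; elim: s => //= e s IH /andP[h /IH ->]; rewrite andbT.
by apply/negP => he; move/allP: h => /(_ _ he); rewrite noncoincident_irr.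
Qed.

Lemma config_nc n D c t s (e e' : edge) : config n D c t s -> e \in s -> e' \in s ->
  e != e' -> nc n e e'.
Proof.
case=> _ _; elim: s => //= x s IH /andP[/allP h1 h2]; rewrite !inE.
move=> /orP[/eqP->|he] /orP[/eqP->|he']; rewrite ?eqxx // => hne.
- exact: h1.
- by rewrite noncoincidentC; apply: h1.
- exact: IH.
Qed.

Definition capacity n D m := forall c t s, config n D c t s -> (size s <= m)%N.

Lemma edge_window (C0 D c : R) n (e x : edge) :
  (forall w, language sigma 0 w -> `|T (ab w)| <= C0) ->
  `|T e.1 - c| <= D -> x \in low n e -> `|T x.1 - c| <= D + C0.
Proof.
move=> hC0 he /mem_edgesP[p [q [hp ->]]].
have hl : language sigma 0 p.
  have h := language_prod sigma e.2 (leq0n n).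
  apply: (language_infix h).
  by rewrite hp; apply: infix_catr; apply: infix_refl.
have := hC0 p hl; rewrite -[p in ab p]/(id p) -(subst_prod_geq sigma (leqnn 0)) -/(A 0 p).
rewrite trD => h; rewrite addrAC; apply: le_trans (ler_normD _ _) _.
exact: lerD.
Qed.

Lemma inord_inj (k : nat) (x y : int) :
  0 <= x -> x <= k%:Z -> 0 <= y -> y <= k%:Z ->
  inord `|x| = inord `|y| :> 'I_k.+1 -> x = y.
Proof.
by move=> h1 h2 h3 h4 /(congr1 val) /=; rewrite !inordK; lia.
Qed.

Lemma floor_eq_dist (x y : R) : Num.floor x = Num.floor y -> `|x - y| < 1.
Proof.
move=> h; have := floor_itv x; have := floor_itv y; rewrite h.
rewrite intrD => /andP[h1 h2] /andP[h3 h4]; rewrite ltr_norml; apply/andP; split; lra.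
Qed.

(** Each edge of a configuration contains an edge of level 0 across the height [t], and
    noncoincidence makes these distinct. A strip of bounded width holds a bounded number of them,
    whatever the level [n]. *)
Lemma capacity_ex (C0 : R) : (forall w, language sigma 0 w -> `|T (ab w)| <= C0) ->
  exists m, forall n, capacity n 1 m.
Proof.
move=> hC0; pose B := (Num.truncn (1 + C0)).+1.
(* Height already climbed (at most 4, since the steps of level 0 have heights 5 and 4), letter, and
   rounded transversal position, made nonnegative by adding [B]. *)
pose code c t (x : edge) : 'I_5 * letter * 'I_(2 * B).+1 :=
  (inord `|t - hgt x.1|, x.2, inord `|Num.floor (T x.1 - c) + B%:Z|).
exists #|{: 'I_5 * letter * 'I_(2 * B).+1}| => n c t s hs.
have [hcr hw _] := hs.
pose g e := nth (0, La) (low n e) (find (crosses 0 t) (low n e)).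
have hg (e : edge) : e \in s -> g e \in low n e /\ crosses 0 t (g e).
  move=> he; have hh : has (crosses 0 t) (low n e).
    have [|x hx hcx] := @crosses_ex 0 t e.1 (S 0 n [:: e.2]).
      by have := hcr e he; rewrite /crosses /edge_end (@pos_comp 0 n).
    by apply/hasP; exists x.
  by split; [apply: mem_nth; rewrite -has_find | apply: nth_find].
have hB : 1 + C0 < B%:R by exact: truncnS_gt.
have hrange (e : edge) : e \in s -> [/\ 0 <= t - hgt (g e).1, t - hgt (g e).1 <= 4%:Z,
    0 <= Num.floor (T (g e).1 - c) + B%:Z & Num.floor (T (g e).1 - c) + B%:Z <= (2 * B)%:Z].
  move=> he; have [h1 h2] := hg e he.
  have h3 := edge_window hC0 (hw e he) h1.
  have h4 : `|T (g e).1 - c| < B%:R by apply: le_lt_trans h3 hB.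
  move: h4; rewrite ltr_norml => /andP[h5 h6].
  split.
  - by move: h2; rewrite /crosses subr_ge0 => /andP[].
  - move: h2; rewrite /crosses /edge_end hgtD /pos subst_prod_geq // /hgt /ab.
    by case: (letterP (g e).2) => -> /=; lia.
  - have : - B%:Z <= Num.floor (T (g e).1 - c) by rewrite floor_ge_int intrN ltW.
    by lia.
  - have : Num.floor (T (g e).1 - c) < B%:Z by rewrite floor_lt_int.
    by lia.
have inj : {in s &, injective (fun e => code c t (g e))}.
  move=> e e' he he' [].
  have [a1 a2 a3 a4] := hrange e he; have [b1 b2 b3 b4] := hrange e' he'.
  move=> /(inord_inj a1 a2 b1 b2) e1 e2 /(inord_inj a3 a4 b3 b4) e3.
  have eg1 : (g e).1 = (g e').1.
    apply: hgt_eq; first lia.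
    have /floor_eq_dist : Num.floor (T (g e).1 - c) = Num.floor (T (g e').1 - c) by lia.
    by rewrite opprB addrA subrK => h; apply: lt_trans h _; lra.
  have eg : g e = g e' by move: eg1 e2; case: (g e) (g e') => ? ? [? ?] /= -> ->.
  apply/eqP; apply/negPn/negP => hne.
  have := config_nc hs he he' hne; apply/negP; rewrite negbK.
  apply/hasP; exists (g e); first by have [] := hg e he.
  by rewrite eg; have [] := hg e' he'.
rewrite -(size_map (fun e => code c t (g e)) s) -(card_uniqP _); last first.
  by rewrite map_inj_in_uniq // (config_uniq hs).
exact: max_card.
Qed.

Lemma capacity0 n (D : R) : 0 < D -> ~ capacity n D 0.
Proof.
move=> D0 h; suff /h : config n D 0 0 [:: (0, La)] by []; split => //.
- move=> e; rewrite inE => /eqP ->; rewrite /crosses lexx /=.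
  exact: (hgt_edge_end n (0, La)).
- by move=> e; rewrite inE => /eqP ->; rewrite tr0 subrr normr0 ltW.
Qed.

(** * Deterministic evolution of maximal configurations *)

Definition sub_edge n m t (E : edge) : edge :=
  (* For [n <= m] the default is never taken when [E] crosses the height [t]. *)
  let s := edges n E.1 (S n m [:: E.2]) in nth (0, La) s (find (crosses n t) s).

Lemma sub_edgeP n m t E : (n <= m)%N -> crosses m t E ->
  sub_edge n m t E \in edges n E.1 (S n m [:: E.2]) /\ crosses n t (sub_edge n m t E).
Proof.
move=> hnm hE; have hh : has (crosses n t) (edges n E.1 (S n m [:: E.2])).
  have [|x hx hcx] := @crosses_ex n t E.1 (S n m [:: E.2]).
    by move: hE; rewrite /crosses /edge_end (@pos_comp n m).
  by apply/hasP; exists x.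
by split; [apply: mem_nth; rewrite -has_find | apply: nth_find].
Qed.

Lemma sub_edge_step n m t E : (n <= m)%N -> crosses m t E -> crosses m (t + 1) E ->
  (sub_edge n m (t + 1) E = sub_edge n m t E /\
     t + 1 < hgt (edge_end n (sub_edge n m t E))) \/
  ((sub_edge n m (t + 1) E).1 = edge_end n (sub_edge n m t E) /\
     hgt (edge_end n (sub_edge n m t E)) = t + 1).
Proof.
move=> hnm h1 h2; have [m1 c1] := sub_edgeP hnm h1; have [m2 c2] := sub_edgeP hnm h2.
set e := sub_edge n m t E in m1 c1 *; set e' := sub_edge n m (t + 1) E in m2 c2 *.
have [h|h] := ltrP (t + 1) (hgt (edge_end n e)).
  left; split => //; apply: (crosses_uniq m2 m1 c2).
  by move: c1; rewrite /crosses h andbT; lia.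
have {}h : hgt (edge_end n e) = t + 1 by move: c1; rewrite /crosses; lia.
right; split => //.
have /mem_edgesP[p [q [hw he]]] := m1.
have hend : edge_end n e = E.1 + A n (rcons p e.2).
  by rewrite /edge_end he -cats1 pos_cat addrA.
case: q hw => [|j q] hw.
  move: h2; rewrite /crosses => /andP[_].
  have -> : edge_end m E = edge_end n e.
    by rewrite hend /edge_end (@pos_comp n m) // hw cats1.
  by rewrite h ltxx.
have m3 : (edge_end n e, j) \in edges n E.1 (S n m [:: E.2]).
  by apply/mem_edgesP; exists (rcons p e.2), q; rewrite cat_rcons.
rewrite (crosses_uniq m2 m3 c2) //.
rewrite /crosses /= h lexx -h; exact: (hgt_edge_end n (edge_end n e, j)).
Qed.

Lemma all_edges (p : pred edge) (s : seq edge) :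
  (forall e : edge, e \in s -> p e) -> all p s.
Proof. by move=> h; apply/allP. Qed.

Lemma exists_argmax (s : seq edge) (g : edge -> int) x0 : x0 \in s ->
  exists2 e : edge, e \in s & forall e' : edge, e' \in s -> g e' <= g e.
Proof.
elim: s x0 => [//|x s IH] x0 _; case: s IH => [_|y s IH].
  by exists x; rewrite ?inE ?eqxx // => e'; rewrite inE => /eqP ->.
have [|e he hmax] := IH y; first by rewrite inE eqxx.
have [h|h] := lerP (g x) (g e).
  exists e; first by rewrite inE he orbT.
  by move=> e'; rewrite inE => /orP[/eqP->//|]; apply: hmax.
exists x; first by rewrite inE eqxx.
move=> e'; rewrite inE => /orP[/eqP->//|/hmax h2].
by apply: le_trans h2 (ltW h).
Qed.

Lemma box_of_hgt (v : vec) (L : nat) : `|hgt v| <= L%:Z -> `|T v| <= 3 ->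
  `|v.1| <= (4 * L + 8)%:Z /\ `|v.2| <= (4 * L + 8)%:Z.
Proof.
move: v => [a b]; rewrite /hgt /tr /= => h hT.
pose s : int := a + b; have hs : a + b = s by [].
have hTs : `|(5 * a + 4 * b)%:~R - (4 + f) * s%:~R| <= 3 :> R.
  by rewrite (_ : _ - _ = a%:~R - f * (a + b)%:~R) // -hs !(intrD, intrM); ring.
have /andP[f0 f1] := freq01.
have hh : `|(5 * a + 4 * b)%:~R| <= L%:R :> R by rewrite -intr_norm -[L%:R]/(L%:Z%:~R) ler_int.
have hs4 : `|4 * s| <= (L + 3)%:Z.
  rewrite -(ler_int R) intr_norm intrM -[(L + 3)%:Z%:~R]/((L + 3)%:R) natrD.
  move: hTs hh; rewrite !ler_norml => /andP[h1 h2] /andP[h3 h4].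
  have [s0|s0] := lerP 0 (s%:~R : R).
    have h5 := mulr_ge0 f0 s0; apply/andP; split; lra.
  have h5 : 0 <= f * - s%:~R by rewrite mulr_ge0 // oppr_ge0 ltW.
  by apply/andP; split; lra.
have ha : a = (5 * a + 4 * b) - 4 * s by rewrite /s; ring.
have hb : b = s - a by rewrite /s; ring.
by split; lia.
Qed.

Lemma window_dist (x y c D : R) : D <= 1 ->
  `|x - c| <= D -> `|y - c| <= D -> `|x - y| < 4.
Proof.
by rewrite !ler_norml !ltr_norml => ? /andP[? ?] /andP[? ?]; apply/andP; split; lra.
Qed.

Section Determinism.
Variables (n m cap : nat) (D c : R) (s : seq edge) (t0 : int) (len0 : nat).
Hypothesis le_nm : (n <= m)%N.
Hypothesis D1 : D <= 1.
Hypothesis hcap : capacity n D cap.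
Hypothesis hsize : (cap <= size s)%N.
Hypothesis hnc0 : nc n (0, La) (0, Lb).

Definition slice (t : int) := [seq sub_edge n m t e | e <- s].

Hypothesis hslice : forall t, t0 <= t <= t0 + len0%:Z -> config n D c t (slice t).
Hypothesis hcross : forall t (e : edge), t0 <= t <= t0 + len0%:Z -> e \in s -> crosses m t e.

(* Otherwise both edges starting at the vertex reached at time [t + 1] could be
   added to the edges that are kept, giving more than [cap] edges. *)
Lemma slice_step (t t' : int) (V : vec) : t' = t + hgt V ->
  t0 <= t -> t + 1 <= t0 + len0%:Z -> t0 <= t' -> t' + 1 <= t0 + len0%:Z ->
  (forall e : edge, e \in slice t -> shift V e \in slice t') ->
  (forall e : edge, e \in slice t' -> shift (- V) e \in slice t) ->
  forall e : edge, e \in slice (t + 1) -> shift V e \in slice (t' + 1).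
Proof.
move=> htV h1 h2 h3 h4 hf hb e; move=> /mapP[g gs ->].
have r1 : t0 <= t <= t0 + len0%:Z by lia.
have r2 : t0 <= t + 1 <= t0 + len0%:Z by lia.
have r3 : t0 <= t' <= t0 + len0%:Z by lia.
have r4 : t0 <= t' + 1 <= t0 + len0%:Z by lia.
have step u E (ru : t0 <= u <= t0 + len0%:Z) (ru1 : t0 <= u + 1 <= t0 + len0%:Z) (hE : E \in s) :=
  sub_edge_step le_nm (hcross ru hE) (hcross ru1 hE).
have hg : sub_edge n m t g \in slice t by apply: map_f.
have /mapP[g' gs' eg'] := hf _ hg.
have eend : edge_end n (sub_edge n m t' g') = edge_end n (sub_edge n m t g) + V.
  by rewrite -eg' edge_end_shift.
(* An edge and its translate end at corresponding times; the mixed cases contradict the heights of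
   their ends. *)
have [[-> hk]|[hst hk]] := step t g r1 r2 gs.
  have [[ek hk']|[_]] := step t' g' r3 r4 gs'.
    by rewrite eg' -ek; apply: map_f.
  by rewrite eend hgtD; lia.
have [[ek]|[hst' hk']] := step t' g' r3 r4 gs'.
  by rewrite eend hgtD; lia.
set e1 := sub_edge n m (t + 1) g in hst *.
set e2 := sub_edge n m (t' + 1) g' in hst' *.
have e2s : e2 \in slice (t' + 1) by apply: map_f.
have e1s : e1 \in slice (t + 1) by apply: map_f.
have e12 : e2.1 = e1.1 + V by rewrite hst' eend hst.
apply/negPn/negP => hnot.
have [C1 W1 N1] := hslice r2; have [C2 W2 N2] := hslice r4.
have hcfg : config n D c (t' + 1) (shift V e1 :: slice (t' + 1)).
  split.
  - move=> x; rewrite inE => /orP[/eqP->|]; last exact: C2.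
    by rewrite htV addrAC crosses_shift; apply: C1.
  - move=> x; rewrite inE => /orP[/eqP->|]; last exact: W2.
    by rewrite /shift /= -e12; apply: W2.
  rewrite pairwise_cons N2 andbT; apply: all_edges => y ys.
  have hne : y != shift V e1 by apply: contraNneq hnot => <-.
  have /mapP[g2 gs2 ey] := ys.
  (* An edge [y] that goes on is the translate of one that goes on, so noncoincidence can be checked
     at time [t + 1]. *)
  have [[ek hk2]|[hst2 hk2]] := step t' g2 r3 r4 gs2.
    have yt' : y \in slice t' by rewrite ey ek; apply: map_f.
    have /mapP[g3 gs3 eg3] := hb _ yt'.
    have hy3 : t + 1 < hgt (edge_end n (sub_edge n m t g3)).
      rewrite -eg3 edge_end_shift ey ek hgtD hgtN.
      by rewrite ltrBrDr addrAC -htV.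
    have [[ek3 _]|[_ hk3]] := step t g3 r1 r2 gs3; last by move: hy3; rewrite hk3 ltxx.
    have yS : shift (- V) y \in slice (t + 1) by rewrite eg3 -ek3; apply: map_f.
    have ysh : y = shift V (shift (- V) y) by rewrite /shift /= subrK; case: (y).
    rewrite ysh noncoincident_shift; apply: (config_nc (hslice r2)) => //.
    by apply: contraNneq hne => ->; rewrite -ysh.
  (* An edge [y] that begins at time [t' + 1] begins at the very vertex of the translate of [e1]:
     both vertices have the same height and lie in the strip. *)
  have y1 : y.1 = e1.1 + V.
    apply: hgt_eq; first by rewrite ey hst2 hk2 hgtD hst hk htV addrAC.
    have wy := W2 _ ys; have w2 := W2 _ e2s; rewrite e12 in w2.
    exact: window_dist D1 wy w2.
  have hj : y.2 != e1.2.
    apply: contraNneq hne => hj; rewrite /shift -hj -y1; by case: (y).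
  have hnc w i j : i != j -> nc n (w, i) (w, j).
    have -> : (w, i) = shift w (0, i) by rewrite /shift /= add0r.
    have -> : (w, j) = shift w (0, j) by rewrite /shift /= add0r.
    rewrite noncoincident_shift.
    case: (letterP i) => ->; case: (letterP j) => -> // _.
    by rewrite noncoincidentC.
  have -> : y = (e1.1 + V, y.2) by rewrite -y1; case: (y).
  by rewrite /shift; apply: hnc; rewrite eq_sym.
by have := hcap hcfg; rewrite /= size_map ltnNge hsize.
Qed.

Lemma slice_iter (t : int) (V : vec) (i : nat) :
  0 < hgt V -> t0 <= t -> t + hgt V + i%:Z <= t0 + len0%:Z ->
  (forall e : edge, e \in slice t -> shift V e \in slice (t + hgt V)) ->
  (forall e : edge, e \in slice (t + hgt V) -> shift (- V) e \in slice t) ->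
  (forall e : edge, e \in slice (t + i%:Z) -> shift V e \in slice (t + hgt V + i%:Z)) /\
  (forall e : edge, e \in slice (t + hgt V + i%:Z) -> shift (- V) e \in slice (t + i%:Z)).
Proof.
move=> hV h1 + hf hb; elim: i => [|i IH] h2; first by rewrite !addr0.
have [|IH1 IH2] := IH; first lia.
have e1 : t + i.+1%:Z = t + i%:Z + 1 by lia.
have e2 : t + hgt V + i.+1%:Z = t + hgt V + i%:Z + 1 by lia.
rewrite e1 e2; split.
  apply: slice_step IH1 IH2; lia.
apply: slice_step; rewrite ?opprK //; try lia.
by rewrite hgtN; lia.
Qed.

Lemma slice_periodic (t : int) (V : vec) (p k : nat) :
  hgt V = p%:Z -> (0 < p)%N -> t0 <= t -> t + (k.+1 * p)%:Z <= t0 + len0%:Z ->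
  (forall e : edge, e \in slice t -> shift V e \in slice (t + hgt V)) ->
  (forall e : edge, e \in slice (t + hgt V) -> shift (- V) e \in slice t) ->
  forall e : edge, e \in slice t -> shift (V *+ k) e \in slice (t + (k * p)%:Z).
Proof.
move=> hV p0 h1 + hf hb; elim: k => [|k IH] h2 e he.
  by rewrite mulr0n /shift addr0 mul0n addr0; case: e he.
have h3 : t + hgt V + (k * p)%:Z <= t0 + len0%:Z by rewrite hV; lia.
have hV0 : 0 < hgt V by rewrite hV.
have [h4 _] := slice_iter hV0 h1 h3 hf hb.
have := h4 _ (IH _ e he); rewrite /shift /= -addrA -mulrSr.
rewrite hV mulSn PoszD addrA; apply.
by lia.
Qed.

End Determinism.

Lemma pigeonhole (F : finType) (g : nat -> F) :
  exists i j, [/\ (i < j)%N, (j <= #|F|)%N & g i = g j].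
Proof.
have : ~~ injectiveb (fun i : 'I_#|F|.+1 => g i).
  apply/negP => /injectiveP /leq_card; rewrite card_ord ltnn //.
move=> /injectivePn[i [j hij e]].
have [h|h] := ltnP i j; first by exists i, j; split => //; rewrite -ltnS.
exists j, i; split; last by rewrite e.
  by rewrite ltn_neqAle h andbT; apply: contraNneq hij => /val_inj ->.
by rewrite -ltnS.
Qed.

(* Take the least [m] such that configurations in some strip have size at most
   [m] at all large levels. In a much thinner strip of a much higher level, [m]
   noncoincident edges cross a common long range of heights. If the two edges
   starting at 0 never coincided, then by [slice_step] the slices of level [n] of
   these edges would form a deterministic sequence with finitely many states up
   to translation. It would be eventually periodic, with a period vector which is
   not on the line, and so would leave the strip. *)
Lemma strong_coincidence (C : R) :
  (forall N, exists2 n, (N <= n)%N & balanced C (language sigma n)) ->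
  exists n, ~~ nc n (0, La) (0, Lb).
Proof.
move=> hgood; apply: contrapT => /forallNP hno.
have {}hno n : nc n (0, La) (0, Lb) by case: (nc n _ _) (hno n) => // /(_ isT).
have [C0 hC0] : exists C0, forall w, language sigma 0 w -> `|T (ab w)| <= C0.
  by have [n _ hn] := hgood 0%N; apply: bounded_dev hn.
pose P m := exists D, [/\ 0 < D, D <= 1 & exists N, forall n, (N <= n)%N -> capacity n D m].
have [m0 hm0] := capacity_ex hC0.
have exP : exists m, `[< P m >].
  by exists m0; apply/asboolP; exists 1; split => //; exists 0%N => n _; apply: hm0.
case: (ex_minnP exP) => -[|m] /asboolP[D [D0 D1 [N hN]]] hmin.
  exact: (@capacity0 N D D0 (hN N (leqnn _))).
have hPm : ~ P m by move=> /asboolP /hmin; rewrite ltnn.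
have Cge0 : 0 <= C by have [n _ /balanced_ge0] := hgood 0%N.
have [N1 hN1] := @spread_lim (D / 2 / (C + 1)) ltac:(by rewrite !divr_gt0 // ltr_wpDl).
have [n hn hbal] := hgood (maxn N N1); rewrite geq_max in hn.
have /andP[hnN hnN1] := hn.
have hdev w : language sigma n w -> `|T (A n w)| <= D / 2.
  move=> /(balanced_dev hbal) h; apply: le_trans h _.
  have := hN1 n hnN1; rewrite ltr_pdivlMr ?ltr_wpDl // => h.
  by have := spread_gt0 n; nra.
pose H := (absz (hgt (A n [:: La])) + absz (hgt (A n [:: Lb])))%N.
(* A state describes a slice up to translation: for each edge the height already climbed, the
   letter, and the rounded transversal position relative to the first edge. *)
pose St : finType := {ffun 'I_m.+1 -> 'I_H.+1 * letter * 'I_9}.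
pose K := #|{: St}|.
(* A period vector has height at most [K], so its transversal part is at least [kap]; [k] periods
   drift by more than 2, hence out of the strip. *)
have [kap kap0 hkap] := tr_lower (4 * K + 8).
pose k := (Num.truncn (2 / kap)).+1.
have hk : 2 < k%:R * kap by rewrite -ltr_pdivrMr // truncnS_gt.
(* Time enough to meet some state twice, followed by [k.+1] periods of length at most [K]. *)
pose Lam := (K + k.+1 * K)%N.
have [kap2 kap20 hkap2] := tr_lower (4 * Lam + 8).
pose D' := Num.min (D / 2) (kap2 / 8).
have D'0 : 0 < D' by rewrite lt_min !divr_gt0.
have D'D : D' <= D / 2 by rewrite ge_min lexx.
have D'k : D' <= kap2 / 8 by rewrite ge_min lexx orbT.
have [N2 hN2] := @spread_lim (Num.min 1 (kap2 / 4)) ltac:(by rewrite lt_min ltr01 divr_gt0).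
(* As [m.+1] is least, [P m] fails: even the thin strip of half-width [D'] holds more than [m] edges
   at some high level. *)
have [n' [hn' [c [tt [s [hs hsz]]]]]] : exists n', (maxn n N2 <= n')%N /\
    exists c t s, config n' D' c t s /\ (m < size s)%N.
  apply: contrapT => h; apply: hPm; exists D'; split => //; first lra.
  exists (maxn n N2) => n' hn' c t s hs; rewrite leqNgt; apply/negP => hlt.
  by apply: h; exists n'; split => //; exists c, t, s.
move: hn'; rewrite geq_max => /andP[hnn' hN2n'].
have := hN2 n' hN2n'; rewrite lt_min => /andP[hsp1 hsp2].
have [hc hw hp] := hs.
have s0 : nth (0, La) s 0 \in s by apply: mem_nth; apply: leq_ltn_trans hsz.
have [e1 e1s he1] := exists_argmax (fun e => hgt e.1) s0.
have [e2 e2s he2] := exists_argmax (fun e => - hgt (edge_end n' e)) s0.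
(* From the highest starting point to the lowest end point. Its transversal part is below [kap2], so
   its height exceeds [Lam]: all edges of [s] cross a common range of that length. *)
pose v := edge_end n' e2 - e1.1.
have hv0 : 0 < hgt v.
  have := hc _ e1s; have := hc _ e2s; rewrite /crosses hgtB; clear; lia.
have hTv : `|T v| < kap2 /\ `|T v| <= 3.
  have -> : T v = (T e2.1 - c) - (T e1.1 - c) + T (A n' [:: e2.2]).
    by rewrite /v /edge_end trB trD; ring.
  have h1 := hw _ e1s; have h2 := hw _ e2s.
  have h3 : `|T (A n' [:: e2.2])| <= spread n'.
    by rewrite /spread; case: (letterP e2.2) => ->; rewrite ?lerDl ?lerDr.
  set x := T e2.1 - c in h2 *; set y := T e1.1 - c in h1 *.
  set z := T _ in h3 *.
  have : `|x - y + z| <= D' + D' + spread n'.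
    apply: le_trans (ler_normD _ _) _; apply: lerD => //.
    by apply: le_trans (ler_normB _ _) _; apply: lerD.
  by split; lra.
have hvL : Lam%:Z < hgt v.
  rewrite ltNge; apply/negP => h; have [hT1 hT2] := hTv.
  have [|b1 b2] := @box_of_hgt v Lam _ hT2; first by rewrite ger0_norm // ltW.
  have v0 : v != 0 by apply: contraTneq hv0 => ->.
  by have := hkap2 v v0 b1 b2; rewrite leNgt hT1.
pose t0 := hgt e1.1.
have hcross t (e : edge) : t0 <= t <= t0 + Lam%:Z -> e \in s -> crosses n' t e.
  move=> ht es; have := he1 e es; have := he2 e es; move: hvL.
  move: ht; rewrite /v hgtB /crosses -/t0; clear; lia.
pose E := slice n n' s.
have hslice t : t0 <= t <= t0 + Lam%:Z -> config n D c t (E t).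
  move=> ht; have hsub e (es : e \in s) := sub_edgeP hnn' (hcross t e ht es).
  split.
  - by move=> e /mapP[g gs ->]; have [] := hsub g gs.
  - move=> e /mapP[g gs ->]; have [/mem_edgesP[p [q [hpq ->]]] _] := hsub g gs.
    have hl : language sigma n p.
      have hl := language_prod sigma g.2 hnn'; apply: (language_infix hl).
      by rewrite hpq; apply: infix_catr; apply: infix_refl.
    rewrite trD addrAC; apply: le_trans (ler_normD _ _) _.
    have := hw g gs; have := hdev p hl; lra.
  - rewrite /E /slice pairwise_map; apply: (sub_in_pairwise _ (allss s)) hp.
    move=> g g' gs gs'; have [h1 _] := hsub g gs; have [h2 _] := hsub g' gs'.
    exact: noncoincident_sub h1 h2.
have hcapn : capacity n D m.+1 by apply: hN.
have hsz' : size s = m.+1.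
  apply/eqP; rewrite eqn_leq hsz andbT -(size_map (sub_edge n n' t0) s).
  by apply: (hcapn c t0); apply: hslice; rewrite lexx lerDl.
pose X (t : int) (i : nat) : edge := nth (0, La) (E t) i.
have hX t i : (i < m.+1)%N -> X t i \in E t.
  by move=> hi; apply: mem_nth; rewrite size_map hsz'.
pose code (j : nat) : St := [ffun i : 'I_m.+1 => let t := t0 + j%:Z in
  (inord `|t - hgt (X t i).1|, (X t i).2,
   inord `|Num.floor (T (X t i).1 - T (X t 0%N).1) + 4|)].
have [i [j [hij hjK hcode]]] := pigeonhole code.
pose t := t0 + i%:Z; pose t' := t0 + j%:Z.
have hKL : (K <= Lam)%N by rewrite leq_addr.
have ht : t0 <= t <= t0 + Lam%:Z.
  by move: hij hjK hKL; rewrite /t -/K; clear; lia.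
have ht' : t0 <= t' <= t0 + Lam%:Z.
  by move: hjK hKL; rewrite /t' -/K; clear; lia.
have bnd (u : int) (l : nat) (hu : t0 <= u <= t0 + Lam%:Z) (hl : (l < m.+1)%N) :
    [/\ 0 <= u - hgt (X u l).1, u - hgt (X u l).1 <= H%:Z,
     0 <= Num.floor (T (X u l).1 - T (X u 0%N).1) + 4 &
     Num.floor (T (X u l).1 - T (X u 0%N).1) + 4 <= 8%:Z].
  have [hc1 hw1 _] := hslice u hu.
  have := hc1 _ (hX u l hl); rewrite /crosses /edge_end hgtD => hcr.
  have hA : hgt (A n [:: (X u l).2]) <= H%:Z.
    rewrite /H; have := hgt_pos_gt0 n La; have := hgt_pos_gt0 n Lb.
    by case: (letterP (X u l).2) => ->; clear; lia.
  have hT1 := hw1 _ (hX u l hl); have hT2 := hw1 _ (hX u 0%N (ltn0Sn _)).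
  have hd : - 2 <= T (X u l).1 - T (X u 0%N).1 <= 2.
    move: hT1 hT2; rewrite !ler_norml => /andP[? ?] /andP[? ?].
    by apply/andP; split; lra.
  have f1 : - 2 <= Num.floor (T (X u l).1 - T (X u 0%N).1).
    by rewrite floor_ge_int; case/andP: hd.
  have f2 : Num.floor (T (X u l).1 - T (X u 0%N).1) <= 2.
    by rewrite -(ler_int R); apply: le_trans (floor_le_tmp _) _; case/andP: hd.
  by move: hcr hA f1 f2; clear; split; lia.
pose V := (X t' 0%N).1 - (X t 0%N).1.
have hco l : (l < m.+1)%N -> [/\ t - hgt (X t l).1 = t' - hgt (X t' l).1,
    (X t l).2 = (X t' l).2 &
    Num.floor (T (X t l).1 - T (X t 0%N).1) = Num.floor (T (X t' l).1 - T (X t' 0%N).1)].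
  move=> hl; have := congr1 (fun g : St => g (Ordinal hl)) hcode.
  rewrite !ffunE /= -/t -/t' => -[].
  have [a1 a2 a3 a4] := bnd t l ht hl; have [b1 b2 b3 b4] := bnd t' l ht' hl.
  move=> /(inord_inj a1 a2 b1 b2) h1 h2 /(inord_inj a3 a4 b3 b4) h3.
  by split => //; move: h3; move: (Num.floor _) (Num.floor _); clear; lia.
have hV : hgt V = t' - t.
  by have [h _ _] := hco 0%N (ltn0Sn _); rewrite /V hgtB; move: h; clear; lia.
have hXV l : (l < m.+1)%N -> X t' l = shift V (X t l).
  move=> hl; have [h1 h2 h3] := hco l hl.
  have e1V : (X t' l).1 = (X t l).1 + V.
    apply: hgt_eq; first by rewrite hgtD hV; move: h1; clear; lia.
    have := floor_eq_dist h3; rewrite /V trD trB.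
    set a := T _; set b := T _; set a' := T _; set b' := T _ => h.
    rewrite (_ : _ - _ = - (a - b - (a' - b'))); last by ring.
    by rewrite normrN; apply: lt_trans h _; lra.
  by rewrite /shift -e1V h2; case: (X t' l).
have fwd (e : edge) : e \in E t -> shift V e \in E (t + hgt V).
  move=> he; have hi : (index e (E t) < m.+1)%N.
    by rewrite -hsz' -(size_map (sub_edge n n' t) s) index_mem.
  have -> : e = X t (index e (E t)) by rewrite /X nth_index.
  by rewrite -hXV // hV addrC subrK; apply: hX.
have bwd (e : edge) : e \in E (t + hgt V) -> shift (- V) e \in E t.
  rewrite hV addrC subrK => he; have hi : (index e (E t') < m.+1)%N.
    by rewrite -hsz' -(size_map (sub_edge n n' t') s) index_mem.
  have -> : e = X t' (index e (E t')) by rewrite /X nth_index.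
  rewrite hXV // /shift /= addrK; case: (X t _) (hX t _ hi) => //.
have hpV : hgt V = (j - i)%N by rewrite hV /t /t'; move: hij; clear; lia.
have hp0 : (0 < j - i)%N by rewrite subn_gt0.
have hend : t + (k.+1 * (j - i))%:Z <= t0 + Lam%:Z.
  have : (k.+1 * (j - i) <= k.+1 * K)%N by rewrite leq_mul2l; move: hjK; rewrite -/K; clear; lia.
  by move: hij hjK; rewrite /t /Lam -/K; clear; lia.
have ht0 : t0 <= t by case/andP: ht.
have hper := slice_periodic hnn' D1 hcapn (eq_leq (esym hsz')) (hno n) hslice hcross
  hpV hp0 ht0 hend fwd bwd.
have hX0 := hX t 0%N (ltn0Sn _).
have [_ w1 _] := hslice t ht.
have [_ w2 _] : config n D c (t + (k * (j - i))%:Z) (E (t + (k * (j - i))%:Z)).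
  have hkk : (k * (j - i) <= k.+1 * (j - i))%N by rewrite leq_mul2r leqnSn orbT.
  apply: hslice; move: hend ht0 hkk; move: (k.+1 * _)%N (k * _)%N.
  move=> a b h1 h2 h3; rewrite (le_trans h2) ?lerDl //=.
  by apply: le_trans h1; rewrite lerD2l lez_nat.
have := w2 _ (hper _ hX0); have := w1 _ hX0; rewrite /shift /= trD.
have -> : T (V *+ k) = T V *+ k.
  elim: (k) => [|q IH]; first by rewrite !mulr0n tr0.
  by rewrite !mulrS trD IH.
have hVT : kap <= `|T V|.
  have V0 : V != 0 by apply/eqP => e; move: hpV hij; rewrite e /hgt /=; clear; lia.
  have hT3 : `|T V| <= 3.
    have [_ w3 _] := hslice t' ht'; have := w3 _ (hX t' 0%N (ltn0Sn _)); have := w1 _ hX0.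
    rewrite /V trB !ler_norml => /andP[? ?] /andP[? ?]; apply/andP; split; lra.
  have [|b1 b2] := @box_of_hgt V K _ hT3; last exact: hkap.
  by rewrite hpV; move: hjK; rewrite -/K; clear; lia.
move=> h1 h2; have : `|T V *+ k| <= 2.
  rewrite (_ : T V *+ k = (T (X t 0%N).1 + T V *+ k - c) - (T (X t 0%N).1 - c)); last by ring.
  by apply: le_trans (ler_normB _ _) _; lra.
rewrite normrMn -mulr_natl => h3.
have : k%:R * kap <= k%:R * `|T V| by rewrite ler_wpM2l.
lra.
Qed.

Section Crossing.
Variable C : R.
Hypothesis C0 : 0 < C.

(** * Close paths share most of their edges *)

(* The path of level [n] that starts at [X] and reads [W] stays close to the line
   at transversal position [c]. *)
Definition near n (c : R) (X : vec) (W : word) :=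
  forall p q, W = p ++ q -> `|T (X + A n p) - c| <= 3 * C * spread n.

Definition cone n (v : vec) := exists p : vec, [/\ v = lmap (S 0 n) p, 0 <= p.1 & 0 <= p.2].

(* Along the cone of positive combinations of the two steps of level [n], the
   path of [W'] from [Y] starts before and ends after that of [W] from [X]. *)
Definition covers n (X : vec) (W : word) (Y : vec) (W' : word) :=
  cone n (X - Y) /\ cone n (Y + A n W' - (X + A n W)).

Lemma near_cat n c X u v w : near n c X (u ++ v ++ w) -> near n c (X + A n u) v.
Proof.
move=> h p q hv; rewrite -[X + _ + _]addrA -pos_cat; apply: (h _ (q ++ w)).
by rewrite hv !catA.
Qed.

Lemma coneD n u v : cone n u -> cone n v -> cone n (u + v).
Proof.
move=> [p [-> p1 p2]] [q [-> q1 q2]]; exists (p + q).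
by rewrite lmapD; split => //=; apply: addr_ge0.
Qed.

Lemma cone_pos n w : cone n (A n w).
Proof. by exists (ab w); rewrite pos_lmap; have [? ?] := ab_ge0 w. Qed.

Lemma lmap_ge0 s (v : vec) : 0 <= v.1 -> 0 <= v.2 -> 0 <= (lmap s v).1 /\ 0 <= (lmap s v).2.
Proof.
move=> h1 h2; have [a1 a2] := ab_ge0 (s [:: La]); have [b1 b2] := ab_ge0 (s [:: Lb]).
by rewrite /lmap /=; split; apply: addr_ge0; apply: mulr_ge0.
Qed.

Lemma lmap_prod_comp n m v : (n <= m)%N ->
  lmap (S 0 m) v = lmap (S 0 n) (lmap (S n m) v).
Proof.
move=> h; rewrite (@subst_prod_comp sigma 0 n m) //.
exact: (lmap_comp _ (subst_prodP 0 n)).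
Qed.

Lemma cone_le n m v : (n <= m)%N -> cone m v -> cone n v.
Proof.
move=> h [p [-> p1 p2]]; exists (lmap (S n m) p); rewrite -lmap_prod_comp //.
by have [? ?] := lmap_ge0 (S n m) p1 p2.
Qed.

Lemma lmap_inj n u v : lmap (S 0 n) u = lmap (S 0 n) v -> u = v.
Proof.
have := det2_prod sigma_subst 0 n sigma_unimodular; rewrite /det2 /lmap.
case: (ab _) (ab _) u v => [a b] [c e] [x y] [z w] /= hd h.
have h1 := congr1 fst h; have h2 := congr1 snd h; rewrite /= in h1 h2.
have h3 : c * (x - z) = a * (w - y) by lia.
have h4 : e * (x - z) = b * (w - y) by lia.
have e1 : (c * b - a * e) * (x - z) = 0.
  rewrite (_ : _ * _ = b * (c * (x - z)) - a * (e * (x - z))); last by ring.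
  by rewrite h3 h4; ring.
have e2 : (c * b - a * e) * (y - w) = 0.
  rewrite (_ : _ * _ = e * (a * (w - y)) - c * (b * (w - y))); last by ring.
  by rewrite -h3 -h4; ring.
have hd0 : c * b - a * e != 0 by apply/eqP => h0; rewrite h0 normr0 in hd.
by apply: vec_eq => /=; apply/eqP; rewrite -subr_eq0; move/eqP: e1; move/eqP: e2;
  rewrite !mulf_eq0 (negbTE hd0).
Qed.

Lemma size_lmap s w : is_substitution s ->
  (size (s w))%:Z = (size (s [:: La]))%:Z * (ab w).1 + (size (s [:: Lb]))%:Z * (ab w).2.
Proof. by move=> hs; rewrite !size_ab (ab_subst hs) /lmap /=; ring. Qed.

(** The identity [key] is the analogue of [norm_dev_len] between the levels [n] and [N]; it shows
    that long blocks narrow the transversal scale. *)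
Lemma spread_block n N Q : (n <= N)%N -> (0 < Q)%N ->
  (forall i, (Q <= size (S n N [:: i]))%N) -> spread N * Q%:R <= 2 * spread n.
Proof.
move=> hnN Q0 hQ; have hs := subst_prodP n N.
set qa := size (S n N [:: La]); set qb := size (S n N [:: Lb]).
have key : `|d N La| * qb%:R + `|d N Lb| * qa%:R = spread n.
  have := @norm_dev_opp N qb%:R qa%:R (mulr_ge0 (ler0n _ _) (ler0n _ _)).
  rewrite !normr_nat => <-; have := @norm_dev_opp n 1 1 (mulr_ge0 ler01 ler01).
  rewrite !normr1 !mulr1 -/(spread n) => <-.
  have hdet := det2_prod sigma_subst n N sigma_unimodular.
  rewrite !(pos_step _ hnN) -[qb%:R]/(qb%:Z%:~R) -[qa%:R]/(qa%:Z%:~R) /qa /qb !size_ab.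
  move: hdet; rewrite /det2; case: (ab _) (ab _) => [a b] [e g] /= hdet.
  have h1 : `|(e * b - a * g)%:~R| = 1 :> R by rewrite -intr_norm hdet.
  rewrite -[RHS]mul1r -[X in _ = X * _]h1 -normrM; congr `|_|.
  by rewrite !(intrD, intrN, intrM); ring.
have ha : `|d N La| * Q%:R <= `|d N La| * qb%:R by rewrite ler_wpM2l // ler_nat hQ.
have hb : `|d N Lb| * Q%:R <= `|d N Lb| * qa%:R by rewrite ler_wpM2l // ler_nat hQ.
have := spread_gt0 n; rewrite [spread N]/spread [leLHS]mulrDl; lra.
Qed.

Definition dsum n c X w : R := \sum_(e <- edges n X w) (T e.1 - c).

Lemma dsum_cat n c X u v : dsum n c X (u ++ v) = dsum n c X u + dsum n c (X + A n u) v.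
Proof. by rewrite /dsum edges_cat big_cat. Qed.

Lemma dsum_shift n c X w : dsum n c X w = (size w)%:R * (T X - c) + dsum n 0 0 w.
Proof.
rewrite /dsum; suff h Y : \sum_(e <- edges n (X + Y) w) (T e.1 - c) =
    (size w)%:R * (T X - c) + \sum_(e <- edges n Y w) (T e.1 - 0).
  by rewrite -h addr0.
elim: w Y => [|i w IH] Y /=; first by rewrite !big_nil mul0r addr0.
by rewrite !big_cons /= -[X + Y + _]addrA IH trD -natr1; ring.
Qed.

Lemma dsum_bound n c X w (B : R) : (forall p q, w = p ++ q -> `|T (X + A n p) - c| <= B) ->
  `|dsum n c X w| <= (size w)%:R * B.
Proof.
elim: w X => [|i w IH] X h; first by rewrite /dsum big_nil normr0 mul0r.
rewrite /dsum /= big_cons; apply: le_trans (ler_normD _ _) _.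
rewrite -natr1 mulrDl mul1r addrC; apply: lerD.
  apply: IH => p q hw; rewrite -[X + _ + _]addrA -pos_cons; apply: (h _ q).
  by rewrite hw.
by have := h [::] (i :: w) erefl; rewrite pos_nil addr0.
Qed.

Lemma dsum_short n c X w (B : R) (L : nat) : 0 <= B -> (size w <= L)%N -> `|T X - c| <= B ->
  `|dsum n c X w| <= L%:R * (B + spread n * L%:R).
Proof.
move=> B0 hL hX; have hs := ltW (spread_gt0 n).
apply: (@le_trans _ _ ((size w)%:R * (B + spread n * L%:R))).
  apply: dsum_bound => p q hw; rewrite trD addrAC.
  apply: le_trans (ler_normD _ _) _; apply: lerD => //.
  apply: le_trans (le_norm_tr_pos _ _) _; rewrite ler_wpM2l // ler_nat.
  by apply: leq_trans hL; rewrite hw size_cat leq_addr.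
by rewrite ler_wpM2r ?ler_nat // addr_ge0 // mulr_ge0.
Qed.

Definition block_dsum n N i := dsum n 0 0 (S n N [:: i]).

(** Each block starts within the allowance of [c]. Up to this error the sum depends only on the
    letter counts of [W], which makes it comparable between two paths. *)
Lemma dsum_near n N c X W : (n <= N)%N -> near N c X W ->
  `|dsum n c X (S n N W) - ((ab W).1%:~R * block_dsum n N La +
     (ab W).2%:~R * block_dsum n N Lb)| <= (size (S n N W))%:R * (3 * C * spread N).
Proof.
move=> hnN; have hs := subst_prodP n N.
elim: W X => [|i W IH] X h.
  by rewrite (subst_nil hs) /dsum /ab /= big_nil !mul0r addr0 subr0 normr0.
rewrite (subst_cons hs) dsum_cat size_cat natrD mulrDl ab_cons /=.
rewrite -(@pos_comp n N) // dsum_shift -/(block_dsum n N i).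
have hX := h [::] (i :: W) erefl; rewrite pos_nil addr0 in hX.
have {}IH := IH (X + A N [:: i]) (near_cat (u := [:: i]) (v := W) (w := [::]) _).
rewrite cats0 in IH; have {}IH := IH h.
move: IH hX; set x := dsum _ _ _ _; set B := 3 * C * spread N => IH hX.
have -> : (size (S n N [:: i]))%:R * (T X - c) + block_dsum n N i + x -
  (((ab [:: i]).1 + (ab W).1)%:~R * block_dsum n N La +
   ((ab [:: i]).2 + (ab W).2)%:~R * block_dsum n N Lb) =
  (size (S n N [:: i]))%:R * (T X - c) +
  (x - ((ab W).1%:~R * block_dsum n N La + (ab W).2%:~R * block_dsum n N Lb)).
  by rewrite !intrD; case: (letterP i) => ->; rewrite /ab /=; ring.
apply: le_trans (ler_normD _ _) _; apply: lerD => //.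
by rewrite normrM normr_nat ler_wpM2l.
Qed.

(** Here [q] stands for the lengths of the images of letters. Balance compares the shorter word with
    a prefix of the longer one; the remainder is short because the images have nearly equal
    lengths. *)
Lemma balanced_count N W W' (L : nat) (q : letter -> nat) :
  balanced C (language sigma N) -> language sigma N W -> language sigma N W' ->
  (forall i, (1 <= q i <= L)%N) ->
  `|(q La)%:R * ((ab W).1 - (ab W').1)%:~R + (q Lb)%:R * ((ab W).2 - (ab W').2)%:~R| <= L%:R :> R ->
  `|((ab W).1 - (ab W').1)%:~R| <= C + (1 + 2 * C) * L%:R :> R /\
  `|((ab W).2 - (ab W').2)%:~R| <= C + (1 + 2 * C) * L%:R :> R.
Proof.
move=> hC + + hq; wlog hle : W W' / (size W' <= size W)%N.
  move=> hw hW hW' h; case: (leqP (size W') (size W)) => hs; first exact: hw.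
  have [|h1 h2] := hw W' W (ltnW hs) hW' hW.
    by rewrite -normrN opprD -!mulrN -!intrN !opprB.
  by split; rewrite -normrN -intrN opprB.
move=> hW hW'; set Wa := take (size W') W; set Wb := drop (size W') W.
have hab : ab W = ab Wa + ab Wb by rewrite -ab_cat cat_take_drop.
have hWa : language sigma N Wa by exact: language_infix hW (infix_take _ _).
have hsz : size Wa = size W' by rewrite size_takel.
have hca := hC Wa W' hWa hW' hsz La; have hcb := hC Wa W' hWa hW' hsz Lb.
have [b1 b2] := ab_ge0 Wb; rewrite hab /=.
have -> : (ab Wa).1 + (ab Wb).1 - (ab W').1 = ((ab Wa).1 - (ab W').1) + (ab Wb).1 by ring.
have -> : (ab Wa).2 + (ab Wb).2 - (ab W').2 = ((ab Wa).2 - (ab W').2) + (ab Wb).2 by ring.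
have hI (u v : int) : (u + v)%:~R = u%:~R + v%:~R :> R by rewrite intrD.
rewrite (hI (_ - (ab W').1)) (hI (_ - (ab W').2)).
have {}hca : `|((ab Wa).1 - (ab W').1)%:~R| <= C :> R by rewrite intrD intrN ler_norml.
have {}hcb : `|((ab Wa).2 - (ab W').2)%:~R| <= C :> R by rewrite intrD intrN ler_norml.
have b1' : 0 <= (ab Wb).1%:~R :> R by rewrite ler0z.
have b2' : 0 <= (ab Wb).2%:~R :> R by rewrite ler0z.
move: (_%:~R) ((ab Wb).1%:~R) (_%:~R) ((ab Wb).2%:~R) hca hcb b1' b2' => x u y v hx hy u0 v0.
have qL i : 1 <= (q i)%:R :> R /\ (q i)%:R <= L%:R :> R.
  by have /andP[h1 h2] := hq i; rewrite ler1n ler_nat.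
have [qa1 qa2] := qL La; have [qb1 qb2] := qL Lb.
move: hx hy; rewrite !ler_norml => /andP[hx1 hx2] /andP[hy1 hy2] /andP[h1 h2].
move: ((q La)%:R) ((q Lb)%:R) (L%:R) qa1 qa2 qb1 qb2 h1 h2 => a b l qa1 qa2 qb1 qb2 h1 h2.
have l1 : 1 <= l by lra.
have ax : - (l * C) <= a * x by nra.
have bx : - (l * C) <= b * y by nra.
have au : u <= a * u by nra.
have bv : v <= b * v by nra.
have cl : 0 <= C * l by nra.
by split; apply/andP; split; nra.
Qed.

Definition count_bound (L : nat) : R := C + (1 + 2 * C) * L%:R.

(* The last inequality in the proof of [crossing] dictates this value. *)
Definition cross_time (L : nat) : nat :=
  (Num.truncn (4 * (L%:R + 2 * count_bound L * (L * L)%:R + 2 * (L * L)%:R))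
     + 2 * L + 2)%N.

Lemma int_ivt (a : nat -> int) (m : nat) :
  (forall t, (t < m)%N -> `|a t.+1 - a t| <= 1) ->
  (forall t, (t <= m)%N -> a t != 0) ->
  (forall t, (t <= m)%N -> 1 <= a t) \/ (forall t, (t <= m)%N -> 1 <= - a t).
Proof.
move=> hst h0; have [hp|hn] := lerP 0 (a 0%N); [left|right]; elim.
- by move=> _; have := h0 0%N (leq0n _); lia.
- by move=> t IH ht; have := IH (ltnW ht); have := hst t ht; have := h0 _ ht; lia.
- by move=> _; have := h0 0%N (leq0n _); lia.
- by move=> t IH ht; have := IH (ltnW ht); have := hst t ht; have := h0 _ ht; lia.
Qed.

Lemma dsum_nth n c X w : dsum n c X w =
  \sum_(0 <= t < size w) (T (X + A n (take t w)) - c).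
Proof.
elim: w X => [|i w IH] X; first by rewrite /dsum /= big_nil big_geq.
rewrite /dsum /= big_cons big_nat_recl //= pos_nil addr0; congr (_ + _).
rewrite -/(dsum n c _ w) IH; apply: eq_bigr => t _.
by rewrite (pos_cons _ i (take t w)) addrA.
Qed.

Lemma norm_devB n : `|d n La - d n Lb| = spread n.
Proof.
have := @norm_dev_opp n 1 1 (mulr_ge0 ler01 ler01).
by rewrite !normr1 !mulr1.
Qed.

(* Two lattice paths that stay close to the same line have nearly the same
   average distance to it, hence one cannot stay strictly on one side of the
   other. *)
Lemma crossing n N (L : nat) c X W Y W' : (n <= N)%N ->
  (forall i, (size (S n N [:: i]) <= L)%N) ->
  24 * C * spread N <= spread n ->
  balanced C (language sigma N) -> language sigma N W -> language sigma N W' ->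
  near N c X W -> near N c Y W' -> covers N X W Y W' -> (cross_time L <= size W)%N ->
  exists e e' : edge, [/\ e \in edges n X (S n N W), e' \in edges n Y (S n N W') &
    e.1 = e'.1].
Proof.
move=> hnN hL hsp hC hW hW' hX hY [[p [hp p1 p2]] [p' [hp' p1' p2']]] hT.
have hs := subst_prodP n N.
set U := S n N W; set U' := S n N W'.
(* In the basis of the two steps of level [n], [X - Y] has coordinate sum [i0]. So the vertices
   after [t] letters of [U] and [i0 + t] letters of [U'] differ by a vector of coordinate sum 0. *)
pose i0 := (size (S n N [:: La]) * absz p.1 + size (S n N [:: Lb]) * absz p.2)%N.
have habW' : ab W' = ab W + p + p'.
  apply: (@lmap_inj N); rewrite !lmapD -!pos_lmap -hp -hp'.
  by apply: vec_eq => /=; ring.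
have hsz : (i0 + size U <= size U')%N.
  rewrite -lez_nat PoszD /i0 PoszD !PoszM /U /U' (size_lmap W hs) (size_lmap W' hs).
  rewrite habW' /= !gez0_abs //.
  have hq i : 0 <= (size (S n N [:: i]))%:Z by [].
  by have := mulr_ge0 (hq La) p1'; have := mulr_ge0 (hq Lb) p2'; lia.
have szW : (size W <= size U)%N by exact: leq_size_subst hs _.
have tmV : (lmap (S n N) p).1 + (lmap (S n N) p).2 = i0%:Z.
  by rewrite /i0 PoszD !PoszM !gez0_abs // !size_ab /lmap /=; ring.
pose D t := lmap (S n N) p + ab (take t U) - ab (take (i0 + t) U').
have hD t : X + A n (take t U) - (Y + A n (take (i0 + t) U')) = lmap (S 0 n) (D t).
  rewrite /D lmapB lmapD -lmap_prod_comp // -hp -!pos_lmap.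
  by apply: vec_eq => /=; ring.
have hD2 t : (t <= size U)%N -> D t = ((D t).1, - (D t).1).
  move=> ht; suff hk : (D t).1 + (D t).2 = 0.
    rewrite [LHS]surjective_pairing; congr (_, _); move: hk.
    by move: (D t).1 (D t).2; clear; lia.
  have e1 := size_ab (take t U); have e2 := size_ab (take (i0 + t) U').
  rewrite size_takel // in e1; rewrite size_takel in e2; last first.
    by apply: leq_trans hsz; rewrite leq_add2l.
  move: e1 e2 tmV; rewrite /D.
  move: (lmap _ _) (ab (take t U)) (ab (take (i0 + t) U')) => [? ?] [? ?] [? ?] /=.
  by clear; lia.
case: (pselect (exists t, (t < size U)%N /\ (D t).1 = 0)) => [[t [htU ht0]]|hno].
  have ht' : (i0 + t < size U')%N by apply: leq_trans hsz; rewrite ltn_add2l.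
  exists (X + A n (take t U), nth La U t).
  exists (Y + A n (take (i0 + t) U'), nth La U' (i0 + t)); split => /=.
  - apply/mem_edgesP; exists (take t U), (drop t.+1 U); split => //=.
    by rewrite -drop_nth // cat_take_drop.
  - apply/mem_edgesP; exists (take (i0 + t) U'), (drop (i0 + t).+1 U'); split => //=.
    by rewrite -drop_nth // cat_take_drop.
  apply/eqP; rewrite -subr_eq0 hD (hD2 t (ltnW htU)) ht0 oppr0.
  by rewrite /lmap /= !mulr0.
exfalso.
have U0 : (0 < size U)%N by apply: leq_trans szW; apply: leq_trans hT; rewrite /cross_time addnS.
have hpred : (size U).-1.+1 = size U by rewrite prednK.
have hstep t : (t < (size U).-1)%N -> `|(D t.+1).1 - (D t).1| <= 1.
  move=> ht; have ht1 : (t < size U)%N by lia.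
  have ht' : (i0 + t < size U')%N by apply: leq_trans hsz; rewrite ltn_add2l.
  rewrite /D addnS !(take_nth La) // -!cats1 !ab_cat.
  have h01 i : 0 <= (ab [:: i]).1 <= 1 by case: (letterP i) => ->.
  have := h01 (nth La U t); have := h01 (nth La U' (i0 + t)).
  move: (lmap _ _) (ab (take t U)) (ab [:: _]) (ab (take _ U')) (ab [:: _]).
  by move=> [? ?] [? ?] [? ?] [? ?] [? ?] /=; clear; lia.
have hne t : (t <= (size U).-1)%N -> (D t).1 != 0.
  by move=> ht; apply/eqP => h; apply: hno; exists t; split => //; lia.
(* Such a difference is a multiple of the difference of the two steps. If it never vanishes, its
   transversal part is at least [spread n], and its sign is constant because the integer factor
   moves by at most 1. *)
have [e he hsgn] : exists2 e : R, `|e| = 1 & forall t, (t < size U)%N ->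
    spread n <= e * (T (X + A n (take t U)) - T (Y + A n (take (i0 + t) U'))).
  pose e1 : R := Num.sg (d n La - d n Lb).
  have hnz : d n La - d n Lb != 0.
    by rewrite -normr_gt0 norm_devB spread_gt0.
  have he1 : `|e1| = 1 by rewrite normr_sg hnz.
  have e1d : e1 * (d n La - d n Lb) = spread n by rewrite -norm_devB normrEsg.
  have hTD t : (t < size U)%N -> T (X + A n (take t U)) - T (Y + A n (take (i0 + t) U')) =
      (d n La - d n Lb) * (D t).1%:~R.
    move=> ht; rewrite -trB hD (hD2 t (ltnW ht)) tr_lmap /= intrN.
    by rewrite /pos; ring.
  have [hpos|hneg] := int_ivt hstep hne.
    exists e1 => // t ht; rewrite hTD // mulrA e1d ler_peMr ?(ltW (spread_gt0 _)) //.
    by rewrite -[1]/(1%:~R) ler_int; apply: hpos; lia.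
  exists (- e1); first by rewrite normrN.
  move=> t ht; rewrite hTD // mulrA mulNr e1d mulNr -mulrN -intrN.
  rewrite ler_peMr ?(ltW (spread_gt0 _)) //.
  by rewrite -[1]/(1%:~R) ler_int; apply: hneg; lia.
(* The portion of [U'] facing [U] is [u2] without its prefix [u1]; both prefixes end at most [L]
   letters after a block boundary of [W']. *)
pose u1 := take i0 U'; pose u2 := take (i0 + size U) U'.
have i0U : (i0 <= size U')%N by lia.
have su1 : size u1 = i0 by rewrite size_takel.
have su2 : size u2 = (i0 + size U)%N by rewrite size_takel.
pose V := take (size U) (drop i0 U').
have u2E : u2 = u1 ++ V by rewrite /u2 takeD.
have sV : size V = size U.
  by apply/eqP; rewrite -(eqn_add2l i0) -{1}su1 -size_cat -u2E su2.
have hsum : spread n * (size U)%:R <=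
    e * (dsum n c X U - (dsum n c Y u2 - dsum n c Y u1)).
  rewrite u2E dsum_cat [dsum n c Y u1 + _]addrC addrK !dsum_nth sV -sumrB mulr_sumr.
  have -> : spread n * (size U)%:R = \sum_(0 <= t < size U) spread n.
    by rewrite big_const_nat subn0 iter_addr addr0 mulr_natr.
  rewrite big_nat_cond [leRHS]big_nat_cond; apply: ler_sum => t /andP[/andP[_ ht] _].
  have -> : Y + A n u1 + A n (take t V) = Y + A n (take (i0 + t) U').
    by rewrite -[Y + _ + _]addrA -pos_cat takeD /V take_takel // ltnW.
  by rewrite opprB addrA subrK; apply: hsgn.
have pre1 : prefix u1 (S n N W') by apply/prefixP; exists (drop i0 U'); rewrite cat_take_drop.
have pre2 : prefix u2 (S n N W').
  by apply/prefixP; exists (drop (i0 + size U) U'); rewrite cat_take_drop.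
have [w1 [x1 [/prefixP[y1 hw1] hu1 hx1]]] := prefix_subst hs hL pre1.
have [w2 [x2 [/prefixP[y2 hw2] hu2 hx2]]] := prefix_subst hs hL pre2.
have LU : (L < size U)%N.
  by apply: leq_trans szW; apply: leq_trans hT; rewrite /cross_time; clear; lia.
have [w3 hw3] : exists w3, w2 = w1 ++ w3.
  have [h|h] := leqP (size w1) (size w2).
    by exists (drop (size w1) w2); exact: cat_prefix_drop (etrans (esym hw1) hw2) h.
  exfalso; have h3 := cat_prefix_drop (etrans (esym hw2) hw1) (ltnW h).
  have hle : (size (S n N w2) <= size (S n N w1))%N.
    by rewrite [in leqRHS]h3 (subst_cat hs) size_cat leq_addr.
  move: su1 su2; rewrite hu1 hu2 !size_cat.
  by move: hle hx1 hx2 LU; clear; lia.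
have hW3 : language sigma N w3.
  apply: (language_infix hW'); rewrite hw2 hw3 -catA.
  exact: infix_infix.
pose B := 3 * C * spread N.
have B0 : 0 <= B by rewrite !mulr_ge0 // ?ltW // spread_gt0.
have hB : 8 * B <= spread n by apply: le_trans hsp; rewrite /B; lra.
have near3 : near N c (Y + A N w1) w3.
  by apply: (near_cat (u := w1) (v := w3) (w := y2)); rewrite catA -hw3 -hw2.
have nY1 : `|T (Y + A N w1) - c| <= B by apply: (hY w1 y1).
have nY2 : `|T (Y + A N w2) - c| <= B by apply: (hY w2 y2).
have dX := dsum_near hnN hX; have dY := dsum_near hnN near3.
have dx1 := @dsum_short n c _ x1 B L B0 hx1 nY1.
have dx2 := @dsum_short n c _ x2 B L B0 hx2 nY2.
have es1 : dsum n c Y u1 = dsum n c Y (S n N w1) + dsum n c (Y + A N w1) x1.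
  by rewrite hu1 dsum_cat -pos_comp.
have es2 : dsum n c Y u2 = dsum n c Y (S n N w1) + dsum n c (Y + A N w1) (S n N w3) +
    dsum n c (Y + A N w2) x2.
  by rewrite hu2 dsum_cat -pos_comp // {1}hw3 (subst_cat hs) dsum_cat -pos_comp.
have hblock i : `|block_dsum n N i| <= (L * L)%:R * spread n.
  apply: le_trans (@dsum_short n 0 0 _ 0 L (lexx 0) (hL i) _) _; first by rewrite tr0 subr0 normr0.
  by rewrite add0r natrM [leRHS]mulrAC mulrA.
have size3 : (size U + size x1 = size (S n N w3) + size x2)%N.
  move: su1 su2; rewrite hu1 hu2 hw3 (subst_cat hs) !size_cat; clear; lia.
have hq i : (1 <= size (S n N [:: i]) <= L)%N by rewrite (subst_size_gt0 hs) hL.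
have [|c1 c2] := balanced_count hC hW hW3 hq.
  have -> : (size (S n N [:: La]))%:R * ((ab W).1 - (ab w3).1)%:~R +
     (size (S n N [:: Lb]))%:R * ((ab W).2 - (ab w3).2)%:~R =
     ((size U)%:Z - (size (S n N w3))%:Z)%:~R :> R.
    rewrite /U (size_lmap W hs) (size_lmap w3 hs).
    rewrite -[(size (S n N [:: La]))%:R]/((size (S n N [:: La]))%:Z%:~R).
    rewrite -[(size (S n N [:: Lb]))%:R]/((size (S n N [:: Lb]))%:Z%:~R).
    by rewrite !(intrD, intrN, intrM); ring.
  rewrite -intr_norm -[L%:R]/(L%:Z%:~R) ler_int.
  by move: size3 hx1 hx2; clear; lia.
rewrite -/(count_bound L) in c1 c2.
set z1 := (_%:~R : R) in c1; set z2 := (_%:~R : R) in c2.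
have hz : `|z1 * block_dsum n N La + z2 * block_dsum n N Lb| <=
    2 * (count_bound L * ((L * L)%:R * spread n)).
  rewrite mulr_natl mulr2n; apply: le_trans (ler_normD _ _) _.
  by rewrite !normrM; apply: lerD; apply: ler_pM.
have hfin : e * (dsum n c X U - (dsum n c Y u2 - dsum n c Y u1)) <=
    (size U)%:R * B + (size (S n N w3))%:R * B +
    2 * (count_bound L * ((L * L)%:R * spread n)) + 2 * (L%:R * (B + spread n * L%:R)).
  apply: le_trans (ler_norm _) _; rewrite normrM he mul1r es1 es2.
  move: dX dY dx1 dx2 hz; rewrite -/B -/U.
  have -> : z1 = (ab W).1%:~R - (ab w3).1%:~R by rewrite /z1 intrD intrN.
  have -> : z2 = (ab W).2%:~R - (ab w3).2%:~R by rewrite /z2 intrD intrN.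
  move: (dsum n c X U) (dsum n c Y (S n N w1)) (dsum n c _ (S n N w3)) (dsum n c _ x1)
    (dsum n c _ x2) (block_dsum n N La) (block_dsum n N Lb) => a b g h k l m.
  move: ((ab W).1%:~R) ((ab W).2%:~R) ((ab w3).1%:~R) ((ab w3).2%:~R) => i1 i2 j1 j2.
  move: (_ * B) (_ * B) (L%:R * _) (2 * _) => r1 r2 r3 r4; clear.
  rewrite !ler_norml => /andP[? ?] /andP[? ?] /andP[? ?] /andP[? ?] /andP[? ?].
  by apply/andP; split; lra.
have hs3 : (size (S n N w3))%:R <= (size U)%:R + L%:R :> R.
  by rewrite -natrD ler_nat; move: size3 hx1; clear; lia.
have htime : 4 * (L%:R + 2 * count_bound L * (L * L)%:R + 2 * (L * L)%:R) < (size U)%:R :> R.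
  apply: lt_le_trans (truncnS_gt _) _; rewrite ler_nat; apply: leq_trans szW.
  by apply: leq_trans hT; rewrite /cross_time -addnA -addn1 leq_add2l addn2.
(* The terms proportional to [size U] amount to [2 * B * size U], at most a quarter of the lower
   bound [spread n * size U]; [cross_time] takes care of the remaining ones. *)
have := le_trans hsum hfin; rewrite natrM in htime *.
have spn := spread_gt0 n; have kb := le_trans (normr_ge0 _) c1.
move: (ler0n R L) (ler0n R (size U)) B0 hB hs3 htime spn kb.
move: ((size U)%:R) ((size (S n N w3))%:R) (L%:R) (spread n) (count_bound L) (B).
clear=> u v l s k b l0 u0 b0 hb hv ht s0 k0 hfinal.
have h1 : v * b <= (u + l) * b by rewrite ler_wpM2r.
have h2 : u * (8 * b) <= u * s by rewrite ler_wpM2l.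
have h3 : l * (8 * b) <= l * s by rewrite ler_wpM2l.
have h4 : (4 * (l + 2 * k * (l * l) + 2 * (l * l))) * s < u * s by rewrite ltr_pM2r.
have h5 : 0 <= l * s by rewrite mulr_ge0 // ltW.
have h6 : 0 <= l * l * s by rewrite !mulr_ge0 // ltW.
have h7 : 0 <= k * (l * l * s) by rewrite mulr_ge0.
lra.
Qed.

Lemma language_subst n m W : (n <= m)%N -> language sigma m W -> language sigma n (S n m W).
Proof.
move=> h [i [k [hk hw]]]; exists i, k; split; first exact: leq_trans hk.
rewrite (@subst_prod_compE sigma n m k) //; have /infixP[p [q ->]] := hw.
rewrite !(subst_cat (subst_prodP n m)).
exact: infix_infix.
Qed.

Definition misses N X W Y W' : nat :=
  count (fun e => e \notin edges 0 Y (S 0 N W')) (edges 0 X (S 0 N W)).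

Definition miss_bound N (beta K : R) := forall c X W Y W',
  language sigma N W -> language sigma N W' -> near N c X W -> near N c Y W' ->
  covers N X W Y W' -> (misses N X W Y W')%:R <= beta * (size (S 0 N W))%:R + K.

(* At some level, close paths miss at most a proportion [beta] of each other's
   edges of level 0, up to an additive constant. *)
Definition achievable (beta : R) := exists N K,
  [/\ 0 <= K, balanced C (language sigma N) & miss_bound N beta K].

Lemma achievable1 N : balanced C (language sigma N) -> achievable 1.
Proof.
move=> hN; exists N, 0; split => // c X W Y W' _ _ _ _ _.
rewrite mul1r addr0 ler_nat /misses -(size_edges 0 X (S 0 N W)).
exact: count_size.
Qed.

Section Contraction.
Variables (n0 n1 N L : nat).
Hypothesis n01 : (n0 <= n1)%N.
Hypothesis n1N : (n1 <= N)%N.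
Hypothesis hcoin : forall e e' : edge, e.1 = e'.1 -> exists2 x,
  x \in edges n0 e.1 (S n0 n1 [:: e.2]) & x \in edges n0 e'.1 (S n0 n1 [:: e'.2]).
Hypothesis hL : forall i, (size (S n1 N [:: i]) <= L)%N.
Hypothesis hsp : 24 * C * spread N <= spread n1.
Hypothesis hbal : balanced C (language sigma N).

(** Each stretch of [cross_time L] letters contains a common vertex of level [n1] by [crossing], and
    [hcoin] turns it into a common edge of level [n0]. *)
Lemma common_count c X W Y W' k :
  language sigma N W -> language sigma N W' -> near N c X W -> near N c Y W' ->
  covers N X W Y W' -> (k * cross_time L <= size W)%N ->
  (k <= count (mem (edges n0 Y (S n0 N W'))) (edges n0 X (S n0 N W)))%N.
Proof.
move=> + hW'; elim: k X W => [//|k IH] X W hW hX hY [hc1 hc2] hk.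
have hs := subst_prodP n0 N.
have n0N : (n0 <= N)%N by lia.
set t := cross_time L in hk.
have hWE : W = take t W ++ drop t W by rewrite cat_take_drop.
have ht : (t <= size W)%N by move: hk; rewrite mulSn; lia.
have hAW : A N W = A N (take t W) + A N (drop t W) by rewrite {1}hWE pos_cat.
rewrite {1}hWE (subst_cat hs) edges_cat count_cat -addn1 addnC; apply: leq_add.
  have near1 : near N c X (take t W).
    have h := @near_cat N c X [::] (take t W) (drop t W).
    by rewrite pos_nil addr0 /= cat_take_drop in h; apply: h.
  have cov1 : covers N X (take t W) Y W'.
    split => //; rewrite (_ : _ - _ = (Y + A N W' - (X + A N W)) + A N (drop t W)).
      by apply: coneD => //; apply: cone_pos.
    by rewrite hAW; apply: vec_eq => /=; ring.
  have lW1 : language sigma N (take t W) by exact: language_infix hW (infix_take _ _).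
  have [|e [e' [h1 h2 h3]]] := crossing n1N hL hsp hbal lW1 hW' near1 hY cov1.
    by rewrite size_takel.
  have [x hx1 hx2] := hcoin h3.
  rewrite -has_count; apply/hasP; exists x.
    by rewrite (@subst_prod_compE sigma n0 n1 N) //; apply/mem_edges_sub => //; exists e.
  rewrite /= (@subst_prod_compE sigma n0 n1 N) //.
  by apply/mem_edges_sub => //; exists e'.
rewrite -pos_comp //; apply: IH => //.
- exact: language_infix hW (infix_drop _ _).
- by apply: (near_cat (u := take t W) (v := drop t W) (w := [::])); rewrite cats0 cat_take_drop.
- split; last by rewrite -[X + _ + _]addrA -hAW.
  rewrite (_ : _ - _ = X - Y + A N (take t W)); last by rewrite addrAC.
  by apply: coneD => //; apply: cone_pos.
- by rewrite size_drop; move: hk; rewrite mulSn; lia.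
Qed.

Variables (N' Q : nat) (beta K kappa : R).
Hypothesis N'n0 : (N' <= n0)%N.
Hypothesis hbal' : balanced C (language sigma N').
Hypothesis hsp' : 2 * spread N <= spread N'.
Hypothesis hmiss : miss_bound N' beta K.
Hypothesis hK : forall i, K <= kappa * (len n0 i)%:R.
Hypothesis hQ : forall i j, (len N i <= Q * len n0 j)%N.
Hypothesis bk0 : 0 <= beta + kappa.

Lemma near_descend c X W : language sigma N W -> near N c X W -> near N' c X (S N' N W).
Proof.
have N'N : (N' <= N)%N by lia.
move=> hW hX p q hpq; have hs := subst_prodP N' N.
pose M := maxn (size (S N' N [:: La])) (size (S N' N [:: Lb])).
have hM i : (size (S N' N [:: i]) <= M)%N.
  by rewrite /M; case: (letterP i) => ->; rewrite leq_max leqnn ?orbT.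
have hp : prefix p (S N' N W) by rewrite hpq prefix_prefix.
have [v [x [/prefixP[y hv] hpx _]]] := prefix_subst hs hM hp.
have hx : language sigma N' x.
  apply: (language_infix (language_subst N'N hW)).
  by rewrite hpq hpx -catA; apply: infix_infix.
(* By [hsp'] the vertices of level [N] use at most half of the allowance [3 * C * spread N'], and
   the incomplete block uses a third. *)
have h1 := balanced_dev hbal' hx; have h2 := hX v y hv.
rewrite hpx pos_cat -pos_comp // [X + _]addrA trD addrAC.
apply: le_trans (ler_normD _ _) _.
have : 2 * (C * spread N) <= C * spread N' by rewrite mulrCA ler_pM2l.
have := mulr_ge0 (ltW C0) (ltW (spread_gt0 N')).
move: h1 h2; lra.
Qed.

Lemma size_prod_letters n w : size (S 0 n w) = (\sum_(x <- w) len n x)%N.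
Proof.
elim: w => [|i w IH].
  by rewrite big_nil (subst_nil (subst_prodP 0 n)).
by rewrite size_cons big_cons IH.
Qed.

Lemma size_prod_sum n X w : size (S 0 n w) = (\sum_(e <- edges n X w) len n e.2)%N.
Proof.
elim: w X => [|i w IH] X /=.
  by rewrite big_nil (subst_nil (subst_prodP 0 n)).
by rewrite size_cons big_cons (IH (X + A n [:: i])).
Qed.

(* Every [cross_time L] letters of [W], the two paths share an edge of level
   [n0], and thus all its edges of level 0; the other edges of level [n0] miss at
   most the proportion [beta] granted by [hmiss] at the lower level [N']. *)
Lemma contraction : exists2 K2, 0 <= K2 & miss_bound N
  ((1 - ((cross_time L)%:R * Q%:R)^-1) * (beta + kappa)) K2.
Proof.
have n0N : (n0 <= N)%N by lia.
have N'N : (N' <= N)%N by lia.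
pose ml := minn (len n0 La) (len n0 Lb).
exists ((beta + kappa) * ml%:R); first by rewrite mulr_ge0.
move=> c X W Y W' hW hW' hX hY [hc1 hc2].
set E := edges n0 X (S n0 N W); set E' := edges n0 Y (S n0 N W').
have hml i : (ml <= len n0 i)%N.
  by rewrite /ml; case: (letterP i) => ->; rewrite geq_min leqnn ?orbT.
have hlow e : e \in E -> (count (fun x => x \notin edges 0 Y (S 0 N W')) (low n0 e))%:R <=
    (beta + kappa) * ((len n0 e.2)%:R - (e \in E')%:R * ml%:R).
  move=> he; case: (boolP (e \in E')) => [he'|_].
    rewrite (eq_in_count (a2 := pred0)) ?count_pred0.
      by rewrite mul1r mulr_ge0 // subr_ge0 ler_nat hml.
    move=> x hx /=; rewrite (@subst_prod_compE sigma 0 n0 N) //.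
    by apply/negbTE; rewrite negbK; apply/mem_edges_sub => //; exists e.
  rewrite mul0r subr0 mulrDl; have /mem_edgesP[p [q [hpq he1]]] := he.
  have hAW : A N W = A n0 p + (A n0 [:: e.2] + A n0 q).
    by rewrite (@pos_comp n0 N) // hpq pos_cat (pos_cons _ e.2 q).
  have hS : S N' N W = S N' n0 p ++ S N' n0 [:: e.2] ++ S N' n0 q.
    rewrite (@subst_prod_compE sigma N' n0 N) // hpq.
    have hs := subst_prodP N' n0.
    by rewrite (subst_cat hs) (subst_cons hs).
  (* The lower level is applied to one edge at a time, against the whole other path; its additive
     constant [K] is charged to the length of this edge. *)
  have h := hmiss (c := c) (X := e.1) (W := S N' n0 [:: e.2]) (Y := Y) (W' := S N' N W').
  rewrite /misses -!(@subst_prod_compE sigma 0 N') // in h.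
  apply: le_trans (h _ _ _ _ _) _.
  - exact: language_prod.
  - exact: language_subst.
  - rewrite he1 (@pos_comp N' n0) //; apply: (near_cat (w := S N' n0 q)).
    by rewrite -hS; apply: near_descend.
  - exact: near_descend.
  - split.
      rewrite he1 (_ : _ - _ = X - Y + A n0 p); last by rewrite addrAC.
      apply: coneD; first exact: cone_le hc1.
      exact: (cone_le N'n0 (cone_pos _ _)).
    rewrite -!pos_comp // (_ : _ - _ = (Y + A N W' - (X + A N W)) + A n0 q).
      apply: coneD; first exact: cone_le hc2.
      exact: (cone_le N'n0 (cone_pos _ _)).
    by rewrite hAW he1; apply: vec_eq => /=; ring.
  by rewrite lerD2l; apply: hK.
have hcount : (misses N X W Y W')%:R <=
    (beta + kappa) * ((size (S 0 N W))%:R - (count (mem E') E)%:R * ml%:R).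
  rewrite /misses (@subst_prod_compE sigma 0 n0 N W) // (@edges_sub 0 n0 X) //.
  rewrite count_flatten -map_comp sumnE big_map natr_sum -/E.
  have -> : (count (mem E') E)%:R = \sum_(e <- E) (e \in E')%:R :> R.
    elim: (E) => [|e s IH]; first by rewrite big_nil.
    by rewrite big_cons /= natrD IH.
  rewrite (size_prod_sum n0 X) natr_sum mulr_suml -sumrB mulr_sumr.
  rewrite big_seq [leRHS]big_seq; apply: ler_sum => e he.
  apply: le_trans (hlow e he) _; rewrite /= -/E'.
  by case: (e \in E').
apply: le_trans hcount _; rewrite [_ * (beta + kappa)]mulrC -mulrA -mulrDr ler_wpM2l //.
set k := (size W %/ cross_time L)%N.
have t0 : (0 < cross_time L)%N by rewrite /cross_time addn2.
have hk : (k <= count (mem E') E)%N.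
  by apply: (common_count hW hW' hX hY) => //; rewrite leq_trunc_div.
have hkR : k%:R * ml%:R <= (count (mem E') E)%:R * ml%:R :> R by rewrite ler_wpM2r // ler_nat.
have Q0 : (0 < Q)%N.
  by have := leq_trans (len_gt0 N La) (hQ La La); rewrite muln_gt0 => /andP[].
(* The incomplete last stretch of [W] is what the additive constant of the conclusion pays for. *)
have hsize : (size (S 0 N W) <= k.+1 * cross_time L * (Q * ml))%N.
  apply: (@leq_trans (Q * ml * size W)).
    apply: leq_size_subst_mul; first exact: is_substitution_prod.
    by move=> i; rewrite /ml minnE; have := hQ i La; have := hQ i Lb; rewrite -minnE /minn; case: ifP.
  by rewrite mulnC leq_mul2r (ltnW (ltn_ceil _ t0)) orbT.
have tq0 : 0 < (cross_time L)%:R * Q%:R :> R by rewrite mulr_gt0 // ltr0n.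
have : (size (S 0 N W))%:R / ((cross_time L)%:R * Q%:R) <= (k%:R + 1) * ml%:R :> R.
  rewrite ler_pdivrMr //.
  have -> : (k%:R + 1) * ml%:R * ((cross_time L)%:R * Q%:R) =
    (k.+1 * cross_time L * (Q * ml))%:R :> R by rewrite !natrM -natr1; ring.
  by rewrite ler_nat.
rewrite mulrDl mul1r mulrBl mul1r [_^-1 * _]mulrC; move: hkR; lra.
Qed.

End Contraction.

(** * Iterating the contraction along recurrent blocks *)

Hypothesis recurrent : forall l m, exists n, [/\ (m <= n)%N,
  forall i, (i < l)%N -> sigma (n + i)%N = sigma i & balanced C (language sigma (n + l))].

(** [eta] depends only on [C] and the block of the first [l] substitutions. From low to high levels,
    a copy of this block first mixes the letters, then produces coincidences, then narrows the
    transversal scale. *)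
Lemma achievable_contract : exists2 eta : R, 0 < eta <= 1 &
  forall beta kappa, 0 <= beta -> 0 < kappa -> achievable beta ->
  achievable ((1 - eta) * (beta + kappa)).
Proof.
have [lc hlc] : exists n, ~~ nc n (0, La) (0, Lb).
  apply: (@strong_coincidence C) => N; have [n [hn _ hb]] := recurrent 0 N.
  by exists n => //; rewrite addn0 in hb.
have [l0 _ hl0] := letter_in_prod 0.
have [r [hr hrs _]] := recurrent lc l0.
pose l1 := (r + lc)%N.
(* Through [spread_block] this gives the factor [24 * C] that [crossing] requires. *)
pose Q0 := (Num.truncn (48 * C)).+1.
have [l2 hl2] := size_prod_unbounded l1 Q0.
pose l := maxn l1 l2.
have [hl1l hQ0] := hl2 l (leq_maxr _ _).
pose L := maxn (size (S l1 l [:: La])) (size (S l1 l [:: Lb])).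
pose Lr := maxn (size (S r l [:: La])) (size (S r l [:: Lb])).
pose Q := (maxlen r * Lr)%N.
have rl1 : (r <= l1)%N by exact: leq_addr.
have hLr i : (size (S r l [:: i]) <= Lr)%N.
  by rewrite /Lr; case: (letterP i) => ->; rewrite leq_max leqnn ?orbT.
have t0 : (0 < cross_time L)%N by rewrite /cross_time addn2.
have Qp : (0 < Q)%N.
  rewrite muln_gt0 (leq_trans (len_gt0 r La) (leq_maxlen r La)).
  apply: leq_trans (hLr La); exact: (subst_size_gt0 (subst_prodP _ _)).
exists (((cross_time L)%:R * Q%:R)^-1).
  rewrite invr_gt0 mulr_gt0 ?ltr0n //= invf_le1 ?mulr_gt0 ?ltr0n // -natrM ler1n muln_gt0.
  by rewrite t0 Qp.
move=> beta kappa b0 k0 [N' [K [K0 hb' hm']]].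
have [m1 hm1] := len_unbounded (Num.truncn (K / kappa)).+1.
have [m2 hm2] := @spread_lim (spread N' / 2) ltac:(by rewrite divr_gt0 // spread_gt0).
have [n [hn hns hbal]] := recurrent l (maxn N' (maxn m1 m2)).
move: hn; rewrite !geq_max => /and3P[nN' nm1 nm2].
have hSn a b : (a <= b)%N -> (b <= l)%N -> S (n + a) (n + b) = S a b.
  move=> hab hbl; have := @eq_subst_prod sigma sigma (n + a) a (b - a).
  rewrite -addnA !subnKC //; apply=> i hi.
  have hai : (a + i < l)%N by lia.
  by rewrite -addnA hns.
pose n0 := (n + r)%N; pose n1 := (n + l1)%N; pose N := (n + l)%N.
have n01 : (n0 <= n1)%N by rewrite leq_add2l.
have n1N : (n1 <= N)%N by rewrite leq_add2l.
have lE i : S n n0 [:: i] = S 0 r [:: i] by rewrite -{1}[n]addn0 hSn // (leq_trans rl1).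
have coin (e e' : edge) : e.1 = e'.1 -> exists2 x,
    x \in edges n0 e.1 (S n0 n1 [:: e.2]) & x \in edges n0 e'.1 (S n0 n1 [:: e'.2]).
  have -> : S n0 n1 = S 0 lc.
    rewrite hSn // /l1; have := @eq_subst_prod sigma sigma r 0 lc hrs.
    by rewrite add0n.
  case: e e' => [Z i] [Z' j] /= <- {Z'}.
  have [x [w hxw]] : exists x w, S 0 lc [:: i] = x :: w.
    have := subst_size_gt0 (subst_prodP 0 lc) i.
    by case: (S 0 lc _) => // x w _; exists x, w.
  have [->|hij] := eqVneq i j.
    have [y [v hyv]] : exists x w, S 0 lc [:: j] = x :: w.
      have := subst_size_gt0 (subst_prodP 0 lc) j.
      by case: (S 0 lc _) => // y v _; exists y, v.
    by exists (Z, y); rewrite hyv /= inE eqxx.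
  move: hlc; rewrite negbK => /hasP[y hy1 hy2].
  have hy : y \in edges 0 0 (S 0 lc [:: i]) /\ y \in edges 0 0 (S 0 lc [:: j]).
    by move: hij; case: (letterP i) => ->; case: (letterP j) => ->.
  have [/mem_edgesP[p [q [hpq hp]]] /mem_edgesP[p' [q' [hpq' hp']]]] := hy.
  have e0 u : A 0 u = ab u by rewrite /pos subst_prod_geq.
  have epp : ab p = ab p'.
    by apply: (addrI (0 : vec)); rewrite -!e0 -hp -hp'.
  exists (Z + A n0 p, y.2).
    by apply/mem_edgesP; exists p, q.
  apply/mem_edgesP; exists p', q'; split => //=.
  by rewrite !pos_lmap epp.
have hLN i : (size (S n1 N [:: i]) <= L)%N.
  by rewrite hSn // /L; case: (letterP i) => ->; rewrite leq_max leqnn ?orbT.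
have hsp : 24 * C * spread N <= spread n1.
  have := @spread_block n1 N Q0 n1N isT.
  have hh i : (Q0 <= size (S n1 N [:: i]))%N by rewrite hSn.
  move=> /(_ hh) h; have hQ : 48 * C < Q0%:R by exact: truncnS_gt.
  have : spread N * (48 * C) <= spread N * Q0%:R by rewrite ler_wpM2l ?ltW ?spread_gt0.
  by move: h; clear; lra.
have N'n0 : (N' <= n0)%N by apply: leq_trans nN' (leq_addr _ _).
have hsp' : 2 * spread N <= spread N'.
  have : spread N < spread N' / 2 by apply: hm2; apply: leq_trans nm2 (leq_addr _ _).
  by clear; lra.
have hK i : K <= kappa * (len n0 i)%:R.
  rewrite mulrC -ler_pdivrMr //; apply: ltW; apply: lt_le_trans (truncnS_gt _) _.
  by rewrite ler_nat; apply: hm1; apply: leq_trans nm1 (leq_addr _ _).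
(* The images under the mixing block contain both letters, so the lengths at level [n0] are
   comparable with a ratio independent of [n]. *)
have hratio i j : (len n0 i <= maxlen r * len n0 j)%N.
  pose s := (len n La + len n Lb)%N.
  have h1 : (len n0 i <= maxlen r * s)%N.
    have hh : (len n0 i <= s * size (S n n0 [:: i]))%N.
      rewrite /len (@subst_prod_compE sigma 0 n n0) ?leq_addr //.
      apply: leq_size_subst_mul; first exact: is_substitution_prod.
      by move=> x; rewrite /s; case: (letterP x) => ->; rewrite ?leq_addr ?leq_addl.
    by apply: leq_trans hh _; rewrite mulnC leq_mul2r lE leq_maxlen orbT.
  apply: leq_trans h1 _; rewrite leq_mul2l; apply/orP; right.
  have hin x : x \in S n n0 [:: j] by rewrite lE -infix1s; apply: hl0.
  rewrite /len (@subst_prod_compE sigma 0 n n0) ?leq_addr //.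
  rewrite size_prod_letters /s.
  rewrite (bigID (pred1 La)) /= (bigID (pred1 Lb) (fun x => x != La)) /=.
  have ha := hin La; have hb := hin Lb.
  rewrite addnA; apply: leq_trans (leq_addr _ _).
  apply: leq_add.
    by rewrite (big_rem La ha) /= leq_addr.
  by rewrite (big_rem Lb hb) /= leq_addr.
have hQ i j : (len N i <= Q * len n0 j)%N.
  rewrite /len (@subst_prod_compE sigma 0 n0 N) ?(leq_trans n01) // -/(len n0 j).
  apply: (@leq_trans (maxlen r * len n0 j * size (S n0 N [:: i]))).
    apply: leq_size_subst_mul; first exact: is_substitution_prod.
    by move=> x; apply: hratio.
  rewrite hSn ?(leq_trans rl1) // /Q mulnAC leq_mul2r leq_mul2l hLr orbT orbT //.
have bk : 0 <= beta + kappa by rewrite addr_ge0 // ltW.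
have [K2 K20 hm2'] := contraction n01 n1N coin hLN hsp hbal N'n0 hb' hsp' hm' hK hQ bk.
by exists N, K2.
Qed.

Lemma achievable_small (eps : R) : 0 < eps -> exists2 beta, beta < eps & achievable beta.
Proof.
have [eta /andP[e0 e1] he] := achievable_contract.
have hk k : achievable ((1 - eta / 2) ^+ k).
  elim: k => [|k IH].
    by rewrite expr0; have [n [_ _ /achievable1]] := recurrent 0 0.
  set b := (1 - eta / 2) ^+ k in IH.
  have b0 : 0 < b by rewrite exprn_gt0 //; lra.
  (* With this [kappa] the factor is [(1 - eta) * (1 + eta / 2)], which is at most [1 - eta / 2]. *)
  have [N [K [K0 hb hm]]] := he b (eta / 2 * b) (ltW b0) ltac:(by rewrite !mulr_gt0) IH.
  exists N, K; split => // c X W Y W' h1 h2 h3 h4 h5.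
  apply: le_trans (hm c X W Y W' h1 h2 h3 h4 h5) _.
  rewrite lerD2r ler_wpM2r // exprS -/b.
  have : 0 <= eta * (eta / 2) * b by rewrite !mulr_ge0 // ltW.
  by lra.
move=> eps0; have h1 : `|1 - eta / 2| < 1 by rewrite ltr_norml; apply/andP; split; lra.
have := cvg_expr h1 => /cvgrPdist_lt /(_ eps eps0)[k _ hkk].
exists ((1 - eta / 2) ^+ k); last exact: hk.
have := hkk k (leqnn k); rewrite /= sub0r normrN; apply: le_lt_trans.
exact: ler_norm.
Qed.

(** * Deviations of infinite words *)

Definition is_limsup (g : nat -> R) (x : R) :=
  (forall e, 0 < e -> exists t0, forall t, (t0 <= t)%N -> g t <= x + e) /\
  (forall e, 0 < e -> forall t0, exists2 t, (t0 <= t)%N & x - e <= g t).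

Definition dev (w : nat -> letter) (n : nat) : R := T (ab (mkseq w n)).

Local Notation X_sigma := (sadic_shift sigma).

Lemma sadic_language w n : X_sigma w -> language sigma 0 (mkseq w n).
Proof. by move=> /(_ 0%N n). Qed.

Lemma take_mkseq (w : nat -> letter) m n : (m <= n)%N -> take m (mkseq w n) = mkseq w m.
Proof. by move=> h; rewrite /mkseq -map_take take_iota (minn_idPl h). Qed.

(** A word in a single letter has a deviation proportional to its length, which balance excludes for
    long words. *)
Lemma letter_occurs N : balanced C (language sigma N) -> exists B : nat,
  forall w i, language sigma N w -> (B <= size w)%N -> i \in w.
Proof.
move=> hb; have hd := norm_dev_gt0 N.
pose B i := (Num.truncn (C * spread N / `|d N i|)).+1.
exists (maxn (B La) (B Lb)) => w i hw hs; apply/negPn/negP => hi.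
have [j hj] : exists j, forall x, x \in w -> x = j.
  case: (letterP i) hi => -> hi; [exists Lb | exists La] => x hx;
    by case: (letterP x) => // e; move: hi; rewrite -e hx.
have hT : T (A N w) = (size w)%:R * d N j.
  elim: (w) hj => [|x v IH] hj; first by rewrite pos_nil tr0 mul0r.
  rewrite pos_cons trD IH => [|y hy]; last by apply: hj; rewrite inE hy orbT.
  by rewrite (hj x) ?inE ?eqxx //= -natr1; ring.
have := balanced_dev hb hw; rewrite hT normrM normr_nat.
rewrite -ler_pdivlMr // leNgt; apply/negP; rewrite negbK.
apply: lt_le_trans (truncnS_gt _) _; rewrite ler_nat; apply: leq_trans hs.
by rewrite -/(B j); case: (letterP j) => ->; rewrite leq_max leqnn ?orbT.
Qed.

(** The deviation rises by at most [s] inside a block of level [N], and some letter attains this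
    rise; so [s] relates upper limits at level 0 to the vertices of level [N]. *)
Lemma exists_peak N : exists s : R,
  (forall i (p : word), prefix p (S 0 N [:: i]) -> T (ab p) <= s) /\
  (exists i (p : word), prefix p (S 0 N [:: i]) /\ T (ab p) = s).
Proof.
pose ps := [seq take k (S 0 N [:: i]) | i <- [:: La; Lb], k <- iota 0 (maxlen N).+1].
have hps p : p \in ps -> exists i, prefix p (S 0 N [:: i]).
  by move=> /allpairsP[[i k] /= [_ _ ->]]; exists i; apply: prefix_take.
have hin i p : prefix p (S 0 N [:: i]) -> p \in ps.
  move=> hp; apply/allpairsP; exists (i, size p); split.
  - by case: (letterP i) => ->; rewrite !inE eqxx ?orbT.
  - rewrite -[(i, size p).2]/(size p) mem_iota add0n ltnS; apply: leq_trans (size_prefix hp) _.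
    exact: leq_maxlen.
  - by apply/eqP; rewrite eq_sym -prefixE.
have [p0 hp0 hmax] : exists2 p, p \in ps & forall q, q \in ps -> T (ab q) <= T (ab p).
  have : [::] \in ps by apply: (hin La); rewrite prefix0s.
  elim: (ps) ([::]) => [//|p qs IH] z _; case: qs IH => [_|q qs IH].
    by exists p; rewrite ?inE ?eqxx // => q; rewrite inE => /eqP ->.
  have [|r hr hm] := IH q; first by rewrite inE eqxx.
  have [h|h] := lerP (T (ab p)) (T (ab r)).
    exists r; first by rewrite inE hr orbT.
    by move=> v; rewrite inE => /orP[/eqP->//|]; apply: hm.
  exists p; first by rewrite inE eqxx.
  move=> v; rewrite inE => /orP[/eqP->//|/hm h2].
  exact: le_trans h2 (ltW h).
exists (T (ab p0)); split; first by move=> i p /hin /hmax.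
by have [i hi] := hps p0 hp0; exists i, p0.
Qed.

Lemma infix_dev N W p q : balanced C (language sigma N) -> language sigma N W ->
  prefix p W -> prefix q W -> `|T (A N p) - T (A N q)| <= C * spread N.
Proof.
move=> hb; wlog h : p q / (size p <= size q)%N.
  move=> hw hW hp hq; case: (leqP (size p) (size q)) => h; first exact: hw.
  by rewrite distrC; apply: hw => //; apply: ltnW.
move=> hW /prefixP[x hx] /prefixP[y hy].
have hq := cat_prefix_drop (etrans (esym hx) hy) h.
rewrite hq pos_cat trD opprD addrA subrr sub0r normrN.
apply: (balanced_dev hb); apply: (language_infix hW).
by rewrite hy; apply: infix_catr; apply: infix_drop.
Qed.

(* The upper limit of the deviation of [w] determines, up to an error of order
   [spread N], the deviation of the vertices of level [N] of [w]. *)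
Lemma limsup_window N s (e : R) w x (m0 : nat) :
  balanced C (language sigma N) ->
  (forall i (p : word), prefix p (S 0 N [:: i]) -> T (ab p) <= s) ->
  (exists i (p : word), prefix p (S 0 N [:: i]) /\ T (ab p) = s) ->
  0 < e -> X_sigma w -> is_limsup (dev w) x ->
  exists m u W y, [/\ (m0 <= m)%N, mkseq w m = u ++ S 0 N W ++ y,
    (size u <= maxlen N)%N /\ (size y <= maxlen N)%N, language sigma N W &
    forall p, prefix p W -> `|T (ab u + A N p) - (x - s)| <= e + C * spread N].
Proof.
move=> hb hs1 [i0 [p0 [hp0 hs0]]] e0 hw [hl1 hl2].
have hs := subst_prodP 0 N.
have [t0 ht0] := hl1 e e0; have [t1 ht1 hg1] := hl2 e e0 (maxlen N).
have [B hB] := letter_occurs hb.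
(* Long enough for [W] to have [t0 + B] letters and for its image to reach the time [t1]. *)
pose m := maxn m0 (maxn (t1 + maxlen N) (maxlen N * (t0 + B + 2)))%N.
have [u [W [y [hW hm hu hy]]]] := language_deep N (sadic_language m hw).
have hmm : size (mkseq w m) = m by rewrite size_mkseq.
have hsz : m = (size u + (size (S 0 N W) + size y))%N.
  by rewrite -{1}hmm hm !size_cat.
have M0 : (0 < maxlen N)%N := leq_trans (len_gt0 N La) (leq_maxlen N La).
have hm1 : (t1 + maxlen N <= m)%N by rewrite /m !leq_max leqnn orbT.
have hm2 : (maxlen N * (t0 + B + 2) <= m)%N by rewrite /m !leq_max leqnn !orbT.
have hWs : (t0 + B <= size W)%N.
  have := leq_size_subst_mul W hs (leq_maxlen N) => h.
  rewrite -(leq_pmul2l M0); move: h hm2 hsz hu hy.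
  rewrite mulnDr muln2 -addnn; clear; lia.
exists m, u, W, y; split => //; first by rewrite /m leq_max leqnn.
have e1 v : A 0 v = ab v by rewrite /pos subst_prod_geq.
(* At time [t1] the deviation is at least [x - e], and it exceeds that of the preceding vertex of
   level [N] by at most [s]. *)
have up : exists2 V, prefix V W & x - e <= T (ab u + A N V) + s.
  have ht1m : (t1 <= m)%N by lia.
  have hpre : prefix (take (t1 - size u) (S 0 N W)) (S 0 N W) by apply: prefix_take.
  have [V [z [j [hV hz hzj]]]] := prefix_subst_letter hs hpre.
  exists V => //; apply: le_trans hg1 _; rewrite /dev -(take_mkseq w ht1m) hm.
  rewrite take_cat ltnNge (leq_trans hu ht1) /=.
  have -> : take (t1 - size u) (S 0 N W ++ y) = take (t1 - size u) (S 0 N W).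
    by rewrite takel_cat //; move: hm1 hsz hy; clear; lia.
  have -> : ab (u ++ take (t1 - size u) (S 0 N W)) = (ab u + A N V) + ab z.
    by rewrite hz !ab_cat; apply: vec_eq => /=; rewrite addrA.
  by rewrite (trD _ (ab u + A N V)) lerD2l; apply: hs1 hzj.
(* The letter [i0] occurs after time [t0], when deviations no longer exceed [x + e], and its image
   attains the full rise [s]. *)
have dn : exists2 V, prefix V W & T (ab u + A N V) + s <= x + e.
  have hl : language sigma N (drop t0 W) by exact: language_infix hW (infix_drop _ _).
  have hi : i0 \in drop t0 W by apply: hB => //; rewrite size_drop; lia.
  have [V [r [hVW hVs]]] : exists V r, W = V ++ i0 :: r /\ (t0 <= size V)%N.
    pose k := index i0 (drop t0 W).
    have hk : (k < size (drop t0 W))%N by rewrite index_mem.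
    exists (take t0 W ++ take k (drop t0 W)), (drop k.+1 (drop t0 W)).
    have hd : i0 :: drop k.+1 (drop t0 W) = drop k (drop t0 W).
      by rewrite (drop_nth La hk) nth_index.
    rewrite hd -catA !cat_take_drop size_cat size_takel ?leq_addr //.
    by apply: leq_trans hWs; apply: leq_addr.
  exists V; first by apply/prefixP; exists (i0 :: r).
  have /prefixP[z hz] := hp0.
  have hSW : S 0 N W = S 0 N V ++ p0 ++ z ++ S 0 N r.
    by rewrite hVW (subst_cat hs) (subst_cons hs) hz -catA.
  pose t := (size u + size (S 0 N V) + size p0)%N.
  have ht : (t0 <= t)%N.
    by have h1 := leq_size_subst hs V; move: h1 hVs; rewrite /t; clear; lia.
  have htm : mkseq w t = u ++ S 0 N V ++ p0.
    have h3 : (t <= m)%N by rewrite hsz hSW !size_cat /t; clear; lia.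
    rewrite -(take_mkseq w h3) hm hSW.
    have -> : u ++ (S 0 N V ++ p0 ++ z ++ S 0 N r) ++ y =
        (u ++ S 0 N V ++ p0) ++ (z ++ S 0 N r ++ y) by rewrite -!catA.
    by rewrite take_size_cat // !size_cat /t addnA.
  have hab : ab (u ++ S 0 N V ++ p0) = (ab u + A N V) + ab p0.
    by rewrite !ab_cat; apply: vec_eq => /=; rewrite addrA.
  by have := ht0 t ht; rewrite /dev htm hab (trD _ (ab u + A N V)) hs0.
move=> p hp; have [V hV hup] := up; have [V' hV' hdn] := dn.
have h1 := infix_dev hb hW hp hV; have h2 := infix_dev hb hW hp hV'.
move: hup hdn h1 h2; rewrite !trD !ler_norml.
by move=> h3 h4 /andP[h5 h6] /andP[h7 h8]; apply/andP; split; lra.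
Qed.

Lemma edges0_mkseq w m :
  edges 0 0 (mkseq w m) = [seq (ab (mkseq w t), w t) | t <- iota 0 m].
Proof.
elim: m => [//|m IH]; rewrite -[m.+1]addn1 iotaD map_cat -IH /=.
rewrite /mkseq iotaD map_cat -/(mkseq w m) edges_cat /= add0n add0r.
by rewrite /pos subst_prod_geq.
Qed.

Lemma edges0_factor w m u v y : mkseq w m = u ++ v ++ y ->
  edges 0 (ab u) v = [seq (ab (mkseq w t), w t) | t <- iota (size u) (size v)].
Proof.
move=> hm; have h := edges0_mkseq w m; rewrite hm !edges_cat add0r in h.
have eu : A 0 u = ab u by rewrite /pos subst_prod_geq.
rewrite eu in h; have hmm : size (mkseq w m) = m by rewrite size_mkseq.
have hsz : m = (size u + (size v + size y))%N by rewrite -{1}hmm hm !size_cat.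
have := congr1 (fun l => take (size v) (drop (size u) l)) h.
rewrite /= drop_size_cat ?size_edges // take_size_cat ?size_edges // => ->.
by rewrite hsz -map_drop drop_iota -map_take take_iota addKn minnE; congr map; congr iota; lia.
Qed.

Lemma close_agree (e : R) : 0 < e -> exists (T0 : nat) (dl : R),
  [/\ (0 < T0)%N, 0 < dl & forall w w' x x' (k : int), X_sigma w -> X_sigma w' ->
    is_limsup (dev w) x -> is_limsup (dev w') x' -> `|x - x' - k%:~R| < dl ->
    (count (fun t => w t != w' t) (iota 0 T0))%:R <= e * T0%:R].
Proof.
move=> e0; have [beta hbe [N [K [K0 hb hm]]]] := @achievable_small (e / 2) ltac:(by rewrite divr_gt0).
have hs := subst_prodP 0 N.
have spN := spread_gt0 N; have Csp : 0 < C * spread N by rewrite mulr_gt0.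
have [s [hs1 hs2]] := exists_peak N.
have [Kc hKc] := cone_of_height N (6 * (C * spread N)).
(* Skipping [j0] letters of level [N] puts the first path ahead of the start of the second one by
   the length [Kc] that [cone_of_height] asks for. *)
pose j0 := (Kc + maxlen N)%N.
(* Bounds the letters outside the compared stretch: the ends [u] and [z] and the image of the
   skipped letters. *)
pose c1 := (maxlen N * (1 + j0) + maxlen N)%N.
pose T0 := (maxn (Num.truncn ((c1%:R + K) / (e / 2))).+1 (maxlen N * (j0 + 2)).+1).
exists T0, (C * spread N / 2); split; [by rewrite leq_max|by rewrite divr_gt0|].
move=> w w' x x' k hw hw' hx hx' hk.
have ed : 0 < C * spread N / 2 by rewrite divr_gt0.
have [m [u [W [y [hm0 hmE [hu hy] hW hwin]]]]] :=
  limsup_window (T0 + maxlen N) hb hs1 hs2 ed hw hx.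
have [m' [u' [W' [y' [hm0' hmE' [hu' hy'] hW' hwin']]]]] :=
  limsup_window (T0 + Kc + maxlen N) hb hs1 hs2 ed hw' hx'.
have hmm : size (mkseq w m) = m by rewrite size_mkseq.
have hsz : m = (size u + (size (S 0 N W) + size y))%N by rewrite -{1}hmm hmE !size_cat.
have hmm' : size (mkseq w' m') = m' by rewrite size_mkseq.
have hsz' : m' = (size u' + (size (S 0 N W') + size y'))%N by rewrite -{1}hmm' hmE' !size_cat.
have hT01 : (maxlen N * (j0 + 2) < T0)%N by rewrite /T0 leq_max leqnn orbT.
have hpre : prefix (take (T0 - size u) (S 0 N W)) (S 0 N W) by apply: prefix_take.
have [V [z [/prefixP[V' hV] hz hzM]]] := prefix_subst hs (leq_maxlen N) hpre.
have hTu : (size u <= T0)%N by move: hT01 hu; rewrite mulnDr; clear; lia.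
have hTz : (T0 = size u + (size (S 0 N V) + size z))%N.
  have := congr1 size hz; rewrite size_cat size_takel.
    by move: hTu; clear; lia.
  by move: hsz hm0 hy; clear; lia.
have hVj : (j0 <= size V)%N.
  have h1 := leq_size_subst_mul V hs (leq_maxlen N).
  have M0 : (0 < maxlen N)%N := leq_trans (len_gt0 N La) (leq_maxlen N La).
  rewrite -(leq_pmul2l M0); move: h1 hT01 hTz hu hzM; rewrite mulnDr muln2 -addnn; clear; lia.
pose V1 := take j0 V; pose V2 := drop j0 V.
have hV12 : V = V1 ++ V2 by rewrite cat_take_drop.
have sV1 : size V1 = j0 by rewrite size_takel.
(* Translation by [v] preserves the number of letters read and moves the transversal position by
   [k]; it brings the second path close to the first. *)
pose v : vec := (k, - k).
have Tv : T v = k%:~R by rewrite /tr /v /= subrr mulr0 subr0.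
pose c := x - s.
pose X := ab u + A N V1; pose Y := ab u' + v.
have tma a : (A N a).1 + (A N a).2 = (size (S 0 N a))%:Z by rewrite [RHS]size_ab.
have tmb a := size_ab a.
have hnX : near N c X V2.
  move=> p q hpq; rewrite /X -[_ + _ + _]addrA -pos_cat.
  have h1 : prefix (V1 ++ p) W.
    by apply/prefixP; exists (q ++ V'); rewrite -!catA [p ++ _]catA -hpq catA -hV12.
  apply: le_trans (hwin _ h1) _; rewrite -[3 * C * _]mulrA; move: Csp.
  by set cs := C * spread N; lra.
have hnY : near N c Y W'.
  move=> p q hpq; have h1 : prefix p W' by apply/prefixP; exists q.
  have := hwin' _ h1.
  have -> : T (Y + A N p) - c = (T (ab u' + A N p) - (x' - s)) - (x - x' - k%:~R).
    by rewrite /Y /c !trD Tv; ring.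
  move=> h2; apply: le_trans (ler_normB _ _) _.
  move: Csp hk h2; rewrite -[3 * C * _]mulrA.
  by set cs := C * spread N; lra.
have hV2 : language sigma N V2.
  apply: (language_infix hW); rewrite hV hV12 -catA; exact: infix_infix.
have hcov : covers N X V2 Y W'.
  have bX := hnX [::] V2 erefl; rewrite pos_nil addr0 in bX.
  have bY := hnY [::] W' erefl; rewrite pos_nil addr0 in bY.
  have bX' := hnX V2 [::] (esym (cats0 _)); have bY' := hnY W' [::] (esym (cats0 _)).
  have dist6 (P P' : vec) : `|T P - c| <= 3 * C * spread N -> `|T P' - c| <= 3 * C * spread N ->
      `|T (P - P')| <= 6 * (C * spread N).
    rewrite trB => h1 h2; have -> : T P - T P' = (T P - c) - (T P' - c) by ring.
    apply: le_trans (ler_normB _ _) _; move: h1 h2; rewrite -[3 * C * _]mulrA.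
    by set cs := C * spread N; lra.
  split.
    apply: hKc; first exact: dist6.
    have h1 := leq_size_subst hs V1.
    have := tma V1; have := tmb u; have := tmb u'.
    rewrite /X /Y /v; move: (ab u) (ab u') (A N V1) => [? ?] [? ?] [? ?] /=.
    by move: h1 hu hu'; rewrite sV1 /j0; clear; lia.
  apply: hKc; first exact: dist6.
  have hsV : size (S 0 N V) = (size (S 0 N V1) + size (S 0 N V2))%N.
    by rewrite {1}hV12 (subst_cat hs) size_cat.
  have := tma V1; have := tma V2; have := tma W'; have := tmb u; have := tmb u'.
  rewrite /X /Y /v; move: (ab u) (ab u') (A N V1) (A N V2) (A N W').
  move=> [? ?] [? ?] [? ?] [? ?] [? ?] /=.
  by move: hsV hTz hsz' hm0' hy'; clear; lia.
have hmiss := hm c X V2 Y W' hV2 hW' hnX hnY hcov.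
pose a := (size u + size (S 0 N V1))%N; pose b := size (S 0 N V2).
have hT0E : T0 = (a + b + size z)%N.
  by rewrite hTz {1}hV12 (subst_cat hs) size_cat /a /b; clear; lia.
have hEX : edges 0 X (S 0 N V2) = [seq (ab (mkseq w t), w t) | t <- iota a b].
  have -> : X = ab (u ++ S 0 N V1) by rewrite ab_cat.
  rewrite (@edges0_factor w m (u ++ S 0 N V1) (S 0 N V2) (S 0 N V' ++ y)) ?size_cat //.
  by rewrite hmE hV hV12 !(subst_cat hs) !catA.
have hEY : edges 0 Y (S 0 N W') =
    [seq (ab (mkseq w' t) + v, w' t) | t <- iota (size u') (size (S 0 N W'))].
  rewrite /Y edges_shift (@edges0_factor w' m' u' (S 0 N W') y') // -map_comp.
  by apply: eq_map => t.
(* A common edge is reached by both words after the same number of letters, so they have the same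
   letter there. *)
have hcnt : (count (fun t => w t != w' t) (iota a b) <= misses N X V2 Y W')%N.
  rewrite /misses hEX count_map; apply: sub_count => t /= hne.
  rewrite hEY; apply/negP => /mapP[t' _ []] h1 h2 h3.
  have htt : t = t'.
    have := size_ab (mkseq w t); have := size_ab (mkseq w' t'); rewrite !size_mkseq.
    rewrite /ab /= h1 h2; clear; lia.
  by move: hne; rewrite h3 htt eqxx.
have htot : (count (fun t => w t != w' t) (iota 0 T0) <= a + misses N X V2 Y W' + size z)%N.
  have hcs i j : (count (fun t => w t != w' t) (iota i j) <= j)%N.
    by rewrite -{2}(size_iota i j) count_size.
  rewrite hT0E (iotaD 0 (a + b)) (iotaD 0 a b) !count_cat add0n.
  by apply: leq_add; [apply: leq_add|].
have hac : (a + size z <= c1)%N.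
  have := leq_size_subst_mul V1 hs (leq_maxlen N); rewrite sV1 /a /c1 mulnDr muln1.
  by move: hu hzM; clear; lia.
have hbT : (b <= T0)%N by rewrite hT0E -addnA addnCA leq_addr.
have hTc : c1%:R + K <= e / 2 * T0%:R.
  rewrite mulrC -ler_pdivrMr ?divr_gt0 //; apply: ltW; apply: lt_le_trans (truncnS_gt _) _.
  by rewrite ler_nat /T0 leq_max leqnn.
have hR1 : (count (fun t => w t != w' t) (iota 0 T0))%:R <=
    (a + size z)%:R + (misses N X V2 Y W')%:R :> R.
  by rewrite -natrD ler_nat addnAC.
have hR2 : (a + size z)%:R <= c1%:R :> R by rewrite ler_nat.
have hR3 : beta * b%:R <= e / 2 * T0%:R.
  apply: (@le_trans _ _ (e / 2 * b%:R)); first by rewrite ler_wpM2r // ltW.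
  by rewrite ler_wpM2l ?ler_nat // divr_ge0 // ltW.
move: hmiss; rewrite -/b; lra.
Qed.

End Crossing.
End Frequency.

(** * Measurability on infinite words *)

Local Notation Words := (prod_topology (fun _ : nat => discrete_topology letter)).

Lemma measurable_coord (i : nat) (a : letter) :
  measurable [set w : infinite_word | w i = a].
Proof.
apply: sub_sigma_algebra.
have h := (@continuousP Words (discrete_topology letter) (fun w => w i)).1
  (@proj_continuous nat (fun _ => discrete_topology letter) i).
apply: (h [set a]); exact: discrete_open.
Qed.

Lemma measurable_mkseq d (T : measurableType d) (D : set T) (g : T -> infinite_word) :
  measurable D -> (forall n a, measurable (D `&` [set z | g z n = a])) ->
  forall n (u : word), measurable (D `&` [set z | mkseq (g z) n = u]).
Proof.
move=> mD h; elim=> [|n IH] u.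
  case: u => [|i u].
    by rewrite (_ : [set _ | _] = setT) ?setIT //; apply/seteqP; split.
  by rewrite (_ : [set _ | _] = set0) ?setI0 //; apply/seteqP; split.
case/lastP: u => [|u a].
  by rewrite (_ : [set _ | _] = set0) ?setI0 //; apply/seteqP; split.
rewrite (_ : D `&` _ = (D `&` [set z | mkseq (g z) n = u]) `&` (D `&` [set z | g z n = a])).
  exact: measurableI.
have e (w : infinite_word) : mkseq w n.+1 = rcons (mkseq w n) (w n).
  by rewrite /mkseq -[n.+1]addn1 iotaD map_cat /= cats1.
apply/seteqP; split => w /=; rewrite e; first by move=> [Dw /rcons_inj[-> ->]].
by move=> [[Dw ->] [_ ->]].
Qed.

Lemma measurable_prefix (n : nat) (P : set word) :
  measurable [set w : infinite_word | P (mkseq w n)].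
Proof.
have h1 (u : word) : measurable [set w : infinite_word | mkseq w n = u].
  rewrite -[X in measurable X]setTI; apply: (@measurable_mkseq _ _ setT id) => // k a.
  by rewrite setTI; exact: measurable_coord.
rewrite (_ : [set _ | _] =
  \bigcup_(u : word) (if pselect (P u) then [set w : infinite_word | mkseq w n = u] else set0)).
  apply: countable_bigcupT_measurable; first exact: countableP.
  by move=> u; case: (pselect _) => _ /=; [exact: h1|exact: measurable0].
apply/seteqP; split => w /=; first by move=> h; exists (mkseq w n) => //; case: pselect.
by move=> [u _]; case: pselect => // h /= ->.
Qed.

Lemma measurable_sadic sigma : measurable (sadic_shift sigma).
Proof.
rewrite (_ : sadic_shift sigma = \bigcap_a \bigcap_n
  [set w | language sigma 0 (mkseq (fun i => w (a + i)%N) n)]); last first.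
  by apply/seteqP; split => w h; [move=> a _ n _; apply: h | move=> a n; apply: h].
apply: bigcapT_measurable => a; apply: bigcapT_measurable => n.
have e (w : infinite_word) : mkseq (fun i => w (a + i)%N) n = drop a (mkseq w (a + n)).
  rewrite /mkseq iotaD map_cat drop_size_cat ?size_map ?size_iota // add0n.
  by rewrite -{2}[a]addn0 iotaDl -map_comp.
have := measurable_prefix (a + n) [set u | language sigma 0 (drop a u)].
by congr measurable; apply/seteqP; split => w /=; rewrite e.
Qed.

Lemma measurable_fun_prefix d (T : measurableType d) (n : nat) (g : word -> T) :
  measurable_fun setT (fun w : infinite_word => g (mkseq w n)).
Proof.
move=> _ B mB; rewrite setTI; exact: (measurable_prefix n (g @^-1` B)).
Qed.

(** Otherwise words outside [U] that share longer and longer prefixes with [w] would converge to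
    [w]. *)
Lemma open_prefix (U : set Words) (w : infinite_word) : open U -> U w ->
  exists n, forall w' : infinite_word, mkseq w' n = mkseq w n -> U w'.
Proof.
move=> oU Uw; apply: contrapT => h.
have h1 n : exists w' : infinite_word, mkseq w' n = mkseq w n /\ ~ U w'.
  apply: contrapT => hn; apply: h; exists n => w' e; apply: contrapT => nU.
  by apply: hn; exists w'.
have [g hg] := choice h1.
have gcvg : (g : nat -> Words) @ \oo --> w.
  apply/cvg_sup => N V [W [[W' oW <-] WfN WU]].
  apply: (filterS WU); rewrite nbhs_simpl; exists N.+1 => // i /= hi.
  have := congr1 (fun s => nth ord0 s N) (hg i).1.
  by rewrite !nth_mkseq // => ->.
have [N _ hN] := gcvg U (open_nbhs_nbhs (conj oU Uw)).
exact: (hg N).2 (hN N (leqnn N)).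
Qed.

Lemma measurable_fun_word d (T : measurableType d) (D : set T) (g : T -> infinite_word) :
  measurable D ->
  (forall n a, measurable (D `&` [set z | g z n = a])) -> measurable_fun D g.
Proof.
move=> mD h _; suff : (@measurable _ infinite_word) `<=` [set B | measurable (D `&` g @^-1` B)].
  by move=> h1 B mB; apply: h1.
apply: smallest_sub.
  split => [|B mB|F mF]; rewrite /mkset.
  - by rewrite preimage_set0 setI0.
  - rewrite (_ : _ `&` _ = D `\` (D `&` g @^-1` B)); first exact: measurableD.
    by apply/seteqP; split => z /=; tauto.
  - by rewrite preimage_bigcup setI_bigcupr; apply: bigcupT_measurable.
move=> B oB; rewrite /mkset.
have h1 := measurable_mkseq mD h.
(* An open set is the countable union of the cylinders that it contains. *)
pose U (u : word) : set T := if pselect (forall w : infinite_word, mkseq w (size u) = u -> B w)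
  then D `&` [set z | mkseq (g z) (size u) = u] else set0.
rewrite (_ : D `&` _ = \bigcup_u U u).
  apply: countable_bigcupT_measurable; first exact: countableP.
  by move=> u; rewrite /U; case: (pselect _) => _ /=; [exact: h1|exact: measurable0].
apply/seteqP; split => z /=.
  move=> [Dz /(open_prefix oB)[n hn]]; exists (mkseq (g z) n) => //.
  by rewrite /U size_mkseq; case: pselect => // ?; case.
by move=> [u _]; rewrite /U; case: pselect => // h2 [Dz /= e]; split => //; apply: h2.
Qed.

(** * Upper limits of the deviations *)

Section Limsup.
Context (R : realType).

(* Finite, and an upper limit in the sense of [is_limsup], when the deviations
   of [w] are bounded; otherwise [fine] may give the junk value 0. *)
Definition upper_dev (f : R) (w : infinite_word) : R :=
  fine (limn_esup (fun n => (dev f w n)%:E)).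

Lemma measurable_upper_dev f : measurable_fun setT (upper_dev f).
Proof.
rewrite /upper_dev; apply: (measurableT_comp (fine_measurable _)) => //.
apply: measurable_fun_limn_esup => n; apply/measurable_EFinP.
exact: (measurable_fun_prefix n (fun u => tr f (ab u))).
Qed.

Lemma is_limsup_upper_dev f w (B : R) : (forall n, `|dev f w n| <= B) ->
  is_limsup (dev f w) (upper_dev f w).
Proof.
move=> hB; rewrite /upper_dev; set u := fun n => (dev f w n)%:E.
have hE : limn_esup u = ereal_inf (range (esups u)).
  by rewrite limn_esup_lim; apply: cvg_lim => //; apply: cvg_esups_inf.
have h1 n : ((- B)%:E <= esups u n)%E.
  apply: (@le_trans _ _ (u n)).
    by rewrite lee_fin; have := hB n; rewrite ler_norml => /andP[].
  by apply: ereal_sup_ubound; exists n => //=.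
have h2 n : (esups u n <= B%:E)%E.
  apply: ge_ereal_sup => _ [k _ <-]; rewrite lee_fin.
  by have := hB k; rewrite ler_norml => /andP[].
have hfin : limn_esup u \is a fin_num.
  rewrite fin_numElt hE; apply/andP; split.
    apply: (@lt_le_trans _ _ (- B)%:E); first exact: ltNyr.
    by apply: le_ereal_inf_tmp => _ [n _ <-].
  apply: (@le_lt_trans _ _ B%:E); last exact: ltry.
  by apply: le_trans (h2 0%N); apply: ereal_inf_lbound; exists 0%N.
rewrite -[limn_esup u]fineK // in hE; set x := fine _ in hE *.
split => [e e0|e e0 t0].
  have : (ereal_inf (range (esups u)) < (x + e)%:E)%E by rewrite -hE lte_fin ltrDl.
  move=> /ereal_inf_lt[_ [t0 _ <-]] hlt; exists t0 => t ht.
  rewrite -lee_fin; apply: ltW; apply: le_lt_trans hlt.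
  by apply: ereal_sup_ubound; exists t => //=.
have : ((x - e)%:E < esups u t0)%E.
  apply: (@lt_le_trans _ _ x%:E); first by rewrite lte_fin ltrBlDr ltrDl.
  by rewrite hE; apply: ereal_inf_lbound; exists t0.
move=> /ereal_sup_gt[_ [t ht <-]]; rewrite lte_fin => hlt.
by exists t => //; apply: ltW.
Qed.

Lemma is_limsup_uniq (g : nat -> R) x y : is_limsup g x -> is_limsup g y -> x = y.
Proof.
suff h a b : is_limsup g a -> is_limsup g b -> a <= b.
  by move=> hx hy; apply/eqP; rewrite eq_le !h.
move=> [_ ha] [hb _]; rewrite leNgt; apply/negP => hlt.
have e0 : 0 < (a - b) / 3 by rewrite divr_gt0 // subr_gt0.
have [t0 h0] := hb _ e0; have [t ht h1] := ha _ e0 t0.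
by have := h0 t ht; lra.
Qed.

Lemma dev_wshift f (w : infinite_word) n :
  dev (f : R) w n.+1 = (w 0%N == ord0)%:R - f + dev f (wshift w) n.
Proof.
have e : mkseq w n.+1 = w 0%N :: mkseq (wshift w) n.
  by rewrite /mkseq /= -[X in iota X n](addn0 1) iotaDl -map_comp.
rewrite /dev e ab_cons trD; congr (_ + _).
by rewrite /tr /ab; case: (letterP (w 0%N)) => -> /=; rewrite ?addr0 ?add0r mulr1.
Qed.

Lemma is_limsup_wshift (f : R) (w : infinite_word) x : is_limsup (dev f w) x ->
  is_limsup (dev f (wshift w)) (x - (w 0%N == ord0)%:R + f).
Proof.
move=> [h1 h2]; split => [e e0|e e0 t0].
  have [t0 h] := h1 e e0; exists t0 => t ht.
  by have := h t.+1 (leqW ht); rewrite dev_wshift; lra.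
have [[|t] ht hle] := h2 e e0 t0.+1; first by [].
by exists t => //; move: hle; rewrite dev_wshift; lra.
Qed.

End Limsup.

(** * The circle and its rotations *)

Lemma measurable_preimage d d' (T : measurableType d) (U : measurableType d') (g : T -> U) B :
  measurable_fun setT g -> measurable B -> measurable (g @^-1` B).
Proof. by move=> mg mB; rewrite -[X in measurable X]setTI; apply: mg. Qed.

Section Circle.
Context (R : realType).
Implicit Types (x y a b t e : R) (n k : nat).

Definition frac x : R := x - (Num.floor x)%:~R.

Lemma frac_ge0 x : 0 <= frac x.
Proof. by rewrite subr_ge0 floor_le_tmp. Qed.

Lemma frac_lt1 x : frac x < 1.
Proof. by have := floorD1_gt x; rewrite /frac intrD; lra. Qed.

Lemma frac_eq x y (k : int) : 0 <= y < 1 -> x = y + k%:~R -> frac x = y.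
Proof.
move=> /andP[y0 y1] ->; rewrite /frac (_ : Num.floor _ = k); first by rewrite addrK.
by apply: floor_def; rewrite intrD; lra.
Qed.

Lemma frac_frac x a : frac (frac x + a) = frac (x + a).
Proof.
apply: (@frac_eq _ _ (Num.floor (x + a) - Num.floor x)); first by rewrite frac_ge0 frac_lt1.
by rewrite intrB /frac; lra.
Qed.

Lemma frac_id x : 0 <= x < 1 -> frac x = x.
Proof. by move=> h; apply: (@frac_eq _ _ 0) => //; rewrite addr0. Qed.

Lemma fracDz x (k : int) : frac (x + k%:~R) = frac x.
Proof.
apply: (@frac_eq _ _ (k + Num.floor x)); first by rewrite frac_ge0 frac_lt1.
by rewrite intrD /frac; lra.
Qed.

Lemma measurable_frac : measurable_fun setT (frac : measurableTypeR R -> measurableTypeR R).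
Proof.
move=> _ B mB; rewrite setTI (_ : _ @^-1` _ = \bigcup_(k : int)
    (`[k%:~R, (k + 1)%:~R[ `&` (fun x => x - k%:~R) @^-1` B)).
  apply: countable_bigcupT_measurable; first exact: countableP.
  move=> k; apply: measurableI => //; rewrite -[X in measurable X]setTI.
  by apply: measurable_funB.
apply/seteqP; split => x /=.
  by move=> h; exists (Num.floor x) => //=; split => //; rewrite in_itv /= floor_itv.
move=> [k _ [/= hk Bx]]; rewrite /frac.
by move: hk; rewrite in_itv /= => /floor_def ->.
Qed.

Definition turn a (x : measurableTypeR R) : measurableTypeR R := frac (x + a).

Lemma measurable_turn a : measurable_fun setT (turn a).
Proof. by apply: (measurableT_comp measurable_frac); apply: measurable_funD. Qed.

(** By the pigeonhole principle two of [N + 1] multiples of [f] lie in one arc of length [1 / N].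
    Their difference is a small nonzero step [th], and its multiples come close to every point. *)
Lemma orbit_dense f t e : (forall (k : int) n, (0 < n)%N -> n%:R * f != k%:~R) ->
  0 < e -> exists n (k : int), 0 <= n%:R * f - t - k%:~R < e.
Proof.
move=> irr e0.
pose N := (Num.truncn e^-1).+1.
have N0 : 0 < N%:R :> R by rewrite ltr0n.
have Ne : N%:R^-1 < e.
  rewrite invf_plt ?posrE //; exact: truncnS_gt.
pose c (i : 'I_N.+1) : 'I_N := inord (Num.truncn (frac (i%:R * f) * N%:R)).
have hc i : (Num.truncn (frac (i%:R * f) * N%:R) < N)%N.
  rewrite -(ltr_nat R); apply: le_lt_trans (_ : frac (i%:R * f) * N%:R < _).
    by rewrite truncn_le // mulr_ge0 ?frac_ge0 // ltW.
  by rewrite -{2}[N%:R]mul1r ltr_pM2r // frac_lt1.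
have [i [j [ltij eij]]] : exists i j : 'I_N.+1, (i < j)%N /\ c i = c j.
  apply: contrapT => h.
  have /leq_card : injective c.
    move=> i j eij; apply: val_inj => /=; apply/eqP; rewrite eqn_leq; apply/andP.
    split; rewrite leqNgt; apply/negP => lt; apply: h; first by exists j, i.
    by exists i, j.
  by rewrite !card_ord ltnn.
have hij : `|frac (j%:R * f) - frac (i%:R * f)| < N%:R^-1.
  have := congr1 val eij; rewrite /c /= !inordK //.
  set u := frac _; set v := frac _ => euv.
  have u0 : 0 <= u * N%:R by rewrite mulr_ge0 ?frac_ge0 // ltW.
  have v0 : 0 <= v * N%:R by rewrite mulr_ge0 ?frac_ge0 // ltW.
  have := truncn_itv u0; have := truncn_itv v0; rewrite euv -natr1 => h1 h2.
  rewrite -(ltr_pM2r N0) mulVf ?gt_eqF // -[X in _ * X](gtr0_norm N0) -normrM.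
  by rewrite ltr_norml mulrBl; lra.
pose m := (j - i)%N.
pose k := Num.floor (j%:R * f) - Num.floor (i%:R * f).
pose th : R := m%:R * f - k%:~R.
have eth : th = frac (j%:R * f) - frac (i%:R * f).
  by rewrite /th /m /k natrB 1?ltnW // intrB /frac; lra.
have th0 : th != 0 by rewrite subr_eq0; apply: irr; rewrite subn_gt0.
have {}eth : `|th| < e by rewrite eth; apply: lt_trans Ne.
have bnd (x : R) : - (Num.bound `|x|)%:R <= x <= (Num.bound `|x|)%:R.
  by rewrite -ler_norml ltW // archi_boundP.
(* Only nonnegative multiples of [th] are available, so an integer moves the target to the side of 0
   to which [th] points. *)
have [K hK] : exists K : int, 0 <= (t + K%:~R) / th.
  case/orP: (lt_total th0) => hth.
    exists (- (Num.bound `|t|)%:Z); rewrite -mulrNN mulr_ge0 // ?oppr_ge0 ?invr_le0 ?(ltW hth) //.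
    by rewrite intrN -pmulrn; have := bnd t; lra.
  exists (Num.bound `|t|)%:Z; rewrite divr_ge0 ?(ltW hth) // -pmulrn.
  by have := bnd t; lra.
pose q := (t + K%:~R) / th.
(* Rounding down or up according to the sign of [th] makes the error nonnegative. *)
have [n hn] : exists n, 0 <= (n%:R - q) * th < e.
  case/orP: (lt_total th0) => hth.
    exists (Num.truncn q); have := truncn_itv hK; rewrite -/q -natr1 => h.
    apply/andP; split; first by apply: mulr_le0; lra.
    apply: le_lt_trans eth; rewrite ltr0_norm //; nra.
  exists (Num.truncn q).+1; have := truncn_itv hK; rewrite -/q -natr1 => h.
  apply/andP; split; first by apply: mulr_ge0; lra.
  apply: le_lt_trans eth; rewrite gtr0_norm //; nra.
exists (n * m)%N, (n%:Z * k + K).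
move: hn; rewrite mulrBl /q divfK // intrD intrM natrM /th; rewrite -pmulrn; lra.
Qed.

(* Compare the [p] intervals of length [x / p] in [0, x] with the [q] intervals
   of length [1 / q] in [0, 1]. *)
Lemma uniform_cdf (F : R -> R) : F 0 = 0 -> F 1 = 1 ->
  (forall a b c d, 0 <= a <= b -> b <= 1 -> 0 <= c <= d -> d <= 1 ->
     b - a < d - c -> F b - F a <= F d - F c) ->
  forall x, 0 <= x <= 1 -> F x = x.
Proof.
move=> F0 F1 hF x x01; have /andP[x0 x1] := x01.
have l01 : (0 : R) <= (1 : R) <= (1 : R) by rewrite ler01 lexx.
have tel p (y : R) : (0 < p)%N -> \sum_(0 <= i < p) (F (i.+1%:R * y / p%:R) - F (i%:R * y / p%:R)) = F y.
  move=> p0; rewrite (telescope_sumr (fun i => F (i%:R * y / p%:R))) // mul0r mul0r F0 subr0.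
  by rewrite mulrAC divff ?mul1r // pnatr_eq0 -lt0n.
have itv p (y : R) i : 0 <= y <= 1 -> (i < p)%N ->
    [/\ 0 <= i%:R * y / p%:R <= i.+1%:R * y / p%:R, i.+1%:R * y / p%:R <= 1 &
     i.+1%:R * y / p%:R - i%:R * y / p%:R = y / p%:R].
  move=> /andP[y0 y1] hi; have p0 : 0 < p%:R :> R by rewrite ltr0n; apply: leq_ltn_trans hi.
  have i0 : 0 <= i%:R :> R by [].
  have hi' : i%:R + 1 <= p%:R :> R by rewrite natr1 ler_nat.
  split.
    apply/andP; split; first by apply: divr_ge0; [exact: mulr_ge0|exact: ltW].
    by rewrite ler_pM2r ?invr_gt0 // ler_wpM2r // ler_nat.
    by rewrite ler_pdivrMr // mul1r -natr1; nra.
  by rewrite -natr1; field; rewrite gt_eqF.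
have dbl p q (z : R) : (0 < p)%N -> (0 < q)%N -> 0 <= z <= 1 ->
  q%:R * F z = \sum_(0 <= i < p) \sum_(0 <= j < q) (F (i.+1%:R * z / p%:R) - F (i%:R * z / p%:R)).
  move=> p0 q0 hz; rewrite -(tel p z p0) mulr_sumr; apply: eq_bigr => i _.
  by rewrite sumr_const_nat subn0 mulr_natl.
(* Here intervals of length [x / p] are shorter than those of length [1 / q]; the increments are
   compared over all [p * q] pairs. *)
have up p q : (0 < p)%N -> (0 < q)%N -> q%:R * x < p%:R -> q%:R * F x <= p%:R.
  move=> p0 q0 h; have p0' : 0 < p%:R :> R by rewrite ltr0n.
  have q0' : 0 < q%:R :> R by rewrite ltr0n.
  rewrite (_ : p%:R = p%:R * F 1); last by rewrite F1 mulr1.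
  rewrite (dbl p q) ?x0 // (dbl q p) ?ler01 ?lexx // exchange_big /=.
  rewrite !big_nat; apply: ler_sum => j /= hj; rewrite !big_nat; apply: ler_sum => i /= hi.
  have [a1 a2 a3] := itv p x i x01 hi; have [b1 b2 b3] := itv q 1 j l01 hj.
  by apply: hF => //; rewrite a3 b3 ltr_pdivrMr // mulrAC ltr_pdivlMr // mul1r mulrC.
have lo p q : (0 < p)%N -> (0 < q)%N -> p%:R < q%:R * x -> p%:R <= q%:R * F x.
  move=> p0 q0 h; have p0' : 0 < p%:R :> R by rewrite ltr0n.
  have q0' : 0 < q%:R :> R by rewrite ltr0n.
  rewrite (_ : p%:R = p%:R * F 1); last by rewrite F1 mulr1.
  rewrite (dbl p q) ?x0 // (dbl q p) ?ler01 ?lexx // exchange_big /=.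
  rewrite !big_nat; apply: ler_sum => i /= hi; rewrite !big_nat; apply: ler_sum => j /= hj.
  have [a1 a2 a3] := itv p x i x01 hi; have [b1 b2 b3] := itv q 1 j l01 hj.
  by apply: hF => //; rewrite a3 b3 ltr_pdivrMr // mulrAC ltr_pdivlMr // mul1r [x * _]mulrC.
apply/eqP; rewrite eq_le; apply/andP; split; rewrite leNgt; apply/negP => h.
  have [q q0 hq] : exists2 q : nat, (0 < q)%N & 1 < q%:R * (F x - x).
    exists (Num.truncn (F x - x)^-1).+1 => //.
    by rewrite -ltr_pdivrMr ?subr_gt0 // div1r truncnS_gt.
  have := up (Num.truncn (q%:R * x)).+1 q isT q0 (truncnS_gt _).
  have : (Num.truncn (q%:R * x))%:R <= q%:R * x by rewrite truncn_le // mulr_ge0.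
  by rewrite -natr1; lra.
(* The constant 2 leaves room to replace the integer part of [q * x], which may equal [q * x], by
   its predecessor. *)
have [q q0 hq] : exists2 q : nat, (0 < q)%N & 2 < q%:R * (x - F x).
  exists (Num.truncn (2 / (x - F x))).+1 => //.
  by rewrite -ltr_pdivrMr ?subr_gt0 // truncnS_gt.
have Fx0 : 0 <= F x.
  have [->|xn0] := eqVneq x 0; first by rewrite F0.
  have := hF 0 0 0 x; rewrite !lexx x0 x1 !subr0 F0 !subr0 lt_def xn0 x0; exact.
have hp : (Num.truncn (q%:R * x))%:R <= q%:R * x by rewrite truncn_le // mulr_ge0.
have hp' := truncnS_gt (q%:R * x).
case: (Num.truncn _) hp hp' => [|p] hp hp'.
  by have := mulr_ge0 (ler0n R q) Fx0; lra.
have p0 : (0 < p)%N.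
  by rewrite -(ltr_nat R); have := mulr_ge0 (ler0n R q) Fx0; move: hp hp'; rewrite -!natr1; lra.
have := lo p q p0 q0; move: hp hp'; rewrite -!natr1; lra.
Qed.
End Circle.

(** * Conjugacy with the rotation *)

Section Conjugacy.
Context (R : realType).
Variables (mu : probability infinite_word R) (X : set infinite_word).
Variables (f : R) (h : infinite_word -> R).
Hypothesis mX : measurable X.
Hypothesis muX : mu X = 1%E.
Hypothesis mu_shift : forall A, measurable A -> mu (wshift @^-1` A) = mu A.
Hypothesis X_shift : forall w, X w -> X (wshift w).
Hypothesis mh : measurable_fun setT (h : infinite_word -> measurableTypeR R).
Hypothesis h_shift : forall w, X w -> h (wshift w) = h w - (w 0%N == ord0)%:R + f.
Hypothesis irr : forall (k : int) n, (0 < n)%N -> n%:R * f != k%:~R.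

Let muXC : mu (~` X) = 0%E.
Proof. by rewrite probability_setC // muX subee. Qed.

Definition phase (w : infinite_word) : measurableTypeR R := frac (h w).

Lemma measurable_phase : measurable_fun setT phase.
Proof. by apply: measurableT_comp => //; exact: measurable_frac. Qed.

Lemma phase_itv w : 0 <= phase w < 1.
Proof. by rewrite frac_ge0 frac_lt1. Qed.

Lemma phase_shift w : X w -> phase (wshift w) = rotation f (phase w).
Proof.
move=> Xw; rewrite /phase h_shift // -[rotation f _]/(frac (frac (h w) + f)) frac_frac.
by rewrite -(fracDz _ (w 0%N == ord0)%:Z) -pmulrn; congr frac; lra.
Qed.

Lemma iter_rotation n x : iter n.+1 (rotation f) x = frac (x + n.+1%:R * f).
Proof.
elim: n => [|n IH]; first by rewrite mul1r.
by rewrite iterS IH -[LHS]/(frac (frac _ + f)) frac_frac -[n.+2%:R]natr1; congr frac; lra.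
Qed.

Lemma phase_iter n w : X w -> phase (iter n wshift w) = frac (phase w + n%:R * f).
Proof.
move=> Xw; elim: n w Xw => [|n IH] w Xw.
  by rewrite mul0r addr0 frac_id // phase_itv.
rewrite iterSr IH; last exact: X_shift.
by rewrite phase_shift // -[rotation f _]/(frac (_ + f)) frac_frac -[n.+1%:R]natr1; congr frac; lra.
Qed.

Lemma mu_eq_off_null Y A B : measurable Y -> mu (~` Y) = 0%E ->
  measurable A -> measurable B -> (forall w, Y w -> A w <-> B w) -> mu A = mu B.
Proof.
move=> mY muY; suff le A' B' : measurable A' -> measurable B' ->
    (forall w, Y w -> A' w -> B' w) -> (mu A' <= mu B')%E.
  by move=> mA mB e; apply/eqP; rewrite eq_le; apply/andP; split; apply: le => // w Yw;
     case: (e w Yw).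
move=> mA mB hAB; apply: (@le_trans _ _ (mu (B' `|` (A' `\` B')))).
  apply: le_measure; rewrite ?inE //; first by apply: measurableU => //; exact: measurableD.
  by move=> w Aw; case: (pselect (B' w)) => Bw; [left|right].
rewrite measureU0 //; first exact: measurableD.
apply: (@subset_measure0 _ _ _ mu _ (~` Y)) => //; first exact: measurableD.
  exact: measurableC.
by move=> w [Aw nB] Yw; apply: nB; exact: hAB.
Qed.

Let mu_eq_on_X A B : measurable A -> measurable B ->
  (forall w, X w -> A w <-> B w) -> mu A = mu B.
Proof. exact: mu_eq_off_null. Qed.

Lemma mu_iter_shift n A : measurable A -> (forall m, measurable (iter m wshift @^-1` A)) ->
  mu (iter n wshift @^-1` A) = mu A.
Proof.
move=> mA hm; elim: n => [|n IH] //; rewrite -IH -(mu_shift (hm n)).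
by congr (mu _); apply/seteqP; split => w /=; rewrite -iterSr.
Qed.

Lemma iter_wshiftE n (w : infinite_word) m : iter n wshift w m = w (n + m)%N.
Proof. by elim: n w => [|n IH] w //; rewrite iterSr IH. Qed.

Lemma measurable_iter_wshift n : measurable_fun setT (iter n wshift).
Proof.
apply: measurable_fun_word => // m a; rewrite setTI.
rewrite (_ : [set _ | _] = [set w | w (n + m)%N = a]); first exact: measurable_coord.
by apply/seteqP; split => w /=; rewrite iter_wshiftE.
Qed.

Lemma mu_phase_rot n B : measurable B ->
  mu (phase @^-1` (turn (n%:R * f) @^-1` B)) = mu (phase @^-1` B).
Proof.
move=> mB; have mB' := measurable_preimage measurable_phase mB.
have mi m := measurable_preimage (measurable_iter_wshift m) mB'.
rewrite -[RHS](mu_iter_shift n) //; apply: mu_eq_on_X => //.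
  exact: measurable_preimage measurable_phase (measurable_preimage (@measurable_turn R _) _).
by move=> w Xw /=; rewrite phase_iter.
Qed.

(** Some multiple of [f] rotates the shorter arc into the longer one, and the law of the phase is
    invariant under this rotation. *)
Lemma mu_phase_le (a b c d : R) : 0 <= a <= b -> b <= 1 -> 0 <= c <= d -> d <= 1 ->
  b - a < d - c -> (mu (phase @^-1` `[a, b[) <= mu (phase @^-1` `[c, d[))%E.
Proof.
move=> hab b1 hcd d1 hlt.
have [n [k hn]] := @orbit_dense R f (c - a) ((d - c) - (b - a)) irr (ltac:(by rewrite subr_gt0)).
have mi (u v : R) : measurable (phase @^-1` `[u, v[).
  exact: measurable_preimage measurable_phase _.
have := @mu_phase_rot n `[c, d[%classic (measurable_itv _) => <-.
apply: le_measure; rewrite ?inE //.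
  exact: measurable_preimage measurable_phase (measurable_preimage (@measurable_turn R _) _).
move=> w /=; rewrite !in_itv /= => hw.
have e : turn (n%:R * f) (phase w) = phase w + n%:R * f - k%:~R.
  by apply: (@frac_eq _ _ _ k); lra.
by rewrite e; lra.
Qed.

Lemma mu_phase_itv (x : R) : 0 <= x <= 1 -> mu (phase @^-1` `[0 : R, x[) = x%:E.
Proof.
have mi (u v : R) : measurable (phase @^-1` `[u, v[).
  exact: measurable_preimage measurable_phase _.
pose F (y : R) := fine (mu (phase @^-1` `[0, y[)).
have FE y : mu (phase @^-1` `[0, y[) = (F y)%:E by rewrite fineK // fin_num_measure.
have Fsub (a b : R) : 0 <= a <= b -> mu (phase @^-1` `[a, b[) = (F b - F a)%:E.
  move=> /andP[a0 ab]; rewrite EFinB -!FE.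
  have : mu (phase @^-1` `[0%R, b[) = (mu (phase @^-1` `[0%R, a[) + mu (phase @^-1` `[a, b[))%E.
    rewrite -measureU //; last first.
      by apply/seteqP; split => // w /=; rewrite !in_itv /= => -[]; lra.
    congr (mu _); apply/seteqP; split => w /=; rewrite !in_itv /=.
      by case: (ltP (phase w) a) => hw; [left|right]; lra.
    by case; lra.
  by move=> ->; rewrite addeAC subee ?add0e // FE.
move=> hx; rewrite FE; congr EFin; apply: (uniform_cdf _ _ _ hx).
- rewrite /F (_ : _ @^-1` _ = set0) ?measure0 //.
  by apply/seteqP; split => // w /=; rewrite in_itv /=; lra.
- rewrite /F (_ : _ @^-1` _ = setT) ?probability_setT //.
  by apply/seteqP; split => // w _ /=; rewrite in_itv /=; apply: phase_itv.
move=> a b c d h1 h2 h3 h4 h5.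
by rewrite -lee_fin -!Fsub //; apply: mu_phase_le.
Qed.

Lemma mu_phase B : measurable B -> mu (phase @^-1` B) = circle_measure R B.
Proof.
pose g (n : nat) : set (measurableTypeR R) := `]-oo, n%:R[%classic.
apply: (@measure_unique _ R (measurableTypeR R) (@RGenInftyO.G R) g
  (RGenInftyO.measurableE R) _ _ _ (pushforward mu phase) (circle_measure R)).
- move=> _ _ [x ->] [y ->]; exists (Num.min x y).
  by apply/seteqP; split => z /=; rewrite !in_itv /= lt_min => /andP.
- by move=> n; exists n%:R.
- apply/seteqP; split => // x _; exists (Num.truncn x).+1 => //=.
  by rewrite /g /= in_itv /= truncnS_gt.
- exact: measurable_phase.
- move=> m A [x ->]; rewrite /pushforward /circle_measure /mrestr /=.
  pose y := Num.max 0 (Num.min x 1).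
  have y01 : 0 <= y <= 1 by rewrite le_max lexx /= ge_max ler01 ge_min lexx orbT.
  have hy (z : R) : 0 <= z < 1 -> (z < y) = (z < x).
    by move=> /andP[z0 z1]; rewrite /y lt_max lt_min z1 andbT ltNge z0.
  transitivity (mu (phase @^-1` `[0%R, y[)).
    congr (mu _); apply/seteqP; split => w /=; rewrite !in_itv /= hy ?phase_itv //.
      by move=> ->; have := phase_itv w; lra.
    by lra.
  rewrite mu_phase_itv //; transitivity (lebesgue_measure (`[0%R, y[%classic : set R)); last first.
    congr lebesgue_measure; apply/seteqP; split => z /=; rewrite !in_itv /=.
      move=> hz; have hz1 : 0 <= z < 1 by lra.
      by move: hz; rewrite hy // => /andP[_ ->].
    by move=> [zx hz]; rewrite hy // zx andbT; case/andP: hz.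
  rewrite lebesgue_measure_itv /= lte_fin oppr0 adde0.
  by have /andP[] := y01; rewrite le_eqVlt => /orP[/eqP<-|->] //; rewrite ltxx.
move=> m k; apply: (@le_lt_trans _ _ 1%E); last exact: ltry.
apply: probability_le1; apply: measurable_preimage => //; exact: measurable_itv.
Qed.

Hypothesis agree : forall e : R, 0 < e -> exists (T0 : nat) (dl : R),
  [/\ (0 < T0)%N, 0 < dl & forall w w' (k : int), X w -> X w' ->
    `|h w - h w' - k%:~R| < dl ->
    (count (fun t => w t != w' t) (iota 0 T0))%:R <= e * T0%:R].

Definition mismatch (g : R -> bool) (t : nat) : set infinite_word :=
  [set w | (w t == ord0) != g (phase w)].

Lemma measurable_mismatch (g : R -> bool) t : measurable [set z : measurableTypeR R | g z] ->
  measurable (mismatch g t).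
Proof.
move=> mg; have m1 := measurable_preimage measurable_phase mg.
have m2 := measurable_coord t ord0.
rewrite (_ : mismatch g t = ([set w | w t = ord0] `\` phase @^-1` [set z | g z]) `|`
  (phase @^-1` [set z | g z] `\` [set w | w t = ord0])).
  by apply: measurableU; apply: measurableD.
apply/seteqP; split => w; rewrite /mismatch /=.
  by have [h1|h1] := eqVneq (w t) ord0; case: (g (phase w)) => //= _;
     [left|right]; split => //; exact/eqP.
by case=> [[-> /negP]|[-> /eqP/negPf->]] //; rewrite eqxx; case: (g _).
Qed.

(* Cut the circle into arcs of length less than [dl] and let [G t] predict the
   letter at time [t] from that of a fixed representative of the arc; on average
   over [t < T0] the prediction fails with probability at most [e]. *)
Lemma exists_small_mismatch (e : R) : 0 < e -> exists (g : R -> bool) t,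
  measurable [set z : measurableTypeR R | g z] /\ (mu (mismatch g t) <= e%:E)%E.
Proof.
move=> e0; have [T0 [dl [T00 dl0 hag]]] := agree e0.
pose N := (Num.truncn dl^-1).+1.
have N0 : 0 < N%:R :> R by rewrite ltr0n.
have Ne : N%:R^-1 < dl by rewrite invf_plt ?posrE //; exact: truncnS_gt.
pose c (z : measurableTypeR R) := Num.floor (N%:R * z).
have mc k : measurable [set z | c z = k].
  rewrite (_ : [set _ | _] = (fun z => N%:R * z) @^-1` `[k%:~R, (k + 1)%:~R[%classic).
    apply: measurable_preimage => //; exact: measurable_funM.
  apply/seteqP; split => z /=; rewrite in_itv /=; last exact: floor_def.
  by move=> <-; rewrite floor_itv.
(* A word of [X] for each arc that contains the phase of some word of [X]; on other arcs the
   constant word is a dummy value. *)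
have [rep hrep] : exists rep : int -> infinite_word, forall w, X w ->
    X (rep (c (phase w))) /\ c (phase (rep (c (phase w)))) = c (phase w).
  have /choice[rep hr] : forall k : int, exists v, (exists w, X w /\ c (phase w) = k) ->
      X v /\ c (phase v) = k.
    move=> k; case: (pselect (exists w, X w /\ c (phase w) = k)) => [[v hv]|hn].
      by exists v.
    by exists (fun=> ord0).
  by exists rep => w Xw; apply: hr; exists w.
pose G (t : nat) (z : R) := rep (c z) t == ord0.
have mG t : measurable [set z : measurableTypeR R | G t z].
  rewrite (_ : [set _ | _] = \bigcup_k (if rep k t == ord0 then [set z | c z = k] else set0)).
    apply: countable_bigcupT_measurable; first exact: countableP.
    by move=> k; case: ifP.
  apply/seteqP; split => z /=; first by move=> h1; exists (c z) => //; rewrite -/(G t z) h1.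
  by move=> [k _]; case: ifP => // h1 /= hk; rewrite /G hk.
pose A t := X `&` mismatch (G t) t.
have mA t : measurable (A t) by apply: measurableI => //; apply: measurable_mismatch.
have muA t : mu (A t) = mu (mismatch (G t) t).
  by apply: mu_eq_on_X => //; [exact: measurable_mismatch|move=> w Xw; split=> [[]|]].
have hpt w : \sum_(t <- iota 0 T0) (\1_(A t) w : R) <= e * T0%:R.
  case: (pselect (X w)) => Xw; last first.
    rewrite big1 ?mulr_ge0 // ?ltW // => t _; rewrite indicE memNset //; by case.
  have [Xr cr] := hrep w Xw.
  apply: le_trans (hag w (rep (c (phase w)))
    (Num.floor (h w) - Num.floor (h (rep (c (phase w))))) Xw Xr _).
    rewrite -sum1_count natr_sum [leRHS]big_mkcond /=; apply: ler_sum => t _.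
    rewrite indicE; have [/set_mem[_]|_] := boolP (w \in A t); last by case: ifP.
    by rewrite /mismatch /G /= => h1; rewrite (_ : w t != _) //; apply: contra h1 => /eqP->.
  rewrite (_ : _ - _ = phase w - phase (rep (c (phase w)))); last first.
    by rewrite /phase /frac intrB; lra.
  apply: lt_trans Ne; rewrite -(ltr_pM2r N0) mulVf ?gt_eqF // -[X in _ * X](gtr0_norm N0) -normrM.
  have := floor_itv (N%:R * phase w); have := floor_itv (N%:R * phase (rep (c (phase w)))).
  rewrite -/(c (phase w)) -/(c (phase (rep _))) cr !intrD => h1 h2.
  by rewrite ltr_norml mulrBl; lra.
have hsum : (\sum_(t <- iota 0 T0) mu (A t) <= (e * T0%:R)%:E)%E.
  have -> : (\sum_(t <- iota 0 T0) mu (A t))%E =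
      (\int[mu]_w (\sum_(t <- iota 0 T0) (\1_(A t) w : R)%:E))%E; last first.
    apply: le_trans (_ : (\int[mu]_w (e * T0%:R)%:E <= _)%E).
      apply: ge0_le_integral => //.
      - by move=> w _; apply: sume_ge0 => t _; rewrite lee_fin.
      - by apply: emeasurable_sum => t; apply/measurable_EFinP; apply: measurable_indic.
      - by move=> w _; rewrite sumEFin lee_fin.
    by rewrite integral_cst // [X in (_ * X)%E](_ : _ = 1%E) ?mule1 //; exact: probability_setT.
  rewrite ge0_integral_sum //.
  - by apply: eq_bigr => t _; rewrite integral_indic // setIT.
  - by move=> t; apply/measurable_EFinP; apply: measurable_indic.
apply: contrapT => hn.
have hlt t : (e%:E < mu (A t))%E.
  by rewrite muA ltNge; apply/negP => hle; apply: hn; exists (G t), t.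
move: hsum; apply/negP; rewrite -ltNge.
rewrite (_ : (e * T0%:R)%:E = \sum_(t <- iota 0 T0) e%:E)%E; last first.
  by rewrite sumEFin big_const_seq count_predT size_iota iter_addr_0 mulr_natr.
clear -hlt T00; case: T0 T00 => // T0 _.
rewrite -[T0.+1]addn1 iotaD big_cat [X in (_ < X)%E]big_cat /= !big_seq1.
apply: lee_ltD => //; first by rewrite sumEFin.
by apply: lee_sum => t _; apply: ltW.
Qed.

(** Letter [t] of a word is letter 0 of its [t]-th shift, so invariance allows the prediction to be
    rotated back to time 0. *)
Lemma exists_small_mismatch0 (e : R) : 0 < e -> exists2 g : R -> bool,
  measurable [set z : measurableTypeR R | g z] & (mu (mismatch g 0) <= e%:E)%E.
Proof.
move=> e0; have [g [t [mg hg]]] := exists_small_mismatch e0.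
pose g' z := g (turn (- (t%:R * f)) z).
have mg' : measurable [set z : measurableTypeR R | g' z].
  exact: measurable_preimage (@measurable_turn R _) mg.
exists g' => //.
have mm := measurable_mismatch 0%N mg'.
have mi m := measurable_preimage (measurable_iter_wshift m) mm.
rewrite -(mu_iter_shift t mm) //; apply: le_trans hg.
rewrite le_eqVlt; apply/orP; left; apply/eqP; apply: mu_eq_on_X => //.
  exact: measurable_mismatch.
move=> w Xw; rewrite /mismatch /g' /= iter_wshiftE addn0 phase_iter //.
by rewrite /turn frac_frac addrK frac_id // phase_itv.
Qed.

(** Borel-Cantelli: with summable error probabilities almost every word is eventually predicted
    correctly, and then the upper limit of the predictions is correct. *)
Lemma exists_null_mismatch : exists2 g : R -> bool,
  measurable [set z : measurableTypeR R | g z] & mu (mismatch g 0) = 0%E.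
Proof.
have /choice[g hg] : forall k : nat, exists g : R -> bool,
    measurable [set z : measurableTypeR R | g z] /\
    (mu (mismatch g 0) <= (1 / (2 ^ k.+1)%:R)%:E)%E.
  move=> k; have [|g] := @exists_small_mismatch0 (1 / (2 ^ k.+1)%:R); last by exists g.
  by rewrite divr_gt0 // ltr0n expn_gt0.
pose L := lim_sup_set (fun k => [set z : measurableTypeR R | g k z]).
have mL : measurable L.
  by apply: bigcapT_measurable => n; apply: bigcup_measurable => k _; exact: (hg k).1.
have mm k : measurable (mismatch (g k) 0) by apply: measurable_mismatch; exact: (hg k).1.
exists (fun z => `[< L z >]).
  by rewrite (_ : [set _ | _] = L) //; apply/seteqP; split => z /= /asboolP.
apply: (@subset_measure0 _ _ _ mu _ (lim_sup_set (fun k => mismatch (g k) 0))).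
- apply: measurable_mismatch; rewrite (_ : [set _ | _] = L) //.
  by apply/seteqP; split => z /= /asboolP.
- by apply: bigcapT_measurable => n; apply: bigcup_measurable => k _.
- move=> w hw; apply: contrapT => hn; move: hw; rewrite /mismatch /=.
  have [n hn'] : exists n, forall k, (n <= k)%N -> g k (phase w) = (w 0%N == ord0).
    apply: contrapT => hn2; apply: hn => n _; apply: contrapT => hn3; apply: hn2.
    exists n => k hk; apply/eqP/negPn/negP => hne; apply: hn3; exists k => //.
    by rewrite /mismatch /= eq_sym.
  apply/negP; rewrite negbK; apply/eqP; apply/idP/asboolP => [w0 m _|hL].
    exists (maxn m n); first exact: leq_maxl.
    by rewrite /= hn' // leq_maxr.
  by have [k hk] := hL n I; rewrite /= hn'.
apply: lim_sup_set_cvg0 => //.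
apply: (@le_lt_trans _ _ 1%E); last exact: ltry.
apply: (@le_trans _ _ (\sum_(k <oo) (1 / (2 ^ k.+1)%:R)%:E)%E); last exact: epsilon_trick0.
by apply: lee_nneseries => [k _ _|k _]; [exact: measure_ge0|exact: (hg k).2].
Qed.

Definition coding (g : R -> bool) (z : measurableTypeR R) : infinite_word :=
  fun n => if g (iter n (rotation f) z) then ord0 else ord_max.

Lemma measurable_iter_rotation n : measurable_fun setT (iter n (rotation f)).
Proof.
elim: n => [|n IH]; first exact: measurable_id.
exact: (measurableT_comp (@measurable_turn R f) IH).
Qed.

Lemma measurable_coding (g : R -> bool) : measurable [set z : measurableTypeR R | g z] ->
  measurable_fun setT (coding g).
Proof.
move=> mg; apply: measurable_fun_word => // n a; rewrite setTI.
have m1 := measurable_preimage (measurable_iter_rotation n) mg.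
have [->|->] := letterP a.
  rewrite (_ : [set _ | _] = iter n (rotation f) @^-1` [set z | g z]) //.
  by apply/seteqP; split => z /=; rewrite /coding; case: ifP.
rewrite (_ : [set _ | _] = ~` (iter n (rotation f) @^-1` [set z | g z])); first exact: measurableC.
by apply/seteqP; split => z /=; rewrite /coding; case: ifP.
Qed.

Lemma coding_rotation g z : coding g (rotation f z) = wshift (coding g z).
Proof. by apply/funext => n; rewrite /coding /wshift iterSr. Qed.

(** By invariance the words with some wrongly predicted letter form a null set, and elsewhere
    [coding g] inverts the phase. The function [g] is exposed because the spectral part needs this
    inverse. *)
Lemma phase_conjugacy : exists (X1 : set infinite_word) (X2 : set (measurableTypeR R)) (g : R -> bool),
  [/\ X1 `<=` X, measurable [set z : measurableTypeR R | g z],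
      [/\ measurable X1, mu (~` X1) = 0%E & wshift @` X1 `<=` X1],
      [/\ measurable X2, circle_measure R (~` X2) = 0%E & rotation f @` X2 `<=` X2] &
      [/\ phase @` X1 `<=` X2, coding g @` X2 `<=` X1,
          {in X1, cancel phase (coding g)} & {in X2, cancel (coding g) phase}]].
Proof.
have [g mg g0] := exists_null_mismatch.
have mc := measurable_coding mg.
pose X1 := X `&` [set w | coding g (phase w) = w].
pose X2 := coding g @^-1` X `&` [set z | phase (coding g z) = z].
have mX1 : measurable X1.
  rewrite /X1 (_ : [set w | _] = \bigcap_n ~` mismatch (fun z => coding g z n == ord0) n).
    apply: measurableI => //; apply: bigcapT_measurable => n; apply: measurableC.
    apply: measurable_mismatch; rewrite (_ : [set _ | _] = coding g @^-1` [set w | w n = ord0]).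
      exact: measurable_preimage mc (measurable_coord _ _).
    by apply/seteqP; split => z /= /eqP.
  apply/seteqP; split => w /=; first by move=> e n _; rewrite /mismatch /= e eqxx.
  move=> hw; apply/funext => n; have := hw n I; rewrite /mismatch /= => /negP; rewrite negbK.
  by case: (letterP (w n)) => ->; case: (letterP (coding g (phase w) n)) => ->.
have mX2 : measurable X2.
  apply: measurableI; first exact: measurable_preimage mc mX.
  have mp := measurableT_comp measurable_phase mc.
  rewrite (_ : [set z | _] = (fun z => phase (coding g z) == z) @^-1` [set true]).
    by apply: measurable_preimage => //; apply: measurable_fun_eqr.
  by apply/seteqP; split => z /= /eqP.
have s1 w : X1 w -> X1 (wshift w).
  by move=> [Xw e]; split; [exact: X_shift|rewrite /= phase_shift // coding_rotation e].
have p12 w : X1 w -> X2 (phase w).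
  by move=> [Xw e]; rewrite /X2 /= /preimage /= e.
have mu1 : mu (~` X1) = 0%E.
  have mm n := measurable_preimage (measurable_iter_wshift n) (measurable_mismatch 0%N mg).
  apply: (@subset_measure0 _ _ _ mu _ (~` X `|` \bigcup_n (iter n wshift @^-1` mismatch g 0))).
  - exact: measurableC.
  - by apply: measurableU; [exact: measurableC|exact: bigcupT_measurable].
  - move=> w nw; apply: contrapT => hn; apply: nw.
    have Xw : X w by apply: contrapT => nX; apply: hn; left.
    split => //=; apply/funext => n; apply: contrapT => hne; apply: hn; right; exists n => //.
    rewrite /mismatch /= iter_wshiftE addn0 phase_iter //.
    have := hne; rewrite /coding.
    have -> : iter n (rotation f) (phase w) = frac (phase w + n%:R * f).
      by case: n {hne} => [|n]; rewrite ?iter_rotation // mul0r addr0 frac_id // phase_itv.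
    by case: (letterP (w n)) => ->; case: (g _).
  apply/(negligibleP mu); first by apply: measurableU; [exact: measurableC|exact: bigcupT_measurable].
  apply: negligibleU; first by apply/(negligibleP mu) => //; exact: measurableC.
  apply: negligible_bigcup => n; apply/(negligibleP mu) => //.
  exact: etrans (mu_iter_shift n (measurable_mismatch 0 mg) mm) g0.
exists X1, X2, g; split => //.
- by move=> w [].
- by split => // _ [w hw <-]; apply: s1.
- split => //.
    rewrite -mu_phase; last exact: measurableC.
    apply: (@subset_measure0 _ _ _ mu _ (~` X1)) => //.
    - by apply: measurable_preimage measurable_phase _; exact: measurableC.
    - exact: measurableC.
    by move=> w /= h1 h2; apply: h1; exact: p12.
  move=> _ [z [Xz e] <-]; rewrite /X2 /= /preimage /= coding_rotation; split; first exact: X_shift.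
  by rewrite phase_shift // e.
split.
- by move=> _ [w hw <-]; exact: p12.
- by move=> _ [z [Xz e] <-]; split => //=; rewrite e.
- by move=> w; rewrite inE => -[].
- by move=> z; rewrite inE => -[].
Qed.

Lemma measurably_conjugate_rotation :
  measurably_conjugate mu wshift (circle_measure R) (rotation f).
Proof.
have [X1 [X2 [g [X1X mg h1 h2 h3]]]] := phase_conjugacy.
have [mX1 mu1 _] := h1; have [p1 p2 _ _] := h3.
exists X1, X2, phase, (coding g); split => //.
  split; first exact: measurable_funS measurable_phase.
  exact: measurable_funS (measurable_coding mg).
split; last by move=> w; rewrite inE => /X1X; exact: phase_shift.
move=> B mB; have [mX2 _ _] := h2.
rewrite -mu_phase; last exact: measurableI.
have mp := measurable_preimage measurable_phase (measurableI _ _ mX2 mB).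
apply: (mu_eq_off_null mX1 mu1) => //.
  by apply: measurableI => //; exact: measurable_preimage measurable_phase _.
move=> w X1w; split => [[_ Bw]|[_ Bw]]; split => //.
by apply: p1; exists w.
Qed.

End Conjugacy.

(** * Trigonometric polynomials *)

Section TrigonometricPolynomials.
Context (R : realType).
Implicit Types (t a x : R).
Local Notation e := (@expi R).

Lemma expiD a b : e (a + b) = e a * e b.
Proof.
rewrite /expi cosD sinD; apply/eqP; rewrite eq_complex /=.
by apply/andP; split; apply/eqP; ring.
Qed.

Lemma expi_2piz (k : int) : e (2 * pi * k%:~R) = 1.
Proof.
have h (n : nat) : e (2 * pi * n%:R) = 1.
  elim: n => [|n IH]; first by rewrite mulr0 /expi cos0 sin0.
  rewrite (_ : 2 * pi * n.+1%:R = 2 * pi * n%:R + 2 * pi); last by ring.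
  by rewrite expiD IH mul1r /expi mulr_natl cos2pi sin2pi.
case: k => n; first by rewrite -pmulrn h.
rewrite NegzE mulrNz -pmulrn mulrN -[LHS]mul1r -{1}(h n.+1) -expiD subrr.
by rewrite /expi cos0 sin0.
Qed.

Definition trig_poly (p : R -> R) := exists s : seq (R[i] * int),
  forall t, (p t)%:C%C = \sum_(ck <- s) ck.1 * e (2 * pi * ck.2%:~R * t).

Lemma trig_poly_cst c : trig_poly (fun=> c).
Proof.
exists [:: (c%:C%C, 0%Z)] => t; rewrite big_seq1 /= mulr0z mulr0 mul0r.
by rewrite /expi cos0 sin0 mulr1.
Qed.

Lemma trig_polyD p q : trig_poly p -> trig_poly q -> trig_poly (fun t => p t + q t).
Proof. by move=> [s hs] [s' hs']; exists (s ++ s') => t; rewrite big_cat /= -hs -hs' raddfD. Qed.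

Lemma trig_polyM p q : trig_poly p -> trig_poly q -> trig_poly (fun t => p t * q t).
Proof.
move=> [s hs] [s' hs'].
exists [seq (ck.1 * cl.1, ck.2 + cl.2) | ck <- s, cl <- s'] => t.
rewrite (_ : (p t * q t)%:C%C = (p t)%:C%C * (q t)%:C%C); last by rewrite rmorphM.
rewrite big_flatten big_map hs hs' mulr_suml; apply: eq_bigr => ck _.
rewrite big_map mulr_sumr; apply: eq_bigr => cl _ /=.
rewrite (_ : 2 * pi * (ck.2 + cl.2)%:~R * t = 2 * pi * ck.2%:~R * t + 2 * pi * cl.2%:~R * t).
  by rewrite expiD; ring.
by rewrite intrD; ring.
Qed.

Lemma trig_polyX p n : trig_poly p -> trig_poly (fun t => p t ^+ n).
Proof.
move=> hp; elim: n => [|n IH]; first exact: trig_poly_cst.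
have := trig_polyM hp IH; rewrite (_ : (fun t => p t * p t ^+ n) = fun t => p t ^+ n.+1) //.
by apply/funext => t; rewrite exprS.
Qed.

Lemma trig_poly_cos a : trig_poly (fun t => cos (2 * pi * (t - a))).
Proof.
exists [:: (e (- (2 * pi * a)) / 2, 1); (e (2 * pi * a) / 2, -1)] => t.
rewrite big_cons big_seq1 /= mulr1 mulrN mulr1.
have half (x y z w : R[i]) : x / 2 * y + z / 2 * w = (x * y + z * w) / 2 by ring.
rewrite half -!expiD (_ : - _ + _ = 2 * pi * (t - a)); last by ring.
rewrite (_ : 2 * pi * a + _ = - (2 * pi * (t - a))); last by ring.
set u := 2 * pi * _; rewrite /expi cosN sinN.
apply: (canRL (mulfK _)); first by rewrite pnatr_eq0.
by apply/eqP; rewrite eq_complex /=; apply/andP; split; apply/eqP; ring.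
Qed.

Lemma measurable_cos d (T : measurableType d) (g : T -> R) :
  measurable_fun setT g -> measurable_fun setT (fun y : T => cos (g y)).
Proof.
by apply: measurableT_comp; apply: continuous_measurable_fun; exact: continuous_cos.
Qed.

Lemma measurable_sin d (T : measurableType d) (g : T -> R) :
  measurable_fun setT g -> measurable_fun setT (fun y : T => sin (g y)).
Proof.
by apply: measurableT_comp; apply: continuous_measurable_fun; exact: continuous_sin.
Qed.

Lemma trig_poly_measurable p : trig_poly p -> measurable_fun setT p.
Proof.
move=> [s hs].
have -> : p = (fun t => \sum_(ck <- s) (complex.Re ck.1 * cos (2 * pi * ck.2%:~R * t)
    - complex.Im ck.1 * sin (2 * pi * ck.2%:~R * t))).
  apply/funext => t; have := congr1 (@complex.Re R) (hs t); rewrite /= => ->.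
  rewrite raddf_sum; apply: eq_bigr => -[[c c'] k] _ /=; by [].
apply: measurable_sum => ck; apply: measurable_funB; apply: measurable_funM => //.
  by apply: measurable_cos; exact: measurable_funM.
by apply: measurable_sin; exact: measurable_funM.
Qed.

(** The arc from 0 to [a] has centre [a / 2]; symmetry and periodicity bring the arguments into
    [0, pi], where the cosine decreases. *)
Lemma cos_arc a t : 0 < a < 1 -> 0 < t < 1 ->
  (t < a -> cos (pi * a) < cos (2 * pi * (t - a / 2))) /\
  (a < t -> cos (2 * pi * (t - a / 2)) < cos (pi * a)).
Proof.
move=> ha ht; have pi0 := pi_gt0 R.
have ia : pi * a \in `[0, pi].
  by rewrite in_itv /= mulr_ge0 ?ler_piMr ?(ltW pi0) //; lra.
have e1 : 2 * pi * (t - a / 2) = pi * (2 * t - a) by field.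
rewrite e1; split => hta.
  have [h|h] := leP 0 (2 * t - a).
    rewrite ltr_cos ?in_itv //=; last first.
      by rewrite mulr_ge0 ?(ltW pi0) //= ler_piMr ?(ltW pi0) //; lra.
    by rewrite ltr_pM2l //; lra.
  rewrite -[X in _ < X]cosN -mulrN ltr_cos ?in_itv //=; last first.
    by rewrite mulr_ge0 ?(ltW pi0) ?ler_piMr ?(ltW pi0) //; lra.
  by rewrite ltr_pM2l //; lra.
have [h|h] := leP (2 * t - a) 1.
  rewrite ltr_cos ?in_itv //=; last first.
    by rewrite mulr_ge0 ?(ltW pi0) //= ?ler_piMr ?(ltW pi0) //; lra.
  by rewrite ltr_pM2l //; lra.
rewrite -[X in X < _]cosN -(cosD2pi (- _)) ltr_cos ?in_itv //=.
  rewrite [- _ + _](_ : _ = pi * (2 - (2 * t - a))); last by rewrite -mulr_natl; ring.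
  by rewrite ltr_pM2l //; lra.
rewrite [- _ + _](_ : _ = pi * (2 - (2 * t - a))); last by rewrite -mulr_natl; ring.
by rewrite mulr_ge0 ?(ltW pi0) ?ler_piMr ?(ltW pi0) //; lra.
Qed.

Lemma bernoulli_le (y : R) m : 0 <= y <= 1 -> 1 - m%:R * y <= (1 - y) ^+ m.
Proof.
move=> /andP[y0 y1]; elim: m => [|m IH]; first by rewrite mul0r subr0.
rewrite exprS -natr1; apply: (@le_trans _ _ ((1 - y) * (1 - m%:R * y))).
  have h : 0 <= m%:R * (y * y) by rewrite !mulr_ge0.
  lra.
by rewrite ler_wpM2l // subr_ge0.
Qed.

(** Bernoulli bounds [m * y] by the power of [1 + y], and [(1 + y) * (1 - y)] is at most 1. *)
Lemma bernoulli_inv (y : R) m : 0 <= y <= 1 -> m%:R * y * (1 - y) ^+ m <= 1.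
Proof.
move=> hy; have /andP[y0 y1] := hy.
apply: (@le_trans _ _ ((1 + y) ^+ m * (1 - y) ^+ m)); last first.
  by rewrite -exprMn exprn_ile1 //; nra.
apply: ler_wpM2r; first by rewrite exprn_ge0 // subr_ge0.
elim: m => [|m IH]; first by rewrite mul0r.
rewrite exprS -natr1 mulrDl mul1r.
have h1 : 1 <= (1 + y) ^+ m by rewrite exprn_ege1 // lerDl.
nra.
Qed.

(* For [0 <= x <= 1], these polynomials tend to 1 if [x < 1 / 2] and to 0 if
   [x > 1 / 2]; this is the step function device of the elementary proof of the
   Stone-Weierstrass theorem by Brosowski and Deutsch. *)
Definition steep (n : nat) (x : R) : R := (1 - x ^+ n) ^+ (2 ^ n).

Lemma steep01 n x : 0 <= x <= 1 -> 0 <= steep n x <= 1.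
Proof.
move=> /andP[x0 x1]; have h : 0 <= 1 - x ^+ n by rewrite subr_ge0 exprn_ile1.
by rewrite exprn_ge0 // exprn_ile1 // lerBlDr lerDl exprn_ge0.
Qed.

(** The exponent [2 ^ n] turns [x ^+ n] into [(2 * x) ^+ n]: this is the error below 1 / 2, and its
    inverse is the error above. *)
Lemma steep_approx x : 0 <= x <= 1 -> x != 1 / 2 ->
  exists2 r : R, 0 <= r < 1 & forall n : nat, `|(x < 1 / 2)%R%:R - steep n x| <= r ^+ n.
Proof.
move=> hx xn; have /andP[x0 x1] := hx.
have hn n : 0 <= x ^+ n <= 1 by rewrite exprn_ge0 // exprn_ile1.
have [lt|ge] := ltP x (1 / 2).
  exists (2 * x); first lra.
  move=> n; have /andP[b0 b1] := steep01 n hx; rewrite mulr1n ger0_norm ?subr_ge0 //.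
  have := bernoulli_le (2 ^ n) (hn n); rewrite -/(steep n x) natrX -exprMn; lra.
have {}ge : 1 / 2 < x by rewrite lt_def xn ge.
exists (2 * x)^-1; first by rewrite invr_ge0 invf_lt1; lra.
move=> n; have /andP[b0 b1] := steep01 n hx; rewrite sub0r normrN ger0_norm //.
rewrite exprVn -[leRHS]mul1r ler_pdivlMr ?exprn_gt0; try lra.
by rewrite mulrC exprMn -natrX; exact: bernoulli_inv.
Qed.

End TrigonometricPolynomials.

(** * Pure discrete spectrum of an invertible coding of a rotation *)

Section PureDiscreteSpectrum.
Context (R : realType) (d : measure_display) (T : measurableType d).
Variables (mu : probability T R) (F : T -> T) (X : set T) (f : R).
Variables (phi : T -> measurableTypeR R) (psi : measurableTypeR R -> T).
Hypothesis mX : measurable X.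
Hypothesis muX : mu (~` X) = 0%E.
Hypothesis mphi : measurable_fun setT phi.
Hypothesis phi_itv : forall x, 0 <= phi x < 1.
Hypothesis phi_atomless : forall a : R, mu (phi @^-1` [set a]) = 0%E.
Hypothesis phi_iter : forall n x, X x -> phi (iter n F x) = frac (phi x + n%:R * f).
Hypothesis mpsi : measurable_fun setT psi.
Hypothesis phiK : forall x, X x -> psi (phi x) = x.

Definition energy (u : T -> R) : \bar R := (\int[mu]_x ((u x) ^+ 2)%:E)%E.

Definition approximable (u : T -> R) := measurable_fun setT u /\
  forall eps : R, 0 < eps -> exists2 p, trig_poly p &
    (energy (fun x => (u x - p (phi x))%R) < eps%:E)%E.

Lemma measurable_trig_poly p : trig_poly p -> measurable_fun setT (fun x => p (phi x)).
Proof. by move=> tp; exact: measurableT_comp (trig_poly_measurable tp) mphi. Qed.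

Lemma measurable_sqr (u : T -> R) : measurable_fun setT u ->
  measurable_fun setT (fun x => (u x ^+ 2)%:E).
Proof. by move=> mu'; apply/measurable_EFinP; exact: measurable_funX. Qed.

Lemma energyD (u v : T -> R) : measurable_fun setT u -> measurable_fun setT v ->
  (energy (fun x => (u x + v x)%R) <= 2%:E * energy u + 2%:E * energy v)%E.
Proof.
move=> mu' mv; have m1 := measurable_sqr mu'; have m2 := measurable_sqr mv.
rewrite /energy -!ge0_integralZl_EFin //; try by move=> x _; rewrite lee_fin sqr_ge0.
rewrite -ge0_integralD //; try by move=> x _; rewrite -EFinM lee_fin mulr_ge0 // sqr_ge0.
- apply: ge0_le_integral => //.
  + by move=> x _; rewrite lee_fin sqr_ge0.
  + by apply: measurable_sqr; exact: measurable_funD.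
  + by apply: emeasurable_funD; exact: measurable_funeM.
  move=> x _; rewrite -!EFinM -EFinD lee_fin.
  by have := sqr_ge0 (u x - v x); rewrite !sqrrD sqrrN; lra.
- exact: measurable_funeM.
- exact: measurable_funeM.
Qed.

Lemma energyD_lt (u v w : T -> R) (eps : R) : (forall x, w x = u x + v x) ->
  measurable_fun setT u -> measurable_fun setT v ->
  (energy u < (eps / 4)%:E)%E -> (energy v < (eps / 4)%:E)%E -> (energy w < eps%:E)%E.
Proof.
move=> /funext -> mu' mv hu hv; apply: le_lt_trans (energyD mu' mv) _.
rewrite (_ : eps%:E = (2%:E * (eps / 4)%:E + 2%:E * (eps / 4)%:E)%E).
  by apply: lteD; rewrite lte_pmul2l.
by rewrite -!EFinM -EFinD; congr EFin; lra.
Qed.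

Lemma approximable_lim (u : T -> R) : measurable_fun setT u ->
  (forall eps : R, 0 < eps -> exists2 v, approximable v &
    (energy (fun x => (u x - v x)%R) < eps%:E)%E) ->
  approximable u.
Proof.
move=> mu' h; split => // eps e0; have e4 : 0 < eps / 4 by lra.
have [v [mv hv] uv] := h _ e4; have [p tp hp] := hv _ e4; exists p => //.
have mp := measurable_trig_poly tp.
apply: energyD_lt uv hp; try exact: measurable_funB.
by move=> x; rewrite addrA subrK.
Qed.

Lemma approximable_poly p : trig_poly p -> approximable (fun x => p (phi x)).
Proof.
move=> tp; split; first exact: measurable_trig_poly.
move=> eps e0; exists p => //; rewrite /energy; under eq_integral do rewrite subrr expr0n /=.
by rewrite integral0 lte_fin.
Qed.

Lemma approximableD u v : approximable u -> approximable v -> approximable (fun x => u x + v x).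
Proof.
move=> [mu' hu] [mv hv]; split; first exact: measurable_funD.
move=> eps e0; have e4 : 0 < eps / 4 by lra.
have [p tp hp] := hu _ e4; have [q tq hq] := hv _ e4.
exists (fun t => p t + q t); first exact: trig_polyD.
have mp := measurable_trig_poly tp.
have mq := measurable_trig_poly tq.
apply: energyD_lt hp hq; try exact: measurable_funB.
by move=> x; rewrite opprD addrACA.
Qed.

Lemma approximableZ c u : approximable u -> approximable (fun x => c * u x).
Proof.
move=> [mu' hu]; split; first exact: measurable_funM.
have [->|c0] := eqVneq c 0.
  move=> eps e0; exists (fun=> 0); first exact: trig_poly_cst.
  rewrite /energy; under eq_integral do rewrite mul0r subrr expr0n /=.
  by rewrite integral0 lte_fin.
have c2 : 0 < c ^+ 2 by rewrite exprn_even_gt0.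
move=> eps e0; have [|p tp hp] := hu (eps / c ^+ 2); first exact: divr_gt0.
exists (fun t => c * p t); first exact: trig_polyM (trig_poly_cst c) tp.
have mp := measurable_trig_poly tp.
rewrite (_ : energy _ = (c ^+ 2)%:E * energy (fun x => (u x - p (phi x))%R))%E.
  rewrite (_ : eps = c ^+ 2 * (eps / c ^+ 2)); last by rewrite mulrC divfK // gt_eqF.
  by rewrite [X in (_ < X)%E]EFinM lte_pmul2l.
rewrite /energy -ge0_integralZl_EFin //; last by apply: ltW.
- by apply: eq_integral => x _; rewrite -EFinM -exprMn mulrBr.
- by move=> x _; rewrite lee_fin sqr_ge0.
by apply: measurable_sqr; exact: measurable_funB.
Qed.

Lemma approximable_sum n (u : nat -> T -> R) : (forall i, approximable (u i)) ->
  approximable (fun x => \sum_(i < n) u i x).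
Proof.
move=> hu; elim: n => [|n IH].
  have := approximable_poly (trig_poly_cst 0); congr approximable.
  by apply/funext => x; rewrite big_ord0.
have := approximableD IH (hu n); congr approximable.
by apply/funext => x; rewrite big_ord_recr.
Qed.

Lemma dominated_small (v : nat -> T -> R) (w : T -> R) (eps : R) :
  (forall n, measurable_fun setT (v n)) ->
  mu.-integrable setT (EFin \o w) -> (forall n x, 0 <= v n x <= w x) ->
  {ae mu, forall x, v n x @[n --> \oo] --> 0} -> 0 < eps ->
  exists n, (\int[mu]_x (v n x)%:E < eps%:E)%E.
Proof.
move=> mv iw hv cv e0.
have cv' : {ae mu, forall x, [set: T] x -> (v n x)%:E @[n --> \oo] --> 0%E}.
  by apply: filterS cv => x hx _; apply: cvg_EFin => //; exact: nearW.
have hw : {ae mu, forall x n, [set: T] x -> (`|(v n x)%:E| <= (EFin \o w) x)%E}.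
  by apply: aeW => x n _ /=; have /andP[h0 h1] := hv n x; rewrite lee_fin ger0_norm.
have [_ _] := dominated_convergence measurableT (fun n => (measurable_EFinP _ _).2 (mv n))
  (measurable_cst _) cv' iw hw.
rewrite integral0 => /fine_cvgP[hfin /cvgrPdist_lt/(_ _ e0) hlt].
near \oo => n; exists n.
have hn : (\int[mu]_x (v n x)%:E)%E \is a fin_num by near: n.
rewrite -(fineK hn) lte_fin; apply: le_lt_trans (ler_norm _) _.
by rewrite -normrN -sub0r; near: n.
Unshelve. all: by end_near.
Qed.

Lemma approximable_ae (u v : T -> R) : measurable_fun setT u -> approximable v ->
  {ae mu, forall x, u x = v x} -> approximable u.
Proof.
move=> mu' hv huv; apply: approximable_lim => // eps e0; exists v => //.
rewrite /energy (@ae_eq_integral _ _ _ mu setT (cst 0%E)) ?integral0 ?lte_fin //.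
- by apply: measurable_sqr; apply: measurable_funB => //; exact: hv.1.
by apply: filterS huv => x /= -> _; rewrite subrr expr0n.
Qed.

(* The arc is the superlevel set [cos (2 pi (t - a / 2)) > cos (pi a)] of a
   trigonometric polynomial, up to its end points. *)
Lemma approximable_arc (a : R) : 0 < a < 1 -> approximable (\1_(phi @^-1` `]-oo, a[)).
Proof.
(* Away from the end points of the arc, [y] is below 1 / 2 inside it and above 1 / 2 outside, as
   [steep] requires. *)
move=> ha; pose y t := 1 / 2 + (cos (pi * a) - cos (2 * pi * (t - a / 2))) / 4.
have y01 t : 0 <= y t <= 1.
  have := cos_le1 (pi * a); have := cos_geN1 (pi * a).
  have := cos_le1 (2 * pi * (t - a / 2)); have := cos_geN1 (2 * pi * (t - a / 2)).
  by rewrite /y; lra.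
have ty n : trig_poly (fun t => steep n (y t)).
  have -> : (fun t => steep n (y t)) = (fun t => (1 + (-1) * ((1 / 2 + cos (pi * a) / 4) +
      (- 1 / 4) * cos (2 * pi * (t - a / 2))) ^+ n) ^+ (2 ^ n)).
    apply/funext => t; rewrite /steep; congr (_ ^+ _); rewrite mulN1r; congr (1 - _ ^+ _).
    by rewrite /y; lra.
  apply: trig_polyX; apply: trig_polyD; first exact: trig_poly_cst.
  apply: trig_polyM; first exact: trig_poly_cst.
  apply: trig_polyX; apply: trig_polyD; first exact: trig_poly_cst.
  by apply: trig_polyM; [exact: trig_poly_cst|exact: trig_poly_cos].
have mI : measurable (phi @^-1` `]-oo, a[) by apply: measurable_preimage.
have mu1 : measurable_fun setT (\1_(phi @^-1` `]-oo, a[) : T -> R) by exact: measurable_indic.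
have mv n := (approximable_poly (ty n)).1.
apply: approximable_lim => // eps e0.
have [||||n hn] := @dominated_small
  (fun n x => (\1_(phi @^-1` `]-oo, a[) x - steep n (y (phi x))) ^+ 2) (fun=> 1) eps _ _ _ _ e0.
- by move=> n; apply: measurable_funX; exact: measurable_funB.
- by apply: finite_measure_integrable_cst.
- move=> n x; rewrite sqr_ge0 /= -real_normK ?num_real // exprn_ile1 //.
  have := steep01 n (y01 (phi x)); rewrite indicE ler_norml.
  by case: (x \in _); rewrite ?mulr1n ?mulr0n; lra.
- have m1 (b : R) : measurable (phi @^-1` [set b]).
    by rewrite -set_itv1; apply: measurable_preimage.
  (* At the end points [y] equals 1 / 2, where [steep] tends to neither 0 nor 1. *)
  have [N [mN N0 sN]] : mu.-negligible (phi @^-1` [set 0] `|` phi @^-1` [set a]).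
    by apply: negligibleU; apply/(negligibleP mu) => //; exact: phi_atomless.
  exists N; split => // x /= hx; apply: sN; apply: contrapT => /= hn; apply: hx.
  have /not_orP[/eqP x0 /eqP xa] := hn; have /andP[p0 p1] := phi_itv x.
  have tx : 0 < phi x < 1 by rewrite lt_def x0 p0.
  have [l1 l2] := cos_arc ha tx.
  have yx : (y (phi x) < 1 / 2) = (phi x < a) /\ y (phi x) != 1 / 2.
    case: (ltgtP (phi x) a) xa => // hxa _.
      by have := l1 hxa; rewrite /y => h; split; [apply/idP; lra|apply/negP => /eqP; lra].
    have := l2 hxa; rewrite /y => h.
    by split; [apply/negbTE; rewrite -leNgt; lra|apply/negP => /eqP; lra].
  have [r /andP[r0 r1] hr] := steep_approx (y01 (phi x)) yx.2.
  apply: (@squeeze_cvgr _ _ _ _ (fun=> 0) (fun n => r ^+ n)); last 2 first.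
  - exact: cvg_cst.
  - by apply: cvg_expr; rewrite ger0_norm.
  near=> n; rewrite sqr_ge0 /=; have := hr n; rewrite yx.1 indicE.
  rewrite (_ : (x \in _) = (phi x < a)); last first.
    by apply/idP/idP => [/set_mem|h]; rewrite ?mem_set //= ?in_itv.
  move=> h; rewrite -real_normK ?num_real // expr2; apply: le_trans (h).
  by rewrite ler_piMl //; apply: le_trans h _; rewrite exprn_ile1 // ltW.
exists (fun x => steep n (y (phi x))); first exact: (approximable_poly (ty n)).
exact: hn.
Unshelve. all: by end_near.
Qed.

(** Dynkin induction from rays, which meet [0, 1) in arcs starting at 0; dominated convergence
    handles disjoint unions. *)
Lemma approximable_preimage B : measurable B -> approximable (\1_(phi @^-1` B)).
Proof.
move=> mB; suff : forall S, <<s @RGenInftyO.G R >> S -> approximable (\1_(phi @^-1` S)).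
  by apply; rewrite -[X in X B]RGenInftyO.measurableE.
apply: (@dynkin_induction _ (measurableTypeR R) (@RGenInftyO.G R)) => //.
- exact: RGenInftyO.measurableE.
- move=> _ _ [x ->] [y ->]; exists (Num.min x y).
  by apply/seteqP; split => z /=; rewrite !in_itv /= lt_min => /andP.
- have := approximable_poly (trig_poly_cst 1); congr approximable.
  by apply/funext => x; rewrite preimage_setT indicT.
- move=> _ [a ->]; have [a0|a0] := leP a 0.
    have := approximable_poly (trig_poly_cst 0); congr approximable.
    apply/funext => x; rewrite indicE memNset //= in_itv /=.
    by have := phi_itv x; lra.
  have [a1|a1] := leP 1 a; last by apply: approximable_arc; rewrite a0.
  have := approximable_poly (trig_poly_cst 1); congr approximable.
  apply/funext => x; rewrite indicE mem_set //= in_itv /=.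
  by have := phi_itv x; lra.
- move=> S mS hS; have := approximableD (approximable_poly (trig_poly_cst 1)) (approximableZ (-1) hS).
  congr approximable; apply/funext => x; rewrite preimage_setC !indicE in_setC mulN1r.
  by case: (x \in _); rewrite /= ?subrr ?subr0.
move=> S mS tS hS; apply: approximable_lim.
  by apply: measurable_indic; apply: measurable_preimage => //; exact: bigcupT_measurable.
have mSi i : measurable_fun setT (\1_(phi @^-1` S i) : T -> R).
  by apply: measurable_indic; exact: measurable_preimage.
pose D n x := \1_(phi @^-1` (\bigcup_k S k)) x - \sum_(i < n) \1_(phi @^-1` S i) x : R.
have hD x : (exists k, forall n, D n x = (n <= k)%N%:R) \/ (forall n, D n x = 0).
  case: (pselect (exists k, S k (phi x))) => [[k hk]|hn]; last first.
    right=> n; rewrite /D indicE memNset; last by move=> [k _ ?]; apply: hn; exists k.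
    rewrite big1 ?subrr // => i _; rewrite indicE memNset // => ?; apply: hn.
    by exists (i : nat).
  left; exists k => n; rewrite /D indicE mem_set; last by exists k.
  have -> : \sum_(i < n) \1_(phi @^-1` S i) x = (k < n)%N%:R :> R.
    have hi i : (x \in phi @^-1` S i) = (i == k).
      apply/idP/eqP => [/set_mem hi|->]; last exact/mem_set.
      by apply: tS => //; exists (phi x).
    elim: n => [|n IH]; first by rewrite big_ord0.
    by rewrite big_ord_recr /= IH indicE hi -natrD ltnS; congr (_ %:R); case: (ltngtP k n).
  by rewrite ltnNge; case: (n <= k)%N; rewrite /= ?subrr ?subr0.
move=> eps e0.
have mD n : measurable_fun setT (D n).
  apply: measurable_funB; last exact: measurable_sum.
  by apply: measurable_indic; apply: measurable_preimage => //; exact: bigcupT_measurable.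
have [||||n hn] := @dominated_small (fun n x => D n x ^+ 2) (fun=> 1) eps _ _ _ _ e0.
- by move=> n; apply: measurable_funX.
- by apply: finite_measure_integrable_cst.
- move=> n x; rewrite sqr_ge0 /=; have [[k ->]|->] := hD x; last by rewrite expr0n.
  by case: (n <= k)%N; rewrite ?expr1n ?expr0n.
- apply: aeW => x; apply: cvg_near_cst; have [[k hk]|h0] := hD x.
    by exists k.+1 => // n /= hn; rewrite hk leqNgt hn expr0n.
  by apply: nearW => n; rewrite h0 expr0n.
exists (fun x => \sum_(i < n) \1_(phi @^-1` S i) x); last exact: hn.
exact: (@approximable_sum n (fun i => \1_(phi @^-1` S i))).
Qed.

(** Invertibility enters here: on [X], membership in [A] is a Borel condition on [phi x], because
    [psi] inverts [phi]. *)
Lemma approximable_indic A : measurable A -> approximable (\1_A).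
Proof.
move=> mA; apply: (approximable_ae _ (approximable_preimage (measurable_preimage mpsi mA))).
  exact: measurable_indic.
exists (~` X); split => //; first exact: measurableC.
move=> x /= h Xx; apply: h; rewrite !indicE; congr (_ %:R); congr nat_of_bool.
by rewrite -{1}(phiK Xx); apply/idP/idP => /set_mem h; exact/mem_set.
Qed.

Import HBSimple.
Import HBNNSimple.

Lemma approximable_nnsfun (g : {nnsfun T >-> R}) : approximable g.
Proof.
pose s := finmap.enum_fset (fset_set (range g)).
have := @approximable_sum (size s) (fun i x => s`_i * \1_(g @^-1` [set s`_i]) x).
move=> h; have {}h := h (fun i => approximableZ _ (approximable_indic _)).
rewrite (_ : (g : T -> R) = fun x => \sum_(i < size s) (s`_i * \1_(g @^-1` [set s`_i]) x)).
  by apply: h.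
by apply/funext => x; rewrite fimfunEord.
Qed.

Lemma approximable_ge0 (u : T -> R) : measurable_fun setT u -> (forall x, 0 <= u x) ->
  (energy u < +oo)%E -> approximable u.
Proof.
move=> mu' u0 fu; apply: approximable_lim => // eps e0.
have mE : measurable_fun setT (EFin \o u) by exact/measurable_EFinP.
pose g := nnsfun_approx measurableT mE.
have gle n x : 0 <= g n x <= u x.
  rewrite /g nnsfun_approxE; apply/andP; split.
    by rewrite -nnsfun_approxE.
  by rewrite -lee_fin; apply: le_approx => // y _; rewrite lee_fin.
have gcv x : g n x @[n --> \oo] --> u x.
  have := @cvg_nnsfun_approx _ T R setT measurableT _ mE (fun y _ => u0 y) x I.
  by move=> /fine_cvgP[].
have [||||n hn] := @dominated_small (fun n x => (u x - g n x) ^+ 2) (fun x => u x ^+ 2) eps _ _ _ _ e0.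
- by move=> n; apply: measurable_funX; exact: measurable_funB.
- apply/integrableP; split; first exact: measurable_sqr.
  by under eq_integral do rewrite /= ger0_norm ?sqr_ge0 //.
- move=> n x; have := gle n x; rewrite sqr_ge0 /= => h.
  by rewrite ler_sqr ?nnegrE; lra.
- apply: aeW => x.
  rewrite -[X in _ --> X](mulr0 (0 : R)) -(subrr (u x)).
  under eq_cvg do rewrite expr2.
  by apply: cvgM; apply: cvgB => //; exact: cvg_cst.
by exists (g n); [exact: approximable_nnsfun|exact: hn].
Qed.

Lemma approximable_L2 (u : T -> R) : measurable_fun setT u -> (energy u < +oo)%E ->
  approximable u.
Proof.
move=> mu' fu.
have pos (v : T -> R) : measurable_fun setT v -> (forall x, 0 <= v x <= `|u x|) -> approximable v.
  move=> mv hv; apply: approximable_ge0 => // [x|]; first by case/andP: (hv x).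
  apply: le_lt_trans fu; apply: ge0_le_integral => //.
  - by move=> x _; rewrite lee_fin sqr_ge0.
  - exact: measurable_sqr.
  - exact: measurable_sqr.
  - move=> x _; rewrite lee_fin -[u x ^+ 2]real_normK ?num_real //.
    by have /andP[h1 h2] := hv x; rewrite ler_sqr ?nnegrE.
rewrite (_ : u = fun x => Num.max (u x) 0 + (-1) * Num.max (- u x) 0).
  apply: approximableD; first apply: pos.
  - exact: measurable_maxr.
  - by move=> x; rewrite le_max lexx orbT /= ge_max ler_norm normr_ge0.
  apply: approximableZ; apply: pos.
  - by apply: measurable_maxr => //; exact: measurableT_comp.
  - by move=> x; rewrite le_max lexx orbT /= ge_max -normrN ler_norm normr_ge0.
by apply/funext => x; rewrite mulN1r; case: (leP (u x) 0) => h; case: (leP (- u x) 0) => h'; lra.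
Qed.

Lemma character_eigenfunction (k : int) :
  eigenfunction mu F (k%:~R * f) (fun x => expi (2 * pi * k%:~R * phi x)).
Proof.
have mth : measurable_fun setT (fun x => 2 * pi * k%:~R * phi x) by exact: measurable_funM.
split.
  split => /=.
  - exact: measurable_cos.
  - exact: measurable_sin.
  under eq_integral do rewrite cos2Dsin2.
  by rewrite integral_cst // mul1e [X in (X < _)%E](_ : _ = 1%E) ?ltry //; exact: probability_setT.
exists (~` X); split => //; first exact: measurableC.
move=> x /= h Xx; apply: h => n; rewrite phi_iter // /frac -expiD.
set m := Num.floor _.
(* The integer [m] removed by [frac] contributes a whole number of turns. *)
rewrite -[RHS]mulr1 -(@expi_2piz R (- (k * m))) -expiD; congr expi.
by rewrite intrN intrM; ring.
Qed.

Lemma rotation_factor_pure_discrete : pure_discrete_spectrum mu F.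
Proof.
move=> g [mRe mIm fing] eps e0; have e2 : 0 < eps / 2 by lra.
have mR2 := measurable_sqr mRe; have mI2 := measurable_sqr mIm.
have [hR hI] : (energy (fun x => complex.Re (g x)) < +oo)%E /\
    (energy (fun x => complex.Im (g x)) < +oo)%E.
  by split; apply: le_lt_trans fing; apply: ge0_le_integral => //;
    try (by move=> x _; rewrite lee_fin sqr_ge0);
    try (by apply/measurable_EFinP; apply: measurable_funD; apply: measurable_funX);
    move=> x _; rewrite lee_fin ?lerDl ?lerDr sqr_ge0.
have [p [s hs] hp] := (approximable_L2 mRe hR).2 _ e2.
have [q [s' hs'] hq] := (approximable_L2 mIm hI).2 _ e2.
pose S := s ++ [seq ('i%C * ck.1, ck.2) | ck <- s'].
exists (size S), (fun k => (nth (0, 0) S k).1),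
  (fun k x => expi (2 * pi * (nth (0, 0) S k).2%:~R * phi x)).
split; first by move=> k; exists ((nth (0, 0) S k).2%:~R * f); exact: character_eigenfunction.
have e x : \sum_(k < size S) (nth (0, 0) S k).1 * expi (2 * pi * (nth (0, 0) S k).2%:~R * phi x)
    = (p (phi x) +i* q (phi x))%C.
  pose F' (ck : R[i] * int) := ck.1 * expi (2 * pi * ck.2%:~R * phi x).
  rewrite -(big_mkord xpredT (fun k => F' (nth (0, 0) S k))) -(big_nth (0, 0) xpredT F').
  rewrite big_cat big_map /F' /= -hs; under eq_bigr do rewrite -mulrA.
  rewrite -mulr_sumr -hs'; apply/eqP; rewrite eq_complex /=.
  by apply/andP; split; apply/eqP; ring.
rewrite (_ : eps%:E = ((eps / 2)%:E + (eps / 2)%:E)%E); last first.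
  by rewrite -EFinD; congr EFin; lra.
apply: le_lt_trans (lteD hp hq).
have mp := measurable_trig_poly (ex_intro _ s hs).
have mq := measurable_trig_poly (ex_intro _ s' hs').
rewrite /energy -ge0_integralD //.
- by rewrite le_eqVlt; apply/orP; left; apply/eqP; apply: eq_integral => x _;
    rewrite e -EFinD; case: (g x).
- by move=> x _; rewrite lee_fin sqr_ge0.
- by apply: measurable_sqr; exact: measurable_funB.
- by move=> x _; rewrite lee_fin sqr_ge0.
- by apply: measurable_sqr; exact: measurable_funB.
Qed.

End PureDiscreteSpectrum.

(** Apply the hypothesis to the longer block of length [n1 + l]: its copy at [n2] contains, at
    [n2 + n1], a copy of the block at [n1], which is itself a copy of the initial one. *)
Lemma recurrent_from_start (R : realType) (sigma : nat -> word -> word) (C : R) :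
  (forall l : nat, exists n : nat,
     [/\ (1 <= n)%N,
         forall i : nat, (i < l)%N -> sigma (n + i)%N = sigma i &
         balanced C (language sigma (n + l))]) ->
  forall l m, exists n : nat,
     [/\ (m <= n)%N,
         forall i : nat, (i < l)%N -> sigma (n + i)%N = sigma i &
         balanced C (language sigma (n + l))].
Proof.
move=> h l; elim=> [|m [n1 [mn1 r1 _]]]; first by have [n [_ r b]] := h l; exists n.
have [n2 [n20 r2 b2]] := h (n1 + l)%N; exists (n2 + n1)%N; split.
- by rewrite -[m.+1]add1n leq_add.
- by move=> i hi; rewrite -addnA r2 ?ltn_add2l // r1.
by rewrite -addnA.
Qed.

Theorem theorem2 (R : realType) (sigma : nat -> word -> word)
  (sigma_subst : forall n, is_substitution (sigma n))
  (sigma_unimodular : forall n, unimodular (sigma n))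
  (sigma_primitive : primitive sigma)
  (sigma_irreducible : algebraically_irreducible sigma)
  (sigma_balanced : exists2 C : R, 0 < C &
     forall l : nat, exists n : nat,
       [/\ (1 <= n)%N,
           forall i : nat, (i < l)%N -> sigma (n + i)%N = sigma i &
           balanced C (language sigma (n + l))])
  (mu : probability infinite_word R)
  (mu_invariant : shift_invariant_on (sadic_shift sigma) mu) :
  (exists alpha : R,
     measurably_conjugate mu wshift (circle_measure R) (rotation alpha)) /\
  pure_discrete_spectrum mu wshift.
Proof.
have [C C0 hrec] := sigma_balanced; have [muX mu_shift] := mu_invariant.
have recurrent := recurrent_from_start hrec.
have [f f_freq] := exists_frequency R sigma_subst.
have mX := measurable_sadic sigma; set X := sadic_shift sigma in muX mX.
have X_shift w : X w -> X (wshift w).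
  by move=> Xw a n; apply: (Xw a.+1 n).
have [N [_ _ balN]] := recurrent 0%N 0%N; rewrite addn0 in balN.
have [B hB] := bounded_dev sigma_subst sigma_unimodular sigma_primitive f_freq balN.
have h_limsup w : X w -> is_limsup (dev f w) (upper_dev f w).
  by move=> Xw; apply: (@is_limsup_upper_dev _ _ _ B) => n; apply/hB/sadic_language.
have h_shift w : X w -> upper_dev f (wshift w) = upper_dev f w - (w 0%N == ord0)%:R + f.
  move=> Xw; apply: is_limsup_uniq (h_limsup _ (X_shift w Xw)) _.
  exact/is_limsup_wshift/h_limsup.
have irr (k : int) n : (0 < n)%N -> n%:R * f != k%:~R.
  (* A relation [n * f = k] would make the transversal part of this nonzero vector vanish, against
     [tr_lower]. *)
  move=> n0; apply/eqP => e; pose v : vec := (k, n%:Z - k).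
  have v0 : v != 0.
    apply/eqP => -[k0 /eqP]; rewrite k0 subr0 => /eqP[n00].
    by rewrite n00 in n0.
  have [kap kap0 hk] := tr_lower sigma_subst sigma_unimodular sigma_primitive f_freq
    (`|v.1| + `|v.2|)%N.
  have tr0 : tr f v = 0.
    by rewrite /tr /= (_ : k + (n%:Z - k) = n%:Z) ?subrKC // -pmulrn mulrC e subrr.
  by have := hk v v0 ltac:(lia) ltac:(lia); rewrite tr0 normr0; lra.
have agree (e : R) : 0 < e -> exists (T0 : nat) (dl : R),
    [/\ (0 < T0)%N, 0 < dl & forall w w' (k : int), X w -> X w' ->
      `|upper_dev f w - upper_dev f w' - k%:~R| < dl ->
      (count (fun t => w t != w' t) (iota 0 T0))%:R <= e * T0%:R].
  move=> e0; have [T0 [dl [T00 dl0 h]]] := close_agree sigma_subst sigma_unimodular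
    sigma_primitive f_freq C0 recurrent e0.
  by exists T0, dl; split => // w w' k Xw Xw'; apply: h; rewrite //; exact: h_limsup.
have mh := measurable_upper_dev f.
split.
  exists f.
  exact: (measurably_conjugate_rotation mX muX mu_shift X_shift mh h_shift irr agree).
have [X1 [X2 [g [X1X mg [mX1 mu1 _] _ [_ _ psiK _]]]]] :=
  phase_conjugacy mX muX mu_shift X_shift mh h_shift irr agree.
apply: (@rotation_factor_pure_discrete _ _ _ mu wshift X1 f (phase (upper_dev f)) (coding f g)) => //.
- exact: measurable_phase.
- exact: phase_itv.
- move=> a; rewrite (mu_phase mX muX mu_shift X_shift mh h_shift irr) //.
  apply: (@subset_measure0 _ _ _ (@lebesgue_measure R) _ [set a]) => //=.
    exact: measurableI (measurable_set1 _) (measurable_itv _).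
  exact: lebesgue_measure_set1.
- move=> n w /X1X Xw; exact: (phase_iter X_shift h_shift).
- exact: measurable_coding.
- by move=> w X1w; apply: psiK; rewrite inE.
Qed.
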